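(* Let $\mathbf{\Gamma}=(\Gamma,R)$ be a gentle bound quiver over a field $k$, let $m\in\mathbb{Z}$ and let $\omega$ be a homotopy band in $\mathbf{\Gamma}$. If $$0\to\mu'\to\bigoplus_{i\in[1,n]}\mu_i\to\mu''\to 0$$ is an almost split sequence in the category of automorphisms of finite dimensional $k$-vector spaces, where $\mu',\mu_1,\dots,\mu_n,\mu''$ are indecomposable automorphisms of finite dimensional vector spaces, then there is an almost split triangle in $\mathcal{K}^b(\mathbf{\Gamma})$ of the form $$Y_{m,\omega,\mu'}\to\bigoplus_{i\in[1,n]}Y_{m,\omega,\mu_i}\to Y_{m,\omega,\mu''}\to Y_{m,\omega,\mu'}[1].$$
   Context: **Quivers.** $[i,j]=\{l\in\mathbb{Z}: i\le l\le j\}$. A quiver $\Gamma$ has vertices $\Gamma_0$, arrows $\Gamma_1$ and maps $s,t:\Gamma_1\to\Gamma_0$ (start, end). A path of length $l\ge1$ is $\sigma=\alpha_1\cdots\alpha_l$ with $s\alpha_i=t\alpha_{i+1}$; $s\sigma=s\alpha_l$, $t\sigma=t\alpha_1$, $\ell(\sigma)=l$; there is also a trivial path of length $0$ at each vertex. A gentle bound quiver is a pair $\mathbf{\Gamma}=(\Gamma,R)$, where $\Gamma$ is a finite quiver without isolated vertices and $R$ is a set of paths of length $2$ such that all sufficiently long paths in $\Gamma$ have a subpath in $R$, and: (i) at each vertex at most two arrows start and at most two arrows end; (ii) for each arrow $\alpha$ there is at most one arrow $\alpha'$ with $s\alpha'=t\alpha$, $\alpha'\alpha\notin R$, and at most one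 arrow $\alpha'$ with $t\alpha'=s\alpha$, $\alpha\alpha'\notin R$; (iii) for each arrow $\alpha$ there is at most one arrow $\alpha'$ with $s\alpha'=t\alpha$, $\alpha'\alpha\in R$, and at most one arrow $\alpha'$ with $t\alpha'=s\alpha$, $\alpha\alpha'\in R$. A path in $\mathbf{\Gamma}$ is a path in $\Gamma$ with no subpath in $R$. Fix string functions $S,T:\Gamma_1\to\{\pm1\}$, i.e. functions with: $S\alpha'=-S\alpha''$ if $s\alpha'=s\alpha''$, $\alpha'\ne\alpha''$; $T\alpha'=-T\alpha''$ if $t\alpha'=t\alpha''$, $\alpha'\neq\alpha''$; and, if $s\alpha'=t\alpha''$, $S\alpha'=-T\alpha''$ when $\alpha'\alpha''\notin R$ and $S\alpha'=T\alpha''$ when $\alpha'\alpha''\in R$ (they exist). **Representations.** $k\mathbf{\Gamma}$ is the $k$-linear category with objects $\Gamma_0$ and $k\mathbf{\Gamma}(x,y)$ having as basis the paths in $\mathbf{\Gamma}$ from $x$ to $y$ (compositions not being paths in $\mathbf{\Gamma}$ are zero). Representations are functors to finite dimensional vector spaces. $P_x$ is the projective representation $P_x(y)=k\mathbf{\Gamma}(x,y)$ and, for a morphism $\varrho$, $p_\varrho:P_{t\varrho}\to P_{s\varrho}$ is $\varrho'\mapsto\varrho'\varrho$. $\mathcal{K}^b(\mathbf{\Gamma})$ is the bounded homotopy category of complexes of (finite dimensional) projective representations of $\mathbf{\Gamma}$, a triangulated category with suspension the degree shift $[1]$, $(X[1])^n=X^{n+1}$. **Homotopy strings.** Adjoin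 to each arrow a formal inverse $\alpha^{-1}$, $s\alpha^{-1}=t\alpha$, $t\alpha^{-1}=s\alpha$, $(\alpha^{-1})^{-1}=\alpha$, $S\alpha^{-1}=T\alpha$, $T\alpha^{-1}=S\alpha$. A homotopy string of length $l\ge1$ is a path $\omega=\alpha_1\cdots\alpha_l$ of arrows and inverse arrows with $\alpha_{i+1}\neq\alpha_i^{-1}$ for all $i$; $S\omega=S\alpha_l$, $T\omega=T\alpha_1$. (There are also homotopy strings of length $0$.) For homotopy strings $\omega',\omega''$ of positive length with $s\omega'=t\omega''$, last letter $\alpha'$ of $\omega'$ and first letter $\alpha''$ of $\omega''$, the composition $\omega'\omega''$ is said to be defined if either $S\omega'=T\omega''$ and $\alpha',\alpha''$ are both arrows or both inverse arrows, or $S\omega'=-T\omega''$ and exactly one of $\alpha',\alpha''$ is an arrow. Every homotopy string $\omega$ of positive length has a unique presentation $\omega=\sigma_1(\omega)\cdots\sigma_L(\omega)$, $L=L(\omega)\geq1$, where for each $i$ either $\sigma_i$ or $\sigma_i^{-1}$ is a path in $\mathbf{\Gamma}$ of positive length and each composition $\sigma_i\sigma_{i+1}$ is defined in this sense. $\deg\omega$ is the number of $i$ for which $\sigma_i$ is a path in $\mathbf{\Gamma}$ minus the number of $i$ for which $\sigma_i^{-1}$ is. Write $\omega^{[i]}$ for the initial part $\sigma_1\cdots\sigma_i$ of $\omega$ ($\omega^{[0]}$ has length $0$ and degree $0$, at the vertex $t\omega$). **Homotopy bands.** A homotopy string $\omega$ is a homotopy band if $\deg\omega=0$, $L(\omega)>0$,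 either $\sigma_1(\omega)$ and $\sigma_{L(\omega)}(\omega)^{-1}$ are paths in $\mathbf{\Gamma}$ or $\sigma_1(\omega)^{-1}$ and $\sigma_{L(\omega)}(\omega)$ are paths in $\mathbf{\Gamma}$, $s\omega=t\omega$, $S\omega=-T\omega$, and there is no homotopy string $\omega'$ with $\ell(\omega')<\ell(\omega)$, $s\omega'=t\omega'$ and $\omega=\omega'^n$ for some $n\geq 1$. **Band complexes.** The category of automorphisms of finite dimensional vector spaces has as objects pairs $(K,\mu)$, $\mu$ an automorphism of a finite dimensional $k$-vector space $K$, and as morphisms linear maps commuting with the automorphisms. Let $\omega$ be a homotopy band, $L=L(\omega)$, $\sigma_l=\sigma_l(\omega)$, $\mu$ an indecomposable automorphism of $K$, $m\in\mathbb{Z}$. Put $\mathcal{J}_{m'}=\{i\in[1,L]: m+\deg\omega^{[i]}=m'\}$. The complex $Y=Y_{m,\omega,\mu}$ has $Y^{m'}=\bigoplus_{i\in\mathcal{J}_{m'}}P_{s\omega^{[i]}}\otimes_kK$, and the component $(d_Y^{m'})_{i,j}$ ($j\in\mathcal{J}_{m'}$, $i\in\mathcal{J}_{m'+1}$) from the $j$-th to the $i$-th summand is the sum of the following contributions over $l\in[1,L]$, where $\mu_1:=\mu$, $\mu_l:=\mathrm{Id}$ for $l>1$, and the index $0$ is read as $L$: if $\sigma_l$ is a path in $\mathbf{\Gamma}$, the term $p_{\sigma_l}\otimes\mu_l$ for $(i,j)=(l,l-1)$; if $\sigma_l^{-1}$ is a path in $\mathbf{\Gamma}$, the term $p_{\sigma_l^{-1}}\otimes\mu_l$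 for $(i,j)=(l-1,l)$. *)

(* Defs.v *)
From HB Require Import structures.
From mathcomp Require Import all_boot all_order all_algebra.
From mathcomp Require Import zify.
Set Implicit Arguments. Unset Strict Implicit. Unset Printing Implicit Defensive.
Import Order.TTheory GRing.Theory Num.Theory.
Local Open Scope ring_scope.

Lemma lfunLE (k : fieldType) (U V : vectType k) (f : U -> V) :
  linear f -> linfun f =1 f.
Proof.
move=> lf; pose m := GRing.isLinear.Build k U V _ f lf.
by move=> u; exact: (@lfunE k U V (HB.pack_for {linear U -> V} f m)).
Qed.

Lemma lin_sumZ (k : fieldType) (U V : lmodType k) (f : U -> V) :
  linear f -> forall (I : finType) (a : I -> k) (F : I -> U),
  f (\sum_i a i *: F i) = \sum_i a i *: f (F i).
Proof.
move=> lf I a F; pose m := GRing.isLinear.Build k U V _ f lf.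
pose g : {linear U -> V} := HB.pack_for {linear U -> V} f m.
rewrite -[f]/(g : U -> V) linear_sum; apply: eq_bigr => i _; exact: linearZ.
Qed.

Lemma limg_fullP (k : fieldType) (U V : vectType k) (g : 'Hom(U, V)) :
  limg g = fullv -> forall v, g (g^-1%VF v) = v.
Proof. by move=> gE v; rewrite limg_lfunVK // gE memvf. Qed.

Section DSum.
Import VectorInternalTheory.
Variables (k : fieldType) (I : finType) (V : I -> vectType k).
Definition dsum := {dffun forall i : I, V i}.
HB.instance Definition _ := Choice.on dsum.
Implicit Types u v w : dsum.
Definition dsum_add u v : dsum := [ffun i => u i + v i].
Definition dsum_opp u : dsum := [ffun i => - u i].
Definition dsum_zero : dsum := [ffun i => 0].
Definition dsum_scale (a : k) u : dsum := [ffun i => a *: u i].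
Fact dsum_addA : associative dsum_add.
Proof. by move=> u v w; apply/ffunP=> i; rewrite !ffunE addrA. Qed.
Fact dsum_addC : commutative dsum_add.
Proof. by move=> u v; apply/ffunP=> i; rewrite !ffunE addrC. Qed.
Fact dsum_add0 : left_id dsum_zero dsum_add.
Proof. by move=> u; apply/ffunP=> i; rewrite !ffunE add0r. Qed.
Fact dsum_addN : left_inverse dsum_zero dsum_opp dsum_add.
Proof. by move=> u; apply/ffunP=> i; rewrite !ffunE addNr. Qed.
HB.instance Definition _ :=
  GRing.isZmodule.Build dsum dsum_addA dsum_addC dsum_add0 dsum_addN.
Fact dsum_scaleA a b u : dsum_scale a (dsum_scale b u) = dsum_scale (a * b) u.
Proof. by apply/ffunP=> i; rewrite !ffunE scalerA. Qed.
Fact dsum_scale1 : left_id 1 dsum_scale.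
Proof. by move=> u; apply/ffunP=> i; rewrite !ffunE scale1r. Qed.
Fact dsum_scaleDr : right_distributive dsum_scale +%R.
Proof. by move=> a u v; apply/ffunP=> i; rewrite !ffunE scalerDr. Qed.
Fact dsum_scaleDl u : {morph dsum_scale^~ u : a b / a + b}.
Proof. by move=> a b; apply/ffunP=> i; rewrite !ffunE scalerDl. Qed.
HB.instance Definition _ := GRing.Zmodule_isLmodule.Build k dsum
  dsum_scaleA dsum_scale1 dsum_scaleDr dsum_scaleDl.

Lemma dsumDE u v i : (u + v) i = u i + v i. Proof. exact: ffunE. Qed.
Lemma dsumZE a u i : (a *: u) i = a *: u i. Proof. exact: ffunE. Qed.
Lemma dsum0E i : (0 : dsum) i = 0. Proof. exact: ffunE. Qed.
Lemma dsum_sumE (J : Type) (r : seq J) (P : pred J) (F : J -> dsum) i :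
  (\sum_(j <- r | P j) F j) i = \sum_(j <- r | P j) F j i.
Proof. by elim/big_rec2: _ => [|j _ y _ <-]; rewrite ?dsum0E ?dsumDE. Qed.

Fact dsum_vect_iso : Vector.axiom #|{: {i : I & 'I_(dim (V i))}}| dsum.
Proof.
pose fr u : 'rV[k]_#|{: {i : I & 'I_(dim (V i))}}| :=
  \row_c v2r (u (tag (enum_val c))) 0 (tagged (enum_val c)).
exists fr => [a u v|].
  by apply/rowP=> c; rewrite !mxE dsumDE dsumZE linearP !mxE.
pose gr (r : 'rV[k]_#|{: {i : I & 'I_(dim (V i))}}|) : dsum :=
  [ffun i => r2v (\row_j r 0 (enum_rank (Tagged (fun i => 'I_(dim (V i))) j)))].
exists gr => [u|r].
  apply/ffunP=> i; rewrite ffunE -[RHS]v2rK; congr r2v.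
  by apply/rowP=> j; rewrite !mxE enum_rankK.
apply/rowP=> c; rewrite !mxE ffunE r2vK !mxE; congr (r _ _).
by rewrite -[RHS]enum_valK; congr enum_rank; case: (enum_val c).
Qed.
HB.instance Definition _ := Lmodule_hasFinDim.Build k dsum dsum_vect_iso.

Lemma dim_dsum0 : (forall i, dim (V i) = 0)%N -> dim (dsum : vectType k) = 0%N.
Proof.
move=> V0; apply: (@eq_card0 {: {i : I & 'I_(dim (V i))}}).
by case=> i j; exfalso; move: j; rewrite V0; case.
Qed.

Definition dsum_inj (i : I) : 'Hom(V i, dsum) :=
  linfun (fun x : V i => [ffun j => dfwith (fun j => 0) x j] : dsum).
Definition dsum_proj (i : I) : 'Hom(dsum, V i) := linfun (fun u : dsum => u i).

Lemma dsum_injE i x j : dsum_inj i x j = dfwith (fun j => 0 : V j) x j.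
Proof.
rewrite /dsum_inj lfunLE ?ffunE // => a u v.
apply/ffunP=> l; rewrite dsumDE dsumZE !ffunE.
have [<-{l}|ne] := eqVneq i l; first by rewrite !dfwith_in.
by rewrite !dfwith_out // scaler0 addr0.
Qed.
Lemma dsum_projE i u : dsum_proj i u = u i.
Proof. by rewrite /dsum_proj lfunLE // => a v w /=; rewrite dsumDE dsumZE. Qed.
Lemma dsum_decomp u : u = \sum_i dsum_inj i (u i).
Proof.
apply/ffunP=> j; rewrite dsum_sumE (bigD1 j) //= dsum_injE dfwith_in.
rewrite big1 ?addr0 // => i ne; rewrite dsum_injE dfwith_out //.
Qed.
End DSum.

Section DSumMx.
Variables (k : fieldType) (I J : finType).
Variables (V : J -> vectType k) (W : I -> vectType k).
Definition dsum_mx (M : forall i j, 'Hom(V j, W i)) : 'Hom(dsum V, dsum W) :=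
  linfun (fun u : dsum V => [ffun i => \sum_j M i j (u j)] : dsum W).
Lemma dsum_mxE M u i : dsum_mx M u i = \sum_j M i j (u j).
Proof.
rewrite /dsum_mx lfunLE ?ffunE // => a v w; apply/ffunP=> l.
rewrite dsumDE dsumZE !ffunE scaler_sumr -big_split /=.
by apply: eq_bigr => j _; rewrite dsumDE dsumZE linearP.
Qed.
End DSumMx.

Section DSumDiag.
Variables (k : fieldType) (I : finType) (V W : I -> vectType k).
Definition dsum_diag (f : forall i, 'Hom(V i, W i)) : 'Hom(dsum V, dsum W) :=
  linfun (fun u : dsum V => [ffun i => f i (u i)] : dsum W).
Lemma dsum_diagE f u i : dsum_diag f u i = f i (u i).
Proof.
rewrite /dsum_diag lfunLE ?ffunE // => a v w; apply/ffunP=> l.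
by rewrite dsumDE dsumZE !ffunE linearP.
Qed.
End DSumDiag.

(* The map U1 * U2 -> V1 * V2 with matrix [a b; c d]. *)
Section PairMx.
Variables (k : fieldType) (U1 U2 V1 V2 : vectType k).
Definition pair_mx (a : 'Hom(U1, V1)) (b : 'Hom(U2, V1))
    (c : 'Hom(U1, V2)) (d : 'Hom(U2, V2)) : 'Hom((U1 * U2)%type, (V1 * V2)%type) :=
  linfun (fun u : U1 * U2 => (a u.1 + b u.2, c u.1 + d u.2)).
Lemma pair_mxE a b c d u :
  pair_mx a b c d u = (a u.1 + b u.2, c u.1 + d u.2).
Proof.
rewrite /pair_mx lfunLE // => s v w /=; congr (_, _).
  by rewrite !linearP /= scalerDr addrACA.
by rewrite !linearP /= scalerDr addrACA.
Qed.
Definition pair_in2 : 'Hom(U2, (U1 * U2)%type) := linfun (fun u : U2 => (0 : U1, u)).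
Definition pair_in1 : 'Hom(U1, (U1 * U2)%type) := linfun (fun u : U1 => (u, 0 : U2)).
Definition pair_pr1 : 'Hom((U1 * U2)%type, U1) := linfun (fun u : U1 * U2 => u.1).
Lemma pair_in1E u : pair_in1 u = (u, 0).
Proof. by rewrite /pair_in1 lfunLE // => s v w; rewrite [RHS]surjective_pairing /= scaler0 addr0. Qed.
Lemma pair_in2E u : pair_in2 u = (0, u).
Proof. by rewrite /pair_in2 lfunLE // => s v w; rewrite [RHS]surjective_pairing /= scaler0 addr0. Qed.
Lemma pair_pr1E u : pair_pr1 u = u.1.
Proof. by rewrite /pair_pr1 lfunLE. Qed.
End PairMx.

Section Automorphisms.
Variable k : fieldType.

Record autom := Autom {
  aspace :> vectType k;
  aact : 'End(aspace);
  aact_inj : lker aact = 0%VS }.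

Record ahom (A B : autom) := AHom {
  amap :> 'Hom(A, B);
  amapP : (amap \o aact A)%VF = (aact B \o amap)%VF }.

Definition asplit_mono (A B : autom) (f : ahom A B) :=
  exists r : ahom B A, (r \o f)%VF = \1%VF.
Definition asplit_epi (A B : autom) (f : ahom A B) :=
  exists s : ahom B A, (f \o s)%VF = \1%VF.
Definition aiso (A B : autom) :=
  exists (f : ahom A B) (g : ahom B A),
    (g \o f)%VF = \1%VF /\ (f \o g)%VF = \1%VF.

Fact dsum_aut_inj (I : finType) (A : I -> autom) :
  lker (dsum_diag (fun i => aact (A i))) = 0%VS.
Proof.
apply/eqP/lker0P => u v uv; apply/ffunP=> i.
have /lker0P inj : lker (aact (A i)) == 0%VS by rewrite aact_inj.
by apply: inj; rewrite -!(dsum_diagE (fun i => aact (A i))) uv.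
Qed.
Definition asum (I : finType) (A : I -> autom) : autom :=
  Autom (dsum_aut_inj A).

Definition azero (A : autom) := fullv = 0%VS :> {vspace A}.

Definition aindecomposable (A : autom) :=
  ~ azero A /\
  forall A1 A2 : autom,
    aiso A (asum (fun b : bool => if b then A1 else A2)) -> azero A1 \/ azero A2.

Definition aleft_almost_split (A B : autom) (f : ahom A B) :=
  ~ asplit_mono f /\
  forall (C : autom) (h : ahom A C), ~ asplit_mono h ->
    exists h' : ahom B C, (h' \o f)%VF = h.

Definition aright_almost_split (B C : autom) (g : ahom B C) :=
  ~ asplit_epi g /\
  forall (A : autom) (h : ahom A C), ~ asplit_epi h ->
    exists h' : ahom A B, (g \o h')%VF = h.

Definition almost_split_sequence (A B C : autom) (f : ahom A B) (g : ahom B C) :=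
  [/\ lker f = 0%VS, limg f = lker g & limg g = fullv] /\
  aleft_almost_split f /\ aright_almost_split g.

End Automorphisms.

(* [rels a b] means that [src a = tgt b] and the length two path [ab]
   (first [b], then [a]) belongs to R. *)
Record bound_quiver := BoundQuiver {
  vertex : finType;
  arrow : finType;
  src : arrow -> vertex;
  tgt : arrow -> vertex;
  rels : rel arrow }.

Record is_gentle (Q : bound_quiver) : Prop := IsGentle {
  rels_composable : forall a b : arrow Q, rels a b -> src a = tgt b;
  no_isolated_vertex : forall x : vertex Q, exists a, src a = x \/ tgt a = x;
  rels_bounding : exists N : nat, forall p : seq (arrow Q),
    sorted (fun a b => src a == tgt b) p -> (N <= size p)%N ->
    exists a b, rels a b /\ infix [:: a; b] p;
  src_le2 : forall x : vertex Q, (#|[set a | src a == x]| <= 2)%N;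
  tgt_le2 : forall x : vertex Q, (#|[set a | tgt a == x]| <= 2)%N;
  nrels_after : forall a b b' : arrow Q, src b = tgt a -> src b' = tgt a ->
    ~~ rels b a -> ~~ rels b' a -> b = b';
  nrels_before : forall a b b' : arrow Q, tgt b = src a -> tgt b' = src a ->
    ~~ rels a b -> ~~ rels a b' -> b = b';
  rels_after : forall a b b' : arrow Q, src b = tgt a -> src b' = tgt a ->
    rels b a -> rels b' a -> b = b';
  rels_before : forall a b b' : arrow Q, tgt b = src a -> tgt b' = src a ->
    rels a b -> rels a b' -> b = b' }.

Record gentle := Gentle {
  gentle_quiver :> bound_quiver;
  gentleP : is_gentle gentle_quiver }.

Section Paths.
Variable G : gentle.

(* [walk y p x]: p is a path in the quiver from x to y, whose last
   arrow is traversed first. *)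
Fixpoint walk (y : vertex G) (p : seq (arrow G)) (x : vertex G) : bool :=
  if p is a :: p' then (tgt a == y) && walk (src a) p' x else y == x.

Definition gpath (x y : vertex G) (p : seq (arrow G)) : bool :=
  walk y p x && sorted (fun a b => ~~ rels a b) p.

Definition nrel (a b : arrow G) : bool := (src a == tgt b) && ~~ rels a b.

Lemma walk_cat y p q x :
  walk y (p ++ q) x = [exists z, walk y p z && walk z q x].
Proof.
elim: p y => [|a p IH] y /=.
  apply/idP/existsP=> [w|[z /andP[/eqP-> //]]]; by exists y; rewrite eqxx.
rewrite IH; apply/andP/existsP=> [[ta /existsP[z w]]|[z /andP[/andP[ta w] w']]].
  by exists z; rewrite ta.
by split=> //; apply/existsP; exists z; rewrite w.
Qed.

Lemma walk_uniq_src y p x x' : p != [::] -> walk y p x -> walk y p x' -> x = x'.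
Proof.
elim: p y => // a p IH y _ /= /andP[_ w] /andP[_ w'].
case: p IH w w' => [|b p] IH; first by move=> /= /eqP<- /eqP<-.
by move=> w w'; apply: (IH (src a)).
Qed.

Lemma gpath_sorted x y p : gpath x y p -> sorted nrel p.
Proof.
case: p => // a p /andP[/= /andP[_ w]] sp {y}.
elim: p a w sp => //= b p IH a /andP[/eqP tb w] /andP[nr sp].
by rewrite /nrel nr tb eqxx /=; apply: IH.
Qed.

Lemma ex_path_bound :
  exists N, [forall p : N.-tuple (arrow G), ~~ sorted nrel p].
Proof.
have [N HN] := rels_bounding (gentleP G).
exists N; apply/forallP=> p; apply/negP=> sp.
have [||a [b [rab /infixP[p1 [p2 pE]]]]] := HN p.
- by apply: sub_sorted sp => a b /andP[].
- by rewrite size_tuple.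
have : infix [:: a; b] p by rewrite pE; apply: infix_infix.
move: sp; rewrite pE => /cat_sorted2[_] /=.
by rewrite /nrel rab andbF.
Qed.

Definition path_bound : nat := ex_minn ex_path_bound.

Lemma size_gpath x y p : gpath x y p -> (size p <= path_bound)%N.
Proof.
move=> /gpath_sorted sp; rewrite leqNgt; apply/negP=> lt.
move: lt; rewrite /path_bound; case: ex_minnP => N /forallP HN _ lt.
have sz : size (take N p) == N by rewrite size_take lt.
by move: (HN (Tuple sz)); rewrite /= take_sorted.
Qed.

(* The finite type of paths from x to y containing no subpath in R;
   [path_bound] bounds the length of all of them. *)
Definition Path (x y : vertex G) : Type :=
  {p : path_bound.-bseq (arrow G) | gpath x y p}.
HB.instance Definition _ x y := Finite.on (Path x y).

Definition arrows x y (p : Path x y) : seq (arrow G) := sval p.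
Coercion arrows : Path >-> seq.

Lemma arrowsP x y (p : Path x y) : gpath x y p. Proof. exact: valP p. Qed.
Lemma arrows_inj x y : injective (@arrows x y).
Proof. by move=> p q /val_inj/val_inj. Qed.

Definition mkPath x y p (h : gpath x y p) : Path x y :=
  exist _ (Bseq (size_gpath h)) h.
Lemma mkPathE x y p (h : gpath x y p) : mkPath h = p :> seq _. Proof. by []. Qed.
Definition path1 x : Path x x := mkPath (p := [::]) (introT andP (conj (eqxx x) isT)).

Lemma eq_arrows x y (p q : Path x y) : (p == q :> seq _) = (p == q).
Proof. by apply/eqP/eqP=> [/arrows_inj|->]. Qed.

Lemma gpath_catl x y z p q : gpath x z (p ++ q) -> gpath x y q -> gpath y z p.
Proof.
move=> /andP[]; rewrite walk_cat => /existsP[t /andP[wp wq]] /cat_sorted2[sp sq].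
move=> /andP[wq' _]; apply/andP; split=> //.
have -> // : y = t.
case: q wq wq' {sq} => [|a q] /=; first by move=> /eqP-> /eqP->.
by move=> /andP[/eqP<- _] /andP[/eqP<- _].
Qed.
Lemma gpath_catr x y z p q : gpath x z (p ++ q) -> p != [::] \/ y = z ->
  gpath y z p -> gpath x y q.
Proof.
move=> /andP[]; rewrite walk_cat => /existsP[t /andP[wp wq]] /cat_sorted2[sp sq].
move=> h /andP[wp' _]; apply/andP; split=> //.
have -> // : y = t.
case: p h wp wp' {sp} => [|a p] h wp wp'.
  by move/eqP: wp => <-; move/eqP: wp' => <-.
by apply: walk_uniq_src wp' wp.
Qed.
Lemma gpath_catr' x y z p q : gpath x z (p ++ q) -> gpath y z p -> gpath x y q.
Proof.
move=> h hp; apply: (gpath_catr h) => //.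
by case: p h hp => [|a p]; [right; move: hp => /andP[/eqP->]|left].
Qed.
End Paths.

Section Reps.
Variables (k : fieldType) (G : gentle).
Implicit Types x y z t : vertex G.

(* Elements are the families of coefficients in the basis of paths. *)
Definition kG x y : vectType k := {ffun Path x y -> k^o}.

(* For K = k this is the composition of k Gamma, extended bilinearly from the
   composition of paths; in general it is the action of k Gamma(y, z) on the
   K-valued coefficient families, i.e. on k Gamma(x, y) (x) K. *)
Definition conv (K : vectType k) x y z (e : kG y z) (f : {ffun Path x y -> K}) :
    {ffun Path x z -> K} :=
  [ffun r : Path x z =>
     \sum_(p : Path y z) \sum_(q : Path x y | p ++ q == r :> seq _) e p *: f q].

Definition kcomp x y z (e : kG y z) (f : kG x y) : kG x z :=
  @conv k^o x y z e f.
Definition kid x : kG x x := [ffun p => (p == path1 x)%:R].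

Lemma conv_linearr (K : vectType k) x y z (e : kG y z) :
  linear (@conv K x y z e).
Proof.
move=> a u v; apply/ffunP=> r; rewrite !ffunE scaler_sumr -big_split /=.
apply: eq_bigr => p _; rewrite scaler_sumr -big_split /=.
by apply: eq_bigr => q _; rewrite !ffunE scalerDr !scalerA mulrC.
Qed.
Lemma conv_linearl (K : vectType k) x y z (f : {ffun Path x y -> K}) :
  linear ((@conv K x y z)^~ f).
Proof.
move=> a u v; apply/ffunP=> r; rewrite !ffunE scaler_sumr -big_split /=.
apply: eq_bigr => p _; rewrite scaler_sumr -big_split /=.
by apply: eq_bigr => q _; rewrite !ffunE scalerDl !scalerA.
Qed.

Lemma conv1 (K : vectType k) x y (f : {ffun Path x y -> K}) :
  conv (kid y) f = f.
Proof.
apply/ffunP=> r; rewrite ffunE (bigD1 (path1 y)) //= [X in _ + X]big1 => [|p np].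
  rewrite addr0 (bigD1 r) //= big1 => [|q /andP[/eqP/arrows_inj->]].
    by rewrite ffunE eqxx scale1r addr0.
  by rewrite eqxx.
by rewrite big1 // => q _; rewrite ffunE (negPf np) scale0r.
Qed.

Lemma sum_fact (V : nmodType) x y z (p : Path y z) (w : seq (arrow G))
    (F : seq (arrow G) -> V) :
  gpath x z (p ++ w) ->
  \sum_(q : Path x y | q == w :> seq _) F q = F w.
Proof.
move=> h; have hw := gpath_catr' h (arrowsP p).
rewrite (bigD1 (mkPath hw)) //= big1 ?addr0 // => q /andP[/eqP qw].
by move=> /negP[]; apply/eqP/arrows_inj; rewrite qw.
Qed.

Lemma convA (K : vectType k) x y z t (e : kG z t) (f : kG y z)
    (g : {ffun Path x y -> K}) :
  conv (kcomp e f) g = conv e (conv f g).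
Proof.
apply/ffunP=> /= r; rewrite !ffunE.
transitivity (\sum_(p : Path z t) \sum_(q : Path y z)
   \sum_(s : Path x y | p ++ q ++ s == r :> seq _) (e p * f q) *: g s).
  transitivity (\sum_(u : Path y t) \sum_(s : Path x y | u ++ s == r :> seq _)
     \sum_(p : Path z t) \sum_(q : Path y z | p ++ q == u :> seq _)
        (e p * f q) *: g s).
    apply: eq_bigr => /= u _; apply: eq_bigr => s _; rewrite ffunE scaler_suml.
    by apply: eq_bigr => /= p _; rewrite scaler_suml.
  rewrite (eq_bigr (fun u : Path y t => \sum_(p : Path z t) \sum_(q : Path y z)
     \sum_(s : Path x y) (if (u ++ s == r :> seq _) && (p ++ q == u :> seq _)
          then (e p * f q) *: g s else 0))); last first.
    move=> u _; rewrite (eq_bigr (fun s : Path x y => \sum_(p : Path z t)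
      \sum_(q : Path y z) if p ++ q == u :> seq _ then (e p * f q) *: g s else 0)).
      rewrite exchange_big /=; apply: eq_bigr => /= p _.
      rewrite exchange_big /=; apply: eq_bigr => /= q _.
      rewrite big_mkcond /=; apply: eq_bigr => /= s _.
      by case: (_ == _).
    by move=> s _; apply: eq_bigr => /= p _; rewrite big_mkcond.
  rewrite exchange_big /=; apply: eq_bigr => /= p _.
  rewrite exchange_big /=; apply: eq_bigr => /= q _.
  rewrite exchange_big /= [RHS]big_mkcond; apply: eq_bigr => /= s _ /=.
  case: ifP => [/eqP E|ne].
    have h : gpath y t (p ++ q).
      by apply: gpath_catl (arrowsP s); rewrite -catA E arrowsP.
    rewrite (bigD1 (mkPath h)) //= big1 => [|u nu].
      by rewrite -catA E !eqxx addr0.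
    case: ifP => // /andP[_ /eqP pq]; case/negP: nu.
    by apply/eqP/arrows_inj; rewrite -pq.
  rewrite big1 // => u _; case: ifP => // /andP[/eqP us /eqP pq].
  by rewrite catA pq us eqxx in ne.
apply: eq_bigr => /= p _.
rewrite (eq_bigr (fun q : Path y z => \sum_(s : Path x y)
   if p ++ q ++ s == r :> seq _ then (e p * f q) *: g s else 0)); last first.
  by move=> q _; rewrite big_mkcond.
transitivity (\sum_(v : Path x z | p ++ v == r :> seq _) \sum_(q : Path y z)
   \sum_(s : Path x y | q ++ s == v :> seq _) (e p * f q) *: g s); last first.
  apply: eq_bigr => /= v _; rewrite ffunE scaler_sumr; apply: eq_bigr => q _.
  by rewrite scaler_sumr; apply: eq_bigr => /= s _; rewrite scalerA.
rewrite [RHS]exchange_big /=; apply: eq_bigr => /= q _.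
rewrite (eq_bigr (fun v : Path x z => \sum_(s : Path x y)
  if q ++ s == v :> seq _ then (e p * f q) *: g s else 0)); last first.
  by move=> v _; rewrite big_mkcond.
rewrite exchange_big /=; apply: eq_bigr => /= s _; case: ifP => [/eqP E|ne].
  have h : gpath x z (q ++ s).
    by apply: gpath_catr' (arrowsP p); rewrite E arrowsP.
  rewrite (bigD1 (mkPath h)) /= ?E ?eqxx // big1 ?addr0 // => v /andP[_ nv].
  case: ifP => // /eqP qs; case/negP: nv.
  by apply/eqP/arrows_inj; rewrite -qs.
rewrite big1 // => v /eqP pv; case: ifP => // /eqP qs.
by rewrite qs pv eqxx in ne.
Qed.

Record rep := Rep {
  robj :> vertex G -> vectType k;
  ract : forall x y, kG x y -> 'Hom(robj x, robj y);
  ract_linear : forall x y, linear (@ract x y);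
  ract1 : forall x, ract (kid x) = \1%VF;
  ractM : forall x y z (e : kG y z) (f : kG x y),
    ract (kcomp e f) = (ract e \o ract f)%VF }.

Record rhom (M N : rep) := RHom {
  rmap :> forall x, 'Hom(M x, N x);
  rmapP : forall x y (e : kG x y),
    (rmap y \o ract M e = ract N e \o rmap x)%VF }.

Definition projective (P : rep) :=
  forall (M N : rep) (g : rhom M N) (f : rhom P N),
    (forall x, limg (g x) = fullv) ->
    exists h : rhom P M, forall x, (g x \o h x = f x)%VF.

Lemma rmapE M N (f : rhom M N) x y (e : kG x y) v :
  f y (ract M e v) = ract N e (f x v).
Proof. by move/lfunP/(_ v): (rmapP f e); rewrite !lfunE. Qed.

Definition rid (M : rep) : rhom M M.
Proof. by exists (fun x => \1%VF) => x y e; rewrite comp_lfun1l comp_lfun1r. Defined.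

Definition rcomp (M N P : rep) (g : rhom N P) (f : rhom M N) : rhom M P.
Proof.
exists (fun x => (g x \o f x)%VF) => x y e.
by rewrite -comp_lfunA rmapP comp_lfunA rmapP comp_lfunA.
Defined.

Lemma rcompE (M N P : rep) (g : rhom N P) (f : rhom M N) x :
  rcomp g f x = (g x \o f x)%VF.
Proof. by []. Qed.

Definition ropp (M N : rep) (f : rhom M N) : rhom M N.
Proof.
by exists (fun x => - f x) => x y e; rewrite comp_lfunNl comp_lfunNr rmapP.
Defined.

Definition rzero (M N : rep) : rhom M N.
Proof. by exists (fun x => 0) => x y e; rewrite comp_lfun0l comp_lfun0r. Defined.

Definition rsum (I : finType) (M : I -> rep) : rep.
Proof.
exists (fun x => dsum (fun i => M i x))
       (fun x y e => dsum_diag (fun i => ract (M i) e)).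
- move=> x y a e f; apply/lfunP=> u; apply/ffunP=> i.
  by rewrite add_lfunE scale_lfunE dsumDE dsumZE !dsum_diagE ract_linear
     add_lfunE scale_lfunE.
- move=> x; apply/lfunP=> u; apply/ffunP=> i.
  by rewrite dsum_diagE ract1 !lfunE.
move=> x y z e f; apply/lfunP=> u; apply/ffunP=> i.
by rewrite comp_lfunE !dsum_diagE ractM comp_lfunE.
Defined.

Definition rsum_mx (I J : finType) (M : J -> rep) (N : I -> rep)
    (f : forall i j, rhom (M j) (N i)) : rhom (rsum M) (rsum N).
Proof.
exists (fun x => dsum_mx (fun i j => f i j x)) => x y e.
apply/lfunP=> u; apply/ffunP=> i.
rewrite !comp_lfunE dsum_mxE dsum_diagE dsum_mxE linear_sum.
by apply: eq_bigr => j _; rewrite dsum_diagE /= rmapE.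
Defined.

Definition rsum_diag (I : finType) (M N : I -> rep)
    (f : forall i, rhom (M i) (N i)) : rhom (rsum M) (rsum N).
Proof.
exists (fun x => dsum_diag (fun i => f i x)) => x y e.
apply/lfunP=> u; apply/ffunP=> i.
by rewrite !comp_lfunE !dsum_diagE rmapE.
Defined.

Definition rpair (M N : rep) : rep.
Proof.
exists (fun x => (M x * N x)%type)
       (fun x y e => pair_mx (ract M e) 0 0 (ract N e)).
- move=> x y a e f; apply/lfunP=> u.
  rewrite add_lfunE scale_lfunE !pair_mxE !ract_linear !add_lfunE !scale_lfunE.
  by rewrite !lfunE /= !addr0 !add0r.
- by move=> x; apply/lfunP=> -[u v]; rewrite pair_mxE !ract1 !lfunE /= addr0 add0r.
move=> x y z e f; apply/lfunP=> u.
by rewrite comp_lfunE !pair_mxE !ractM !lfunE /= !addr0 !add0r.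
Defined.

Definition rpair_mx (M1 M2 N1 N2 : rep) (a : rhom M1 N1) (b : rhom M2 N1)
    (c : rhom M1 N2) (d : rhom M2 N2) : rhom (rpair M1 M2) (rpair N1 N2).
Proof.
exists (fun x => pair_mx (a x) (b x) (c x) (d x)) => x y e.
apply/lfunP=> u; rewrite !comp_lfunE !pair_mxE /= !zero_lfunE !addr0 !add0r.
by rewrite !rmapE !linearD.
Defined.

Definition rin1 (M N : rep) : rhom M (rpair M N).
Proof.
exists (fun x => pair_in1 (M x) (N x)) => x y e; apply/lfunP=> u.
by rewrite !comp_lfunE pair_mxE !pair_in1E /= !lfunE /= addr0 add0r linear0.
Defined.

Definition rin2 (M N : rep) : rhom N (rpair M N).
Proof.
exists (fun x => pair_in2 (M x) (N x)) => x y e; apply/lfunP=> u.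
by rewrite !comp_lfunE pair_mxE !pair_in2E /= !lfunE /= linear0 addr0 add0r.
Defined.

Definition rpr1 (M N : rep) : rhom (rpair M N) M.
Proof.
exists (fun x => pair_pr1 (M x) (N x)) => x y e; apply/lfunP=> u.
by rewrite !comp_lfunE pair_mxE !pair_pr1E /= !lfunE /= addr0.
Defined.

Definition rsum_inj (I : finType) (P : I -> rep) (i : I) : rhom (P i) (rsum P).
Proof.
exists (fun x => dsum_inj (fun i => P i x) i) => x y e.
apply/lfunP=> u; apply/ffunP=> j; rewrite !comp_lfunE dsum_diagE !dsum_injE.
have [<-|ne] := eqVneq i j; first by rewrite !dfwith_in.
by rewrite !dfwith_out // linear0.
Defined.

Lemma rsum_projective (I : finType) (P : I -> rep) :
  (forall i, projective (P i)) -> projective (rsum P).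
Proof.
move=> Pproj M N g f gsurj.
have /fin_all_exists[h hE] i : exists h : rhom (P i) M, forall x,
    (g x \o h x = f x \o dsum_inj (fun i => P i x) i)%VF.
  have [h hE] := Pproj i M N g (rcomp f (rsum_inj P i)) gsurj.
  by exists h => x; apply: hE.
pose h' x := (\sum_i (h i x \o dsum_proj (fun i => P i x) i))%VF.
have h'E x u : h' x u = \sum_i h i x (u i).
  by rewrite sum_lfunE; apply: eq_bigr => i _; rewrite comp_lfunE dsum_projE.
have h'P x y (e : kG x y) : (h' y \o ract (rsum P) e = ract M e \o h' x)%VF.
  apply/lfunP=> u; rewrite !comp_lfunE !h'E linear_sum; apply: eq_bigr => i _.
  by rewrite dsum_diagE rmapE.
exists (RHom h'P) => x; apply/lfunP=> u; rewrite comp_lfunE /= h'E linear_sum.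
rewrite [u in RHS]dsum_decomp linear_sum; apply: eq_bigr => i _.
by move/lfunP/(_ (u i)): (hE i x); rewrite !comp_lfunE.
Qed.

Lemma rpair_projective (P Q : rep) :
  projective P -> projective Q -> projective (rpair P Q).
Proof.
move=> Pproj Qproj M N g f gsurj.
have [hP hPE] := Pproj M N g (rcomp f (rin1 P Q)) gsurj.
have [hQ hQE] := Qproj M N g (rcomp f (rin2 P Q)) gsurj.
pose h' x : 'Hom(rpair P Q x, M x) :=
  linfun (fun u : (P x * Q x)%type => hP x u.1 + hQ x u.2).
have h'E x u : h' x u = hP x u.1 + hQ x u.2.
  rewrite /h' lfunLE // => a v w.
  by rewrite !linearP /= scalerDr addrACA.
have h'P x y (e : kG x y) : (h' y \o ract (rpair P Q) e = ract M e \o h' x)%VF.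
  apply/lfunP=> u; rewrite !comp_lfunE !h'E pair_mxE /= !zero_lfunE addr0 add0r.
  by rewrite !rmapE linearD.
exists (RHom h'P) => x; apply/lfunP=> u; rewrite comp_lfunE /= h'E linearD.
move/lfunP/(_ u.1): (hPE x); move/lfunP/(_ u.2): (hQE x).
rewrite !comp_lfunE /= pair_in1E pair_in2E => -> ->; rewrite -linearD; congr (f x _).
by apply: injective_projections; rewrite /= ?addr0 ?add0r.
Qed.

Section Tensor.
Variables (K : vectType k) (x : vertex G).

(* P_x(y) (x) K is the space of K-valued families of coefficients in the basis
   of paths from x to y; [tproj k^o x] is P_x itself. *)
Definition tproj_act y z (e : kG y z) :
    'Hom({ffun Path x y -> K}, {ffun Path x z -> K}) :=
  linfun (@conv K x y z e).
Lemma tproj_actE y z (e : kG y z) f : tproj_act e f = conv e f.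
Proof. by rewrite /tproj_act lfunLE //; apply: conv_linearr. Qed.
Fact tproj_act_linear y z : linear (@tproj_act y z).
Proof.
move=> a e f; apply/lfunP=> u.
by rewrite add_lfunE scale_lfunE !tproj_actE (conv_linearl u).
Qed.
Fact tproj_act1 y : tproj_act (kid y) = \1%VF.
Proof. by apply/lfunP=> u; rewrite tproj_actE conv1 lfunE. Qed.
Fact tproj_actM y z t (e : kG z t) (f : kG y z) :
  tproj_act (kcomp e f) = (tproj_act e \o tproj_act f)%VF.
Proof. by apply/lfunP=> u; rewrite comp_lfunE !tproj_actE convA. Qed.

Definition tproj : rep :=
  @Rep (fun y => {ffun Path x y -> K}) tproj_act
    tproj_act_linear tproj_act1 tproj_actM.

Definition delta y (p : Path x y) (v : K) : {ffun Path x y -> K} :=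
  [ffun q => if q == p then v else 0].

End Tensor.

Definition kpath x y (p : Path x y) : kG x y := [ffun q => (q == p)%:R].

Lemma conv_kpath (K : vectType k) x y (p : Path x y) (v : K) :
  conv (kpath p) (delta (path1 x) v) = delta p v.
Proof.
apply/ffunP=> /= r; rewrite !ffunE (bigD1 p) //= [X in _ + X]big1 => [|q nq].
  rewrite addr0 (eq_bigr (fun q => if q == path1 x then v else 0)); last first.
    by move=> /= q _; rewrite !ffunE eqxx scale1r.
  rewrite big_mkcond (bigD1 (path1 x)) //= big1 => [|q /negPf->]; last by case: ifP.
  by rewrite addr0 ?eqxx cats0 eq_arrows eq_sym.
by rewrite big1 // => s _; rewrite ffunE (negPf nq) scale0r.
Qed.

Lemma delta_decomp (K : vectType k) x y (u : {ffun Path x y -> K}) :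
  u = \sum_p delta p (u p).
Proof.
apply/ffunP=> q; rewrite sum_ffunE (bigD1 q) //= ffunE eqxx big1 ?addr0 // => p np.
by rewrite ffunE eq_sym (negPf np).
Qed.

Lemma tproj_projective (K : vectType k) x : projective (tproj K x).
Proof.
move=> M N g f gsurj.
have dlin y (p : Path x y) : linear (@delta K x y p).
  move=> a v w; apply/ffunP=> q; rewrite !ffunE.
  by case: ifP => // _; rewrite scaler0 addr0.
pose m0 (v : K) : M x := (g x)^-1%VF (f x (delta (path1 x) v)).
have m0lin : linear m0.
  by move=> a v w; rewrite /m0 dlin !linearP.
have m00 : m0 0 = 0.
  by have := m0lin (-1) 0 0; rewrite scaler0 addr0 scaleN1r addNr.
have m0E v : g x (m0 v) = f x (delta (path1 x) v) by rewrite limg_fullP.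
pose hf y (u : {ffun Path x y -> K}) := \sum_p ract M (kpath p) (m0 (u p)).
have hflin y : linear (@hf y).
  move=> a u v; rewrite scaler_sumr -big_split; apply: eq_bigr => p _ /=.
  by rewrite !ffunE m0lin linearP.
pose h y : 'Hom(tproj K x y, M y) := linfun (@hf y).
have hE y u : h y u = hf y u by rewrite /h lfunLE //; apply: hflin.
have hP y z (e : kG y z) : (h z \o ract (tproj K x) e = ract M e \o h y)%VF.
  apply/lfunP=> u; rewrite !comp_lfunE /= tproj_actE !hE.
  rewrite [u in RHS]delta_decomp [u in LHS]delta_decomp.
  have -> (F : Path x y -> {ffun Path x y -> K}) :
      conv e (\sum_p F p) = \sum_p conv e (F p).
    by rewrite -tproj_actE linear_sum; apply: eq_bigr => p _; apply: tproj_actE.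
  have hs w (F : Path x y -> {ffun Path x w -> K}) :
      hf w (\sum_p F p) = \sum_p hf w (F p).
    by rewrite -hE linear_sum; apply: eq_bigr => p _; exact: hE.
  rewrite !hs linear_sum; apply: eq_bigr => q _ /=.
  move: (u q) => v.
  have hd w (p : Path x w) : hf w (delta p v) = ract M (kpath p) (m0 v).
    rewrite /hf (bigD1 p) //= ffunE eqxx big1 ?addr0 // => s ns.
    by rewrite ffunE (negPf ns) m00 linear0.
  rewrite hd -comp_lfunE -ractM.
  have -> : conv e (delta q v) = \sum_r delta r (kcomp e (kpath q) r *: v).
    rewrite [LHS]delta_decomp; apply: eq_bigr => r _; congr delta.
    rewrite -conv_kpath -convA ffunE.
    rewrite (bigD1 r) //= [X in _ + X]big1 => [|p np].
      rewrite addr0 (bigD1 (path1 x)) ?cats0 //= big1 => [|s /andP[_ /negPf ns]].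
        by rewrite addr0 [delta _ _ _]ffunE eqxx.
      by rewrite [delta _ _ _]ffunE ns scaler0.
    rewrite big1 // => s /eqP E; rewrite [delta _ _ _]ffunE.
    case: eqP => // sE; last by rewrite scaler0.
    by case/negP: np; apply/eqP/arrows_inj; rewrite -E sE cats0.
  have -> : ract M (kcomp e (kpath q)) =
     \sum_r kcomp e (kpath q) r *: ract M (kpath r).
    have rl := @ract_linear M x z.
    have {1}-> : kcomp e (kpath q) =
        \sum_r kcomp e (kpath q) r *: (kpath r : kG x z).
      apply/ffunP=> r; rewrite sum_ffunE (bigD1 r) //= big1 => [|s ns].
        by rewrite !ffunE eqxx addr0 [RHS]mulr1.
      by rewrite !ffunE eq_sym (negPf ns) [LHS]mulr0.
    exact: lin_sumZ.
  rewrite -hE linear_sum sum_lfunE; apply: eq_bigr => r _ /=.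
  rewrite hE /hf scale_lfunE (bigD1 r) //= ffunE eqxx big1 => [|s ns].
    have m0Z a w : m0 (a *: w) = a *: m0 w.
      by have := m0lin a w 0; rewrite m00 !addr0.
    by rewrite addr0 m0Z linearZ.
  by rewrite ffunE (negPf ns) m00 linear0.
exists (RHom hP) => y; apply/lfunP=> u; rewrite comp_lfunE /= hE linear_sum.
rewrite [u in RHS]delta_decomp linear_sum; apply: eq_bigr => p _ /=.
by rewrite rmapE m0E -rmapE /= tproj_actE conv_kpath.
Qed.

(* When the sequence of arrows sigma is a path from x' to x, [tmap] is
   p_sigma (x) mu, sending rho (x) v to (rho sigma) (x) mu v, or to 0 if
   rho sigma is not a path in the bound quiver. Taking a bare sequence instead
   of a typed path avoids transports between end points. *)
Section TensorMap.
Variables (K K' : vectType k) (sigma : seq (arrow G)) (mu : 'Hom(K, K')).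
Variables x x' : vertex G.

Definition tmap_fun y (f : {ffun Path x y -> K}) : {ffun Path x' y -> K'} :=
  [ffun r : Path x' y => \sum_(q : Path x y | q ++ sigma == r :> seq _) mu (f q)].
Lemma tmap_fun_linear y : linear (@tmap_fun y).
Proof.
move=> a u v; apply/ffunP=> r; rewrite !ffunE scaler_sumr -big_split /=.
by apply: eq_bigr => q _; rewrite !ffunE linearP.
Qed.
Definition tmap_map y : 'Hom(tproj K x y, tproj K' x' y) := linfun (@tmap_fun y).
Lemma tmap_mapE y f : tmap_map y f = tmap_fun f.
Proof. by rewrite /tmap_map lfunLE //; apply: tmap_fun_linear. Qed.

Fact tmapP y z (e : kG y z) :
  (tmap_map z \o ract (tproj K x) e = ract (tproj K' x') e \o tmap_map y)%VF.
Proof.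
apply/lfunP=> f; rewrite !comp_lfunE /= !tproj_actE !tmap_mapE.
apply/ffunP=> /= r; rewrite !ffunE.
transitivity (\sum_(p : Path y z) \sum_(q : Path x y)
    if p ++ q ++ sigma == r :> seq _ then e p *: mu (f q) else 0).
  rewrite (eq_bigr (fun s : Path x z => \sum_(p : Path y z) \sum_(q : Path x y)
     if p ++ q == s :> seq _ then e p *: mu (f q) else 0)); last first.
    move=> /= s _; rewrite ffunE linear_sum; apply: eq_bigr => p _.
    rewrite linear_sum -big_mkcond; apply: eq_bigr => q _.
    by rewrite linearZ.
  rewrite exchange_big; apply: eq_bigr => /= p _.
  rewrite exchange_big; apply: eq_bigr => /= q _.
  case: ifP => [/eqP E|ne].
    have h : gpath x z (p ++ q).
      have := arrowsP r; rewrite -E catA => /andP[].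
      rewrite walk_cat => /existsP[w /andP[wpq _]] /cat_sorted2[spq _].
      apply/andP; split=> //.
      move: wpq; rewrite !walk_cat => /existsP[w' /andP[wp wq]].
      apply/existsP; exists y.
      by move: (arrowsP p) (arrowsP q) => /andP[-> _] /andP[-> _].
    rewrite (bigD1 (mkPath h)) /= -?catA ?E // big1 => [|s /andP[_ ns]].
      by rewrite eqxx addr0.
    case: ifP => // /eqP pq; case/negP: ns.
    by apply/eqP/arrows_inj; rewrite -pq.
  rewrite big1 // => s /eqP sr; case: ifP => // /eqP pq.
  by rewrite catA pq sr eqxx in ne.
apply: eq_bigr => /= p _; symmetry.
rewrite (eq_bigr (fun s : Path x' y => \sum_(q : Path x y)
  if q ++ sigma == s :> seq _ then e p *: mu (f q) else 0)); last first.
  by move=> /= s _; rewrite ffunE scaler_sumr big_mkcond.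
rewrite exchange_big; apply: eq_bigr => /= q _.
case: ifP => [/eqP E|ne].
  have h : gpath x' y (q ++ sigma).
    by apply: gpath_catr' (arrowsP p); rewrite E arrowsP.
  rewrite (bigD1 (mkPath h)) /= ?E // big1 => [|s /andP[_ ns]].
    by rewrite eqxx addr0.
  case: ifP => // /eqP pq; case/negP: ns.
  by apply/eqP/arrows_inj; rewrite -pq.
rewrite big1 // => s /eqP sr; case: ifP => // /eqP pq.
by rewrite pq sr eqxx in ne.
Qed.
Definition tmap : rhom (tproj K x) (tproj K' x') := RHom tmapP.
End TensorMap.

Lemma tmap_comp0 (K K' K'' : vectType k) (sigma tau : seq (arrow G))
    (mu : 'Hom(K', K'')) (nu : 'Hom(K, K')) x x' x'' y :
  ~~ sorted (fun a b => ~~ rels a b) (tau ++ sigma) ->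
  (tmap sigma mu x' x'' y \o tmap tau nu x x' y)%VF = 0.
Proof.
move=> bad; apply/lfunP=> u; rewrite zero_lfunE comp_lfunE /= !tmap_mapE.
apply/ffunP=> r; rewrite !ffunE big1 // => s /eqP sr.
rewrite ffunE big1 ?linear0 // => q /eqP qs.
case/negP: bad; have /andP[_] := arrowsP r.
by rewrite -sr -qs -catA => /cat_sorted2[].
Qed.

End Reps.

Definition isucc (n : int) : int := n + 1.
Arguments isucc : simpl never.

Section Kb.
Variables (k : fieldType) (G : gentle).

Record cplx := Cplx {
  cobj :> int -> rep k G;
  cdiff : forall n : int, rhom (cobj n) (cobj (isucc n));
  cdiff2 : forall n x, (cdiff (isucc n) x \o cdiff n x = 0)%VF;
  cobj_projective : forall n, projective (cobj n);
  cobj_bounded : exists N : nat, forall n : int, (N < `|n|)%N ->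
    forall x, dim (cobj n x) = 0%N }.

Record cmap (X Y : cplx) := CMap {
  cfun :> forall n : int, rhom (X n) (Y n);
  cfunP : forall n x,
    (cfun (isucc n) x \o cdiff X n x = cdiff Y n x \o cfun n x)%VF }.

(* Equality of morphisms in K^b. The homotopy component from X^(n+1) to Y^n is
   called [h n], so that the conditions, which range over all degrees n + 1,
   need no transport. *)
Definition homotopic (X Y : cplx) (f g : cmap X Y) :=
  exists h : forall n : int, rhom (X (isucc n)) (Y n),
  forall n x, f (isucc n) x - g (isucc n) x =
    ((cdiff Y n x \o h n x) + (h (isucc n) x \o cdiff X (isucc n) x))%VF.

Definition cid (X : cplx) : cmap X X.
Proof.
exists (fun n => rid (X n)) => n x.
by rewrite comp_lfun1l comp_lfun1r.
Defined.

Definition ccomp (X Y Z : cplx) (g : cmap Y Z) (f : cmap X Y) : cmap X Z.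
Proof.
exists (fun n => rcomp (g n) (f n)) => n x.
by rewrite !rcompE -comp_lfunA cfunP comp_lfunA cfunP comp_lfunA.
Defined.

Definition czero (X Y : cplx) : cmap X Y.
Proof.
exists (fun n => rzero (X n) (Y n)) => n x.
by rewrite comp_lfun0l comp_lfun0r.
Defined.

Definition is_czero (X : cplx) := homotopic (cid X) (czero X X).

Definition split_mono (X Y : cplx) (f : cmap X Y) :=
  exists r : cmap Y X, homotopic (ccomp r f) (cid X).
Definition split_epi (X Y : cplx) (f : cmap X Y) :=
  exists s : cmap Y X, homotopic (ccomp f s) (cid Y).
Definition is_ciso (X Y : cplx) (f : cmap X Y) :=
  exists g : cmap Y X,
    homotopic (ccomp g f) (cid X) /\ homotopic (ccomp f g) (cid Y).

Definition csum (I : finType) (X : I -> cplx) : cplx.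
Proof.
exists (fun n => rsum (fun i => X i n)) (fun n => rsum_diag (fun i => cdiff (X i) n)).
- move=> n x; apply/lfunP=> u; apply/ffunP=> i.
  rewrite comp_lfunE !dsum_diagE zero_lfunE dsum0E.
  by move/lfunP/(_ (u i)): (cdiff2 (X i) n x); rewrite comp_lfunE zero_lfunE.
- by move=> n; apply: rsum_projective => i; apply: cobj_projective.
have /fin_all_exists[N HN] i := cobj_bounded (X i).
exists (\max_i N i) => n lt x; apply: dim_dsum0 => i; apply: HN.
by apply: leq_ltn_trans lt; apply: leq_bigmax.
Defined.

Definition csum_map (I : finType) (X Y : I -> cplx) (f : forall i, cmap (X i) (Y i)) :
  cmap (csum X) (csum Y).
Proof.
exists (fun n => rsum_diag (fun i => f i n)) => n x.
apply/lfunP=> u; apply/ffunP=> i; rewrite !comp_lfunE !dsum_diagE.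
by move/lfunP/(_ (u i)): (cfunP (f i) n x); rewrite !comp_lfunE.
Defined.

Definition cindecomposable (X : cplx) :=
  ~ is_czero X /\
  forall X1 X2 : cplx,
    (exists f : cmap X (csum (fun b : bool => if b then X1 else X2)), is_ciso f) ->
    is_czero X1 \/ is_czero X2.

Definition shift (X : cplx) : cplx.
Proof.
exists (fun n => X (isucc n)) (fun n => ropp (cdiff X (isucc n))).
- by move=> n x; rewrite /= comp_lfunNl comp_lfunNr opprK cdiff2.
- by move=> n; apply: cobj_projective.
have [N HN] := cobj_bounded X.
by exists N.+1 => n lt x; apply: HN; rewrite /isucc; lia.
Defined.

Definition shift_map (X Y : cplx) (f : cmap X Y) : cmap (shift X) (shift Y).
Proof.
exists (fun n => f (isucc n)) => n x /=.
by rewrite comp_lfunNl comp_lfunNr (cfunP f).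
Defined.

(* Degree n of the cone is X^(n+1) (+) Y^n, with differential
   (u, v) |-> (- d u, f u + d v). *)
Definition cone (X Y : cplx) (f : cmap X Y) : cplx.
Proof.
exists (fun n => rpair (X (isucc n)) (Y n))
  (fun n => rpair_mx (ropp (cdiff X (isucc n))) (rzero _ _) (f (isucc n)) (cdiff Y n)).
- move=> n x; apply/lfunP=> -[u v]; rewrite comp_lfunE !pair_mxE zero_lfunE /=.
  rewrite !zero_lfunE !addr0 !opp_lfunE !linearN /= opprK linearD /= addrA.
  move/lfunP/(_ u): (cdiff2 X (isucc n) x); rewrite comp_lfunE zero_lfunE => ->.
  move/lfunP/(_ u): (cfunP f (isucc n) x); rewrite !comp_lfunE => ->.
  move/lfunP/(_ v): (cdiff2 Y n x); rewrite comp_lfunE zero_lfunE => ->.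
  by rewrite addNr addr0.
- by move=> n; apply: rpair_projective; apply: cobj_projective.
have [N HN] := cobj_bounded X; have [N' HN'] := cobj_bounded Y.
exists (maxn N.+1 N') => n lt x.
have -> : dim (rpair (X (isucc n)) (Y n) x) =
  (dim (X (isucc n) x) + dim (Y n x))%N by [].
by rewrite HN ?HN' //; rewrite /isucc; lia.
Defined.

Definition cone_in (X Y : cplx) (f : cmap X Y) : cmap Y (cone f).
Proof.
exists (fun n => rin2 (X (isucc n)) (Y n)) => n x; apply/lfunP=> u.
by rewrite !comp_lfunE /= !pair_in2E pair_mxE /= zero_lfunE !linear0 !add0r.
Defined.

Definition cone_pr (X Y : cplx) (f : cmap X Y) : cmap (cone f) (shift X).
Proof.
exists (fun n => rpr1 (X (isucc n)) (Y n)) => n x; apply/lfunP=> u.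
by rewrite !comp_lfunE /= !pair_pr1E pair_mxE /= zero_lfunE addr0.
Defined.

Definition distinguished (X Y Z : cplx)
    (u : cmap X Y) (v : cmap Y Z) (w : cmap Z (shift X)) :=
  exists (X' Y' : cplx) (f : cmap X' Y')
         (a : cmap X X') (b : cmap Y Y') (c : cmap Z (cone f)),
    [/\ is_ciso a, is_ciso b & is_ciso c] /\
    [/\ homotopic (ccomp b u) (ccomp f a),
        homotopic (ccomp c v) (ccomp (cone_in f) b)
      & homotopic (ccomp (shift_map a) w) (ccomp (cone_pr f) c)].

Definition left_almost_split (X Y : cplx) (u : cmap X Y) :=
  ~ split_mono u /\
  forall (W : cplx) (h : cmap X W), ~ split_mono h ->
    exists h' : cmap Y W, homotopic (ccomp h' u) h.

Definition right_almost_split (Y Z : cplx) (v : cmap Y Z) :=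
  ~ split_epi v /\
  forall (W : cplx) (h : cmap W Z), ~ split_epi h ->
    exists h' : cmap W Y, homotopic (ccomp v h') h.

(* Happel's conditions, in the form symmetric in u and v: given the rest,
   that u is not a split monomorphism, that v is not a split epimorphism and
   that w is nonzero are equivalent, and either lifting property implies the
   other one. *)
Definition almost_split_triangle (X Y Z : cplx)
    (u : cmap X Y) (v : cmap Y Z) (w : cmap Z (shift X)) :=
  [/\ distinguished u v w, cindecomposable X, cindecomposable Z,
      left_almost_split u & right_almost_split v].

End Kb.

(* The values 1 and -1 are encoded by booleans, so that change of sign is
   [negb]. *)
Record string_functions (G : gentle) := StringFunctions {
  Sfun : arrow G -> bool;
  Tfun : arrow G -> bool;
  Sfun_neq : forall a b, src a = src b -> a != b -> Sfun a = ~~ Sfun b;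
  Tfun_neq : forall a b, tgt a = tgt b -> a != b -> Tfun a = ~~ Tfun b;
  STfun_nrels : forall a b, src a = tgt b -> ~~ rels a b -> Sfun a = ~~ Tfun b;
  STfun_rels : forall a b, src a = tgt b -> rels a b -> Sfun a = Tfun b }.

Section Strings.
Variables (G : gentle) (ST : string_functions G).

(* (a, true) is the arrow a and (a, false) its formal inverse. *)
Definition letter : Type := (arrow G * bool)%type.
Implicit Types a b c : letter.
Definition linv a : letter := (a.1, ~~ a.2).
Definition lsrc a : vertex G := if a.2 then src a.1 else tgt a.1.
Definition ltgt a : vertex G := if a.2 then tgt a.1 else src a.1.
Definition lS a : bool := if a.2 then Sfun ST a.1 else Tfun ST a.1.
Definition lT a : bool := if a.2 then Tfun ST a.1 else Sfun ST a.1.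

(* Words of positive length: first letter and remaining letters. *)
Definition word : Type := (letter * seq letter)%type.
Implicit Types w p q : word.
Definition letters w : seq letter := w.1 :: w.2.
Definition wlast w : letter := last w.1 w.2.
Definition wsrc w : vertex G := lsrc (wlast w).
Definition wtgt w : vertex G := ltgt w.1.
Definition wS w : bool := lS (wlast w).
Definition wT w : bool := lT w.1.
Definition winv (s : seq letter) : seq letter := rev (map linv s).

Definition homotopy_string w : bool :=
  sorted (fun a b => (lsrc a == ltgt b) && (b != linv a)) (letters w).

(* The two conditions under which the composition of two homotopy strings
   with last letter a and first letter b is said to be defined. *)
Definition ldefined a b : bool :=
  if a.2 == b.2 then lS a == lT b else lS a == ~~ lT b.
Definition wdefined p q : bool :=
  (wsrc p == wtgt q) && ldefined (wlast p) q.1.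

Definition direct (s : seq letter) : bool :=
  [&& s != [::], all snd s & sorted (@nrel G) (map fst s)].
Definition inverse (s : seq letter) : bool := direct (winv s).

(* Characterises ps as sigma_1(w), ..., sigma_L(w). The computed sequence
   [parts w] below is shown to be the only such ps. *)
Definition presentation w (ps : seq word) : bool :=
  [&& flatten (map letters ps) == letters w,
      all (fun p => direct (letters p) || inverse (letters p)) ps
    & sorted wdefined ps].

Fixpoint parts_rec a (s : seq letter) : seq word :=
  if s is b :: s' then
    if ldefined a b then (a, [::]) :: parts_rec b s'
    else if parts_rec b s' is (c, v) :: r then (a, c :: v) :: r
    else [::]
  else [:: (a, [::])].
Definition parts w : seq word := parts_rec w.1 w.2.

Lemma directE a s :
  direct (a :: s) = all snd (a :: s) && path (@nrel G) a.1 (map fst s).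
Proof. by []. Qed.

Lemma inverseE a s : inverse (a :: s) =
  all (predC snd) (a :: s) && path (fun x y => @nrel G y x) a.1 (map fst s).
Proof.
rewrite /inverse /direct /winv -size_eq0 size_rev size_map all_rev all_map.
by rewrite map_rev rev_sorted -map_comp.
Qed.

Lemma parts_rec_cons a s : exists v r, parts_rec a s = (a, v) :: r.
Proof.
case: s => [|b s] /=; first by exists [::], [::].
case: ifP => _; first by exists [::], (parts_rec b s).
elim: s b => [|c s IH] b /=; first by exists [:: b], [::].
case: ifP => _; first by exists [:: b], (parts_rec c s).
have [v [r E]] := IH c; case: (parts_rec c s) E => [//|[d v'] r'] [E1 E2].
by exists (b :: d :: v'), r'.
Qed.

Lemma ldefinedPn a b : lsrc a = ltgt b -> b != linv a -> ~~ ldefined a b ->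
  a.2 = b.2 /\ if a.2 then nrel a.1 b.1 else nrel b.1 a.1.
Proof.
case: a b => [a [] ] [b []]; rewrite /ldefined /linv /lsrc /ltgt /lS /lT /= => e ne nd.
- split=> //; rewrite /nrel e eqxx /=; apply: contra nd => /STfun_rels.
  by rewrite e => ->.
- case/negP: nd; have /(Sfun_neq ST e)-> // : a != b.
  by apply: contra ne => /eqP->.
- case/negP: nd; have /(Tfun_neq ST e)-> // : a != b.
  by apply: contra ne => /eqP->.
split=> //; rewrite /nrel e eqxx /=; apply: contra nd => r.
by rewrite (STfun_rels ST (esym e) r).
Qed.

Lemma ldefined_direct a b : a.2 -> b.2 -> nrel a.1 b.1 -> ldefined a b = false.
Proof.
move=> a2 b2 /andP[/eqP e nr]; rewrite /ldefined a2 b2 eqxx /lS /lT a2 b2.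
by rewrite (STfun_nrels ST e nr); case: Tfun.
Qed.
Lemma ldefined_inverse a b :
  ~~ a.2 -> ~~ b.2 -> nrel b.1 a.1 -> ldefined a b = false.
Proof.
move=> /negPf a2 /negPf b2 /andP[/eqP e nr]; rewrite /ldefined a2 b2 eqxx /lS /lT a2 b2.
by rewrite (STfun_nrels ST e nr); case: Tfun.
Qed.

Lemma presentation_parts w : homotopy_string w -> presentation w (parts w).
Proof.
case: w => a s; rewrite /homotopy_string /presentation /parts /=.
elim: s a => [|b s IH] a /=.
  by rewrite /direct /inverse /direct /winv /= eqxx /=; case: a.2.
move=> /andP[/andP[/eqP e ne] /IH{IH}].
have [v [r ->]] := parts_rec_cons b s.
move=> /and3P[/eqP fE /andP[bv rv] sr] /=.
case: ifP => [ab|/negbT nab].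
  apply/and3P; split; first by apply/eqP; congr cons.
    apply/and3P; split=> //.
    by rewrite /direct /inverse /direct /winv /=; case: a.2.
  by apply/andP; split=> //; rewrite /wdefined /wsrc /wtgt /= e eqxx.
apply/and3P; split; first by apply/eqP; congr cons.
  apply/andP; split=> //.
  have [e2 nr] := ldefinedPn e ne nab.
  move: bv; rewrite /letters !directE !inverseE /= -e2.
  by case: a.2 nr => nr; rewrite /= ?orbF nr.
by case: r sr {rv fE} => //= q r /andP[-> ->].
Qed.

Lemma parts_rec_cat a v s :
  (direct (a :: v) || inverse (a :: v)) ->
  (if s is b :: _ then ldefined (last a v) b else true) ->
  parts_rec a (v ++ s) = (a, v) :: if s is b :: s' then parts_rec b s' else [::].
Proof.
elim: v a => [|b v IH] a dv; first by case: s => //= b s ->.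
rewrite [last _ _]/= => ls /=.
have -> : ldefined a b = false.
  move: dv; rewrite directE inverseE /= => /orP[] /andP[/and3P[a2 b2 _] /andP[nr _]].
    exact: ldefined_direct.
  exact: ldefined_inverse.
rewrite IH //; move: dv; rewrite !directE !inverseE /=.
by move=> /orP[] /andP[/and3P[_ -> ->] /andP[_ ->]]; rewrite ?orbT.
Qed.

Lemma presentation_unique w ps : presentation w ps -> ps = parts w.
Proof.
case: w => a s; rewrite /parts /presentation.
elim: ps a s => [|[c v] r IH] a s //= => /and3P[/eqP[<- {a}] <- {s}] /andP[cv rv] sr.
rewrite parts_rec_cat //; last first.
  by case: r sr {IH rv} => [|q r] //= /andP[/andP[_]].
case: r IH rv sr => [|q r] IH rv //= /andP[_ sr]; congr cons.
case: q rv IH sr => b u rv IH sr /=.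
by apply: IH; apply/and3P; split=> //; apply/eqP.
Qed.

Definition pdeg (ps : seq word) : int :=
  (count (direct \o letters) ps)%:Z - (count (inverse \o letters) ps)%:Z.
Definition deg w : int := pdeg (parts w).

Record homotopy_band w : Prop := HomotopyBand {
  band_string : homotopy_string w;
  band_deg : deg w = 0;
  band_parts : (0 < size (parts w))%N;
  band_ends :
    (direct (letters (head w (parts w))) && inverse (letters (last w (parts w)))) ||
    (inverse (letters (head w (parts w))) && direct (letters (last w (parts w))));
  band_closed : wsrc w = wtgt w;
  band_sign : wS w = ~~ wT w;
  band_primitive : ~ exists (w' : word) (n : nat),
    [/\ homotopy_string w', (size (letters w') < size (letters w))%N,
        wsrc w' = wtgt w', (1 <= n)%N
      & letters w = flatten (nseq n (letters w'))] }.

End Strings.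

Section BandComplex.
Variables (k : fieldType) (G : gentle) (ST : string_functions G).
Variables (m : int) (w : word G) (hw : homotopy_band ST w) (mu : autom k).

Notation L := (size (parts ST w)).
(* The index l in [1, L] is represented by the ordinal l - 1; thus the cyclic
   predecessor [ord_pred l] stands for l - 1, with 0 read as L. *)
Implicit Types i j l : 'I_L.

Definition sigma l : word G := tnth (in_tuple (parts ST w)) l.

(* m + deg w^[l] and s w^[l] *)
Definition band_degree l : int := m + pdeg (take l.+1 (parts ST w)).
Definition band_vertex l : vertex G := wsrc (sigma l).

Definition band_mu l : 'Hom(mu, mu) := if l == 0%N :> nat then aact mu else \1%VF.

(* The contribution of sigma_l to the component from the summand j to the
   summand i. *)
Definition band_term i j l :
    rhom (tproj mu (band_vertex j)) (tproj mu (band_vertex i)) :=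
  if [&& direct (letters (sigma l)), i == l & j == ord_pred l] then
    tmap (map fst (letters (sigma l))) (band_mu l) (band_vertex j) (band_vertex i)
  else if [&& inverse (letters (sigma l)), i == ord_pred l & j == l] then
    tmap (map fst (winv (letters (sigma l)))) (band_mu l) (band_vertex j) (band_vertex i)
  else rzero _ _.

Fact band_compP i j x y (e : kG k x y) :
  ((\sum_l band_term i j l y) \o ract (tproj mu (band_vertex j)) e =
   ract (tproj mu (band_vertex i)) e \o \sum_l band_term i j l x)%VF.
Proof.
apply/lfunP=> u; rewrite !comp_lfunE !sum_lfunE linear_sum.
by apply: eq_bigr => l _; rewrite rmapE.
Qed.
Definition band_comp i j :
    rhom (tproj mu (band_vertex j)) (tproj mu (band_vertex i)) :=
  RHom (@band_compP i j).

Definition band_obj (n : int) : rep k G :=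
  rsum (fun i : {i : 'I_L | band_degree i == n} => tproj mu (band_vertex (val i))).

Definition band_diff (n : int) : rhom (band_obj n) (band_obj (isucc n)) :=
  rsum_mx (fun (i : {i : 'I_L | band_degree i == isucc n})
               (j : {j : 'I_L | band_degree j == n}) =>
             band_comp (val i) (val j)).


Lemma direct_inverse (s : seq (letter G)) : direct s -> inverse s = false.
Proof. by case: s => // a s; rewrite directE inverseE /= => /andP[/andP[-> _] _]. Qed.

Lemma sorted_junction (T : eqType) (e : rel T) (a b : T) (s t : seq T) :
  sorted e ((a :: s) ++ b :: t) -> e (last a s) b.
Proof. by rewrite /= cat_path => /andP[_ /andP[]]. Qed.

Lemma winv_cat (s t : seq (letter G)) : map fst (winv s) ++ map fst (winv t) =
  rev (map fst t ++ map fst s) :> seq (arrow G).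
Proof.
have E r : map fst (winv r) = rev (map fst r) :> seq (arrow G).
  by rewrite /winv map_rev -map_comp.
by rewrite !E rev_cat.
Qed.

Lemma sigma_adjacent l : (0 < l)%N -> wdefined ST (sigma (ord_pred l)) (sigma l).
Proof.
move=> l0; have /and3P[_ _ sp] := presentation_parts ST (band_string hw).
have x0 := sigma l; rewrite /sigma !(tnth_nth x0) /=.
have -> : ((l + L).-1 %% L)%N = l.-1.
  have -> : ((l + L).-1 = l.-1 + L)%N by lia.
  by rewrite modnDr modn_small //; have := ltn_ord l; lia.
by rewrite -{2}(prednK l0); move/(sortedP x0): sp; apply; rewrite prednK.
Qed.

Lemma sigma_ends l : l = 0%N :> nat ->
  (direct (letters (sigma l)) -> direct (letters (sigma (ord_pred l))) -> False) /\
  (inverse (letters (sigma l)) -> inverse (letters (sigma (ord_pred l))) -> False).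
Proof.
move=> l0; have := band_ends hw; have x0 := sigma l.
have Lp := band_parts hw.
have -> : head w (parts ST w) = sigma l.
  by rewrite /sigma (tnth_nth w) l0 nth0.
have -> : last w (parts ST w) = sigma (ord_pred l).
  rewrite /sigma (tnth_nth w) /= l0 add0n modn_small ?prednK //.
  by rewrite (last_nth w); case: (parts ST w) Lp.
move=> /orP[] /andP[a b]; split=> c d.
- by rewrite (direct_inverse d) in b.
- by rewrite (direct_inverse a) in c.
- by rewrite (direct_inverse c) in a.
- by rewrite (direct_inverse b) in d.
Qed.

Lemma band_term2 i j h l l' y :
  (band_term i j l y \o band_term j h l' y)%VF = 0.
Proof.
rewrite /band_term; case: ifP => [/and3P[dl /eqP il /eqP jl]|_].
  case: ifP => [/and3P[dl' /eqP jl' _]|_].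
    have El : l' = ord_pred l by rewrite -jl'.
    apply: tmap_comp0; apply/negP.
    have [l0|lp] := posnP l.
      by case: (sigma_ends l0) => + _; rewrite -El => /(_ dl dl').
    have := sigma_adjacent lp; rewrite -El => /andP[e ld].
    move=> /sorted_junction; rewrite last_map => nr.
    have dlast : (wlast (sigma l')).2.
      by move: dl'; rewrite directE => /andP[/allP/(_ _ (mem_last _ _))].
    have dhead : (sigma l).1.2 by move: dl; rewrite directE => /andP[/andP[]].
    have := ldefined_direct ST dlast dhead.
    rewrite ld /nrel nr andbT; move: e; rewrite /wsrc /wtgt /lsrc /ltgt dlast dhead.
    by move=> -> /(_ isT).
  case: ifP => [/and3P[il' /eqP jl' _]|_]; last by rewrite comp_lfun0r.
  have E : l = l' by apply: (@ord_pred_inj L); rewrite -jl -jl'.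
  by rewrite -E (direct_inverse dl) in il'.
case: ifP => [/and3P[dl /eqP il /eqP jl]|_]; last by rewrite comp_lfun0l.
case: ifP => [/and3P[dl' /eqP jl' _]|_].
  by rewrite -jl' jl in dl'; rewrite (direct_inverse dl') in dl.
case: ifP => [/and3P[dl' /eqP jl' _]|_]; last by rewrite comp_lfun0r.
have El : l = ord_pred l' by rewrite -jl.
apply: tmap_comp0; apply/negP.
have [l0|lp] := posnP l'.
  by case: (sigma_ends l0) => _; rewrite -El => /(_ dl' dl).
have := sigma_adjacent lp; rewrite -El => /andP[e ld].
rewrite winv_cat rev_sorted => /sorted_junction; rewrite last_map => nr.
have dlast : ~~ (wlast (sigma l)).2.
  by move: dl; rewrite inverseE => /andP[/allP/(_ _ (mem_last _ _))].
have dhead : ~~ (sigma l').1.2 by move: dl'; rewrite inverseE => /andP[/andP[]].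
have := ldefined_inverse ST dlast dhead.
rewrite ld /nrel nr andbT; move: e.
rewrite /wsrc /wtgt /lsrc /ltgt (negPf dlast) (negPf dhead) eq_sym.
by move=> -> /(_ isT).
Qed.

Fact band_diff2 n x : (band_diff (isucc n) x \o band_diff n x = 0)%VF.
Proof.
apply/lfunP=> u; apply/ffunP=> i.
rewrite comp_lfunE dsum_mxE zero_lfunE dsum0E big1 // => j _.
rewrite dsum_mxE linear_sum big1 // => h _ /=.
rewrite sum_lfunE big1 // => l _; rewrite sum_lfunE linear_sum big1 // => l' _ /=.
by rewrite -comp_lfunE band_term2 zero_lfunE.
Qed.

Fact band_obj_projective n : projective (band_obj n).
Proof. by apply: rsum_projective => i; apply: tproj_projective. Qed.

Fact band_obj_bounded : exists N : nat, forall n : int, (N < `|n|)%N ->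
  forall x, dim (band_obj n x) = 0%N.
Proof.
exists (`|m| + L)%N => n lt x; apply: dim_dsum0 => -[i /= /eqP E]; exfalso.
move: lt; rewrite -E /band_degree /pdeg.
set s := take _ _; have : (size s <= L)%N by apply: size_take_leq || rewrite size_take_min geq_minr.
have := count_size (@direct G \o @letters G) s.
have := count_size (@inverse G \o @letters G) s.
lia.
Qed.

Definition band_cplx : cplx k G :=
  Cplx band_diff2 band_obj_projective band_obj_bounded.

End BandComplex.

(* Main.v *)
From HB Require Import structures.
Require Import Defs.
From mathcomp Require Import all_boot all_order all_algebra.
From mathcomp Require Import zify.
From Stdlib Require Import Classical.
Set Implicit Arguments. Unset Strict Implicit. Unset Printing Implicit Defensive.

(** A short exact sequence of automorphisms gives a degreewise split sequence of
    band complexes X -> E -> Z, hence a triangle with a connecting map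
    t : Z -> X[1]. The sequence lifts exactly the maps h : W -> Z with t h = 0.

    The cone of a natural map from the band complex to its image under the
    Nakayama functor is exact, so that a map b : W -> X[1] is null-homotopic as
    soon as the trace form lambda vanishes on b e for all e : X -> W. For a map
    e : X -> Z the value lambda (t e) only depends on the coefficients of e at
    the trivial paths from each node to itself. These define a morphism phi of
    automorphisms, and lambda (t e) = 0 if phi lifts to the middle term of the
    given sequence, that is, if phi is not a split epimorphism.

    The nodes of a band are ordered by comparing lexicographically the walks
    that leave them on a fixed side; primitivity of the band makes this a linear
    order. The coefficients of a chain map at trivial paths are triangular for
    this order, hence an endomorphism with phi invertible is invertible. This
    gives local endomorphism rings, and a map h : W -> Z such that phi is split
    for some h e is a split epimorphism; so t h = 0 in all other cases. *)

(** * Paths in a gentle quiver *)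

(** The trace form sees so little of [e] because the connecting map is the off-diagonal part of a
    differential: its coefficients sit at the paths of single edges of the band, and in [t e] the
    coefficient along an edge can only come from the coefficient of [e] at a trivial path. If phi
    lifts, this coefficient becomes a commutator with the automorphism on the edge, which has trace
    zero against the inverse of that automorphism. The obstacle is that a band may visit a vertex
    several times in the same degree. A chain map then has coefficients at trivial paths between
    different nodes, and bijective diagonal coefficients do not by themselves make it invertible;
    the order on the nodes is there to exclude cycles among these coefficients. Primitivity
    separates walks along the band that travel in the same direction. Walks in opposite directions
    are separated by another argument: the two edges at a node lie on different sides of the vertex.
    Duality is applied to maps into X[1] only. The left half of the almost split property is deduced
    from the right half, by means of cocones and the locality of the endomorphisms of X. *)

Section PathSides.
Variables (G : gentle) (ST : string_functions G).
Implicit Types (x y z : vertex G) (p q : seq (arrow G)).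

(* The sides at a vertex x are the values of S on arrows leaving x and of -T on
   arrows reaching x: two arrows leaving x on the same side coincide, likewise
   for two arrows reaching x, and an arrow may be followed by another one in
   the bound quiver exactly when both lie on the same side. *)
Definition oside p : bool := if p is a :: t then Sfun ST (last a t) else true.
Definition iside p : bool := if p is a :: _ then ~~ Tfun ST a else true.

Lemma oside_cat p q : q != [::] -> oside (p ++ q) = oside q.
Proof. by case: q => // b q _; case: p => //= a p; rewrite last_cat. Qed.
Lemma iside_cat p q : p != [::] -> iside (p ++ q) = iside p.
Proof. by case: p. Qed.

Lemma rels_side a b : src a = tgt b ->
  rels a b = (Sfun ST a != ~~ Tfun ST b) :> bool.
Proof.
move=> e; have [r|nr] := boolP (rels a b).
  by rewrite (STfun_rels ST e r); case: Tfun.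
by rewrite (STfun_nrels ST e nr) eqxx.
Qed.

Lemma walk_src x y a p : walk y (a :: p) x -> src (last a p) = x.
Proof.
by elim: p a y => [|b p IH] a y /= /andP[_]; [move/eqP|move/IH].
Qed.

Lemma gpath_tgt x y a p : gpath x y (a :: p) -> tgt a = y.
Proof. by move=> /andP[/andP[/eqP]]. Qed.
Lemma gpath_src x y a p : gpath x y (a :: p) -> src (last a p) = x.
Proof. by move=> /andP[/walk_src]. Qed.
Lemma gpath_nil x y : gpath x y [::] = (y == x) :> bool.
Proof. by rewrite /gpath /= andbT. Qed.

(** The concatenation can contain a new relation only at the junction, and [rels_side] decides
    whether it does. *)
Lemma gpath_cat x y z p q : gpath x y p -> gpath y z q -> p != [::] -> q != [::] ->
  gpath x z (q ++ p) = (oside q == iside p).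
Proof.
case: p => // b p; case: q => // a q hp hq _ _.
have e : src (last a q) = tgt b by rewrite (gpath_src hq) (gpath_tgt hp).
have [wp sp] := andP hp; have [wq sq] := andP hq.
rewrite /gpath walk_cat; have -> : [exists t, walk z (a :: q) t && walk t (b :: p) x].
  by apply/existsP; exists y; rewrite wq wp.
rewrite /= cat_path /=; move: sq sp => /= -> -> /=.
by rewrite andbT rels_side // negbK.
Qed.

Lemma gpath_split x z p q : gpath x z (q ++ p) ->
  exists2 y, gpath x y p & gpath y z q.
Proof.
move=> h; have /andP[+ /cat_sorted2[sq sp]] := h; rewrite walk_cat.
by move=> /existsP[y /andP[wq wp]]; exists y; apply/andP.
Qed.

Lemma gpath_tgt_uniq x y z p : gpath x y p -> gpath x z p -> y = z.
Proof.
by case: p => [|a p]; [rewrite !gpath_nil => /eqP-> /eqP->|move=> /gpath_tgt<- /gpath_tgt].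
Qed.
Lemma gpath_src_uniq x y z p : gpath x z p -> gpath y z p -> x = y.
Proof.
by case: p => [|a p]; [rewrite !gpath_nil => /eqP-> /eqP->|move=> /gpath_src<- /gpath_src].
Qed.

Lemma gpath_rcons x y p a : gpath x y (rcons p a) -> src a = x /\ gpath (tgt a) y p.
Proof.
rewrite -cats1 => /gpath_split[z /[dup] ha /gpath_tgt <- hp]; split=> //.
exact: gpath_src ha.
Qed.

Lemma gpath_cat_side x z p q : gpath x z (q ++ p) -> p != [::] -> q != [::] ->
  oside q = iside p.
Proof.
by move=> h pn qn; have [y hp hq] := gpath_split h; apply/eqP; rewrite -(gpath_cat hp hq).
Qed.

Lemma oside_rcons p a : oside (rcons p a) = Sfun ST a.
Proof. by rewrite -cats1 oside_cat. Qed.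

Lemma gpath_rcons_side x y p a : gpath x y (rcons p a) -> p != [::] ->
  oside p = ~~ Tfun ST a.
Proof.
move=> h pn; have [sa hp] := gpath_rcons h.
have ha : gpath x (tgt a) [:: a] by rewrite /gpath /= sa !eqxx.
by move: h; rewrite -cats1 (gpath_cat ha hp) // => /eqP.
Qed.

(** The arrow leaving a vertex on a given side is unique, and the absence of relations forces the
    side of the next arrow. Hence a path is determined by its starting vertex, its side there and
    its length. *)
Lemma gpath_suffix x y y' p q : gpath x y p -> gpath x y' q ->
  [|| p == [::], q == [::] | oside p == oside q] -> suffix p q || suffix q p.
Proof.
elim/last_ind: p x q => [|p a IH] x q; first by rewrite suffix0s.
case/lastP: q => [|q b]; first by rewrite suffix0s orbT.
move=> hp hq; have [sa hp'] := gpath_rcons hp; have [sb hq'] := gpath_rcons hq.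
rewrite -!size_eq0 !size_rcons /= !oside_rcons => /eqP E.
have ab : a = b.
  apply/eqP; apply/idPn => /(Sfun_neq ST (etrans sa (esym sb))).
  by rewrite E; case: Sfun.
rewrite -ab in hq' hq *; rewrite !suffix_rcons eqxx /=; apply: (IH _ _ hp' hq').
have [//|pn] := eqVneq p [::]; have [|qn] := eqVneq q [::]; first by rewrite orbT.
by rewrite (gpath_rcons_side hp pn) (gpath_rcons_side hq qn) eqxx !orbT.
Qed.

Lemma gpath_prefix x x' y p q : gpath x y p -> gpath x' y q ->
  [|| p == [::], q == [::] | iside p == iside q] -> prefix p q || prefix q p.
Proof.
elim: p y q => [|a p IH] y [|b q] //= hp hq /eqP/negb_inj E.
have ab : a = b.
  have e : tgt a = tgt b by rewrite (gpath_tgt hp) (gpath_tgt hq).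
  apply/eqP; apply/idPn => /(Tfun_neq ST e).
  by rewrite E; case: Tfun.
rewrite -ab in hq *; rewrite eqxx /=.
have [y1 hp1 ha] := gpath_split (q := [:: a]) hp.
have [y2 hq1 ha'] := gpath_split (q := [:: a]) hq.
have e := gpath_src_uniq ha ha'; rewrite -e in hq1.
apply: (IH _ _ hp1 hq1).
have [//|pn] := eqVneq p [::]; have [|qn] := eqVneq q [::]; first by rewrite orbT.
have := gpath_cat hp1 ha pn isT; rewrite hp => /esym/eqP <-.
by have := gpath_cat hq1 ha qn isT; rewrite hq => /esym/eqP <-; rewrite eqxx !orbT.
Qed.

End PathSides.

(** * Edges and half-edges of a band *)

Section LetterPaths.
Variables (G : gentle) (ST : string_functions G).
Implicit Types (a c : letter G) (s t : seq (letter G)) (p : word G).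

Lemma nrel_path_gpath (a : arrow G) (t : seq (arrow G)) : path (@nrel G) a t ->
  gpath (src (last a t)) (tgt a) (a :: t).
Proof.
rewrite /gpath /= eqxx /=; elim: t a => [|b t IH] a /=; first by rewrite eqxx.
by move=> /andP[/andP[/eqP e nr] /IH /andP[wt st]]; rewrite e eqxx wt nr.
Qed.

Lemma direct_gpath p : direct (letters p) ->
  gpath (wsrc p) (wtgt p) (map fst (letters p)).
Proof.
case: p => a t; rewrite /letters /= directE => /andP[/allP al /nrel_path_gpath].
have -> : wsrc (a, t) = src (last a.1 (map fst t)).
  by rewrite /wsrc /wlast /= last_map /lsrc al ?mem_last.
by have -> : wtgt (a, t) = tgt a.1 by rewrite /wtgt /ltgt al ?mem_head.
Qed.

Lemma inverse_gpath p : inverse (letters p) ->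
  gpath (wtgt p) (wsrc p) (map fst (winv (letters p))).
Proof.
case: p => a t; rewrite /inverse /letters /= => h.
have winvE : winv (a :: t) = linv (last a t) :: behead (winv (a :: t)).
  by rewrite /winv lastI map_rcons rev_rcons.
have := direct_gpath (p := (linv (last a t), behead (winv (a :: t)))).
rewrite /letters /= -winvE => /(_ h).
have -> : wtgt (linv (last a t), behead (winv (a :: t))) = wsrc (a, t).
  by rewrite /wtgt /wsrc /wlast /ltgt /lsrc /=; case: (last a t) => b [].
have -> : wsrc (linv (last a t), behead (winv (a :: t))) = wtgt (a, t).
  rewrite /wtgt /wsrc /wlast /=.
  have -> : last (linv (last a t)) (behead (winv (a :: t))) = linv a.
    have -> : forall c s, last c s = last c (c :: s) by [].
    by rewrite -winvE /winv /= rev_cons last_rcons.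
  by rewrite /ltgt /lsrc /=; case: (a) => b [].
by rewrite [in X in _ -> X]winvE.
Qed.

Lemma direct_snd p c : direct (letters p) -> c \in letters p -> c.2.
Proof. by case: p => a t; rewrite /letters directE => /andP[/allP al _] /al. Qed.
Lemma inverse_snd p c : inverse (letters p) -> c \in letters p -> ~~ c.2.
Proof. by case: p => a t; rewrite /letters inverseE => /andP[/allP al _] /al. Qed.

Lemma direct_oside p : direct (letters p) ->
  oside ST (map fst (letters p)) = lS ST (wlast p).
Proof.
move=> h; have := direct_snd h (mem_last p.1 p.2); case: p h => a t h.
by rewrite /wlast /lS /= last_map => ->.
Qed.
Lemma direct_iside p : direct (letters p) ->
  iside ST (map fst (letters p)) = ~~ lT ST p.1.
Proof.
move=> h; have := direct_snd h (mem_head p.1 p.2); case: p h => a t h.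
by rewrite /lT /= => ->.
Qed.
Lemma inverse_oside p : inverse (letters p) ->
  oside ST (map fst (winv (letters p))) = lT ST p.1.
Proof.
move=> h; have := inverse_snd h (mem_head p.1 p.2); case: p h => a t h.
rewrite /lT /letters /winv /= rev_cons map_rcons oside_rcons.
by move=> /negPf->.
Qed.
Lemma inverse_iside p : inverse (letters p) ->
  iside ST (map fst (winv (letters p))) = ~~ lS ST (wlast p).
Proof.
move=> h; have := inverse_snd h (mem_last p.1 p.2); case: p h => a t h.
rewrite /wlast /lS /letters /winv lastI map_rcons rev_rcons /=.
by move=> /negPf->.
Qed.

End LetterPaths.

Section BandEdges.
Variables (G : gentle) (ST : string_functions G).
Variables (w : word G) (hw : homotopy_band ST w).
Notation L := (size (parts ST w)).
Implicit Types i j l : 'I_L.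

Definition edge_dir l : bool := direct (letters (sigma l)).

(* The edge l of the band is the path underlying sigma_l; its starting vertex
   is that of the node [esrc l], and the differential maps the summand at
   [etgt l] to the summand at [esrc l]. *)
Definition epath l : seq (arrow G) :=
  map fst (if edge_dir l then letters (sigma l) else winv (letters (sigma l))).
Definition esrc l : 'I_L := if edge_dir l then l else ord_pred l.
Definition etgt l : 'I_L := if edge_dir l then ord_pred l else l.

Lemma edge_inverse l : ~~ edge_dir l -> inverse (letters (sigma l)).
Proof.
have /and3P[_ /allP al _] := presentation_parts ST (band_string hw).
move=> /negPf nd; have := al (sigma l) (mem_tnth l (in_tuple (parts ST w))).
by rewrite -[direct _]/(edge_dir l) nd.
Qed.

Lemma sigma_nth (p0 : word G) l : sigma l = nth p0 (parts ST w) l.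
Proof. by rewrite /sigma (tnth_nth p0). Qed.

Lemma sigma0 l : l = 0%N :> nat -> sigma l = head w (parts ST w).
Proof. by move=> l0; rewrite (sigma_nth w) l0 nth0. Qed.
Lemma sigma_last l : l = 0%N :> nat -> sigma (ord_pred l) = last w (parts ST w).
Proof.
move=> l0; rewrite (sigma_nth w) /= l0 add0n.
have := band_parts hw => L0; rewrite modn_small ?prednK //.
by rewrite (last_nth w); case: (parts ST w) L0.
Qed.

Lemma last_flatten (T : Type) (c : T) (s : seq (seq T)) (t : seq T) :
  last c (flatten (rcons s t)) = last (last c (flatten s)) t.
Proof. by rewrite -cats1 flatten_cat /= cats0 last_cat. Qed.

Lemma band_wlast l : l = 0%N :> nat -> wlast (sigma (ord_pred l)) = wlast w.
Proof.
move=> l0; rewrite sigma_last //.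
have /and3P[/eqP fE _ _] := presentation_parts ST (band_string hw).
have -> : wlast w = last w.1 (letters w) by [].
rewrite -fE; have := band_parts hw; case/lastP: (parts ST w) => // s p _.
by rewrite map_rcons last_flatten last_rcons.
Qed.
Lemma band_wfirst l : l = 0%N :> nat -> (sigma l).1 = w.1.
Proof.
move=> l0; rewrite sigma0 // /parts.
by have [v [r ->]] := parts_rec_cons ST w.1 w.2.
Qed.

(** For [l = 0] this is the cyclic junction from the last part to the first. The parts there have
    opposite directions by [band_ends], so that being defined means exactly the sign condition of a
    band. *)
Lemma edge_junction l : wsrc (sigma (ord_pred l)) = wtgt (sigma l) /\
  ldefined ST (wlast (sigma (ord_pred l))) (sigma l).1.
Proof.
have [l0|lp] := posnP l; last first.
  by have /andP[/eqP] := sigma_adjacent hw lp.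
have := band_wlast l0; have := band_wfirst l0; move=> E1 E2; split.
  by rewrite /wsrc /wtgt E1 E2; exact: (band_closed hw).
have E : (wlast (sigma (ord_pred l))).2 != (sigma l).1.2.
  have m1 := mem_last (sigma (ord_pred l)).1 (sigma (ord_pred l)).2.
  have m2 := mem_head (sigma l).1 (sigma l).2.
  have := band_ends hw; rewrite -(sigma0 l0) -(sigma_last l0) => /orP[] /andP[h1 h2].
    by rewrite (negPf (inverse_snd h2 m1)) (direct_snd h1 m2).
  by rewrite (negPf (inverse_snd h1 m2)) (direct_snd h2 m1).
rewrite /ldefined (negPf E) E1 E2; apply/eqP; exact: (band_sign hw).
Qed.

Lemma epath_gpath l :
  gpath (band_vertex (esrc l)) (band_vertex (etgt l)) (epath l).
Proof.
rewrite /band_vertex /esrc /etgt /epath; have [e _] := edge_junction l.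
have [d|/edge_inverse i] := ifPn.
  by rewrite e direct_gpath.
by rewrite e inverse_gpath.
Qed.

Lemma epath_neq0 l : epath l != [::].
Proof.
by rewrite /epath; case: ifP => _; rewrite -size_eq0 ?/winv ?size_map ?size_rev ?size_map.
Qed.

(* Half-edges: (l, true) is the right end of sigma_l, at the node l, and
   (l, false) its left end, at the node l - 1. *)
Implicit Type h : 'I_L * bool.
Definition hnode h : 'I_L := if h.2 then h.1 else ord_pred h.1.
Definition hout h : bool := h.2 == edge_dir h.1.
Definition hside h : bool :=
  if hout h then oside ST (epath h.1) else iside ST (epath h.1).
Definition hmate h : 'I_L * bool :=
  if h.2 then (ordS h.1, false) else (ord_pred h.1, true).

Lemma hside_left l : hside (l, false) = if edge_dir l then ~~ lT ST (sigma l).1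
  else lT ST (sigma l).1.
Proof.
rewrite /hside /hout /epath /=; case d: (edge_dir l) => /=.
  exact: direct_iside.
by rewrite inverse_oside // edge_inverse // d.
Qed.
Lemma hside_right l : hside (l, true) = if edge_dir l then lS ST (wlast (sigma l))
  else ~~ lS ST (wlast (sigma l)).
Proof.
rewrite /hside /hout /epath /=; case d: (edge_dir l) => /=.
  exact: direct_oside.
by rewrite inverse_iside // edge_inverse // d.
Qed.

Lemma edge_dir_letter l c : c \in letters (sigma l) -> c.2 = edge_dir l.
Proof.
have [d|/edge_inverse i] := boolP (edge_dir l); first exact: direct_snd.
by move=> /(inverse_snd i)/negPf.
Qed.

Lemma hnode_mate h : hnode (hmate h) = hnode h.
Proof. by case: h => l []; rewrite /hnode /hmate /= ?ordSK. Qed.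
(** This is what it means for consecutive parts to have a defined composition: whatever their
    directions, the two edges that meet at a node use different sides of its vertex. *)
Lemma hside_mate h : hside (hmate h) = ~~ hside h.
Proof.
have main l : hside (l, false) = ~~ hside (ord_pred l, true).
  rewrite hside_left hside_right; have [_] := edge_junction l.
  rewrite /ldefined.
  rewrite (edge_dir_letter (mem_last (sigma (ord_pred l)).1 _)).
  rewrite (edge_dir_letter (mem_head (sigma l).1 _)).
  by case: (edge_dir l); case: (edge_dir _) => /= /eqP->; rewrite ?negbK.
case: h => l []; rewrite /hmate /=; first by rewrite main ordSK.
by rewrite main negbK.
Qed.

Lemma hnode_mateP h h' : hnode h = hnode h' -> h = h' \/ h = hmate h'.
Proof.
case: h h' => l e [l' e']; rewrite /hnode /hmate /=.
case: e e' => -[] => [->|->|<-|/ord_pred_inj->]; rewrite ?ordSK ?ord_predK; auto.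
Qed.

Lemma half_edge_inj h h' : hnode h = hnode h' -> hside h = hside h' -> h = h'.
Proof. by move=> /hnode_mateP[//|->]; rewrite hside_mate; case: hside. Qed.

Definition half_edge i (b : bool) : 'I_L * bool :=
  if hside (i, true) == b then (i, true) else hmate (i, true).
Lemma half_edge_node i b : hnode (half_edge i b) = i.
Proof. by rewrite /half_edge; case: ifP; rewrite ?hnode_mate. Qed.
Lemma half_edge_side i b : hside (half_edge i b) = b.
Proof.
rewrite /half_edge; case: eqP => [//|]; rewrite hside_mate.
by case: hside; case: b.
Qed.

Lemma esrc_half l : hnode (l, edge_dir l) = esrc l. Proof. by []. Qed.
Lemma etgt_half l : hnode (l, ~~ edge_dir l) = etgt l.
Proof. by rewrite /hnode /etgt if_neg. Qed.
Lemma hside_src l : hside (l, edge_dir l) = oside ST (epath l).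
Proof. by rewrite /hside /hout eqxx. Qed.
Lemma hside_tgt l : hside (l, ~~ edge_dir l) = iside ST (epath l).
Proof. by rewrite /hside /hout /=; case: edge_dir. Qed.

Lemma esrc_inj l l' : esrc l = esrc l' ->
  oside ST (epath l) = oside ST (epath l') -> l = l'.
Proof.
move=> e s; suff [] : (l, edge_dir l) = (l', edge_dir l') by [].
by apply: half_edge_inj; rewrite ?esrc_half // !hside_src.
Qed.
Lemma etgt_inj l l' : etgt l = etgt l' ->
  iside ST (epath l) = iside ST (epath l') -> l = l'.
Proof.
move=> e s; suff [] : (l, ~~ edge_dir l) = (l', ~~ edge_dir l') by [].
by apply: half_edge_inj; rewrite ?etgt_half // !hside_tgt.
Qed.
(** By [gpath_cat] the path of [l'] followed by that of [l] contains a relation; this is the reason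
    why the differential squares to zero. *)
Lemma esrc_etgt l l' : esrc l = etgt l' ->
  oside ST (epath l) = ~~ iside ST (epath l').
Proof.
move=> e; have /hnode_mateP[E|E] : hnode (l, edge_dir l) = hnode (l', ~~ edge_dir l').
- by rewrite esrc_half etgt_half.
- by case: E => <-; case: edge_dir.
by rewrite -hside_src E hside_mate hside_tgt.
Qed.

Lemma edge_at_side i b :
  (exists2 l, esrc l = i & oside ST (epath l) = b) \/
  (exists2 l, etgt l = i & iside ST (epath l) = b).
Proof.
have := half_edge_node i b; have := half_edge_side i b.
case: (half_edge i b) => l e; rewrite /hside /hout /=.
case: eqP => [->|/eqP ne] s n; [left|right]; exists l => //.
by rewrite -etgt_half; move: ne n; case: e; case: edge_dir.
Qed.

End BandEdges.

Section BandDegree.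
Variables (G : gentle) (ST : string_functions G) (m : int).
Variables (w : word G) (hw : homotopy_band ST w).
Notation L := (size (parts ST w)).
Import GRing.Theory.
Local Open Scope ring_scope.

Lemma pdeg_rcons (ps : seq (word G)) p :
  pdeg (rcons ps p) = pdeg ps + (direct (letters p) : nat)%:Z - (inverse (letters p) : nat)%:Z.
Proof. by rewrite /pdeg -cats1 !count_cat /= !addn0; lia. Qed.

(** For [l = 0] the preceding node is the last one, reached after the whole of [w]; the condition
    [deg w = 0] makes the grading close up around the band. *)
Lemma edge_degree (l : 'I_L) :
  band_degree m (esrc l) = isucc (band_degree m (etgt l)).
Proof.
have main : band_degree m l = band_degree m (ord_pred l) +
    (direct (letters (sigma l)) : nat)%:Z - (inverse (letters (sigma l)) : nat)%:Z.
  rewrite /band_degree (take_nth w) // pdeg_rcons -(sigma_nth w).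
  suff -> : pdeg (take (ord_pred l).+1 (parts ST w)) = pdeg (take l (parts ST w)) by lia.
  have [l0|lp] := posnP l.
    rewrite /= l0 add0n modn_small ?prednK ?take_size ?take0 ?(band_parts hw) //.
    exact: (band_deg hw).
  congr (pdeg (take _ _)); have := ltn_ord l.
  have -> : val (ord_pred l) = ((l + L).-1 %% L)%N by [].
  have -> : ((l + L).-1 = l.-1 + L)%N by lia.
  by rewrite modnDr => ll; rewrite modn_small; lia.
rewrite /esrc /etgt; case d: (edge_dir l); rewrite /isucc main -[direct _]/(edge_dir l) d.
  by rewrite (direct_inverse d) /=; lia.
by rewrite edge_inverse ?d //=; lia.
Qed.

End BandDegree.

(** * Primitivity *)

(** Euclid's algorithm on the lengths: the shorter word is a prefix of the longer one, and removing
    it leaves two commuting words. *)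
Lemma cat_comm_power (T : eqType) (u v : seq T) : u != [::] -> v != [::] ->
  u ++ v = v ++ u ->
  exists z i j, [/\ u = flatten (nseq i z), v = flatten (nseq j z), (0 < i)%N & (0 < j)%N].
Proof.
have [n] := ubnP (size u + size v)%N; elim: n u v => // n IH u v.
have aux (a b : seq T) : (size a + size b < n.+1)%N -> (size a <= size b)%N ->
    a != [::] -> b != [::] -> a ++ b = b ++ a ->
    exists z i j, [/\ a = flatten (nseq i z), b = flatten (nseq j z), (0 < i)%N & (0 < j)%N].
  move=> lt le an bn E.
  have [c bE] : exists c, b = a ++ c.
    exists (drop (size a) b); rewrite -{1}(cat_take_drop (size a) b); congr cat.
    by have := congr1 (take (size a)) E; rewrite take_size_cat // takel_cat.
  have [c0|cn] := eqVneq c [::].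
    exists a, 1%N, 1%N; split=> //; first by rewrite /= cats0.
    by rewrite bE c0 /= !cats0.
  have E' : a ++ c = c ++ a.
    by move: E; rewrite bE -catA => /eqP; rewrite eqseq_cat // eqxx /= => /eqP.
  have sa : (0 < size a)%N by rewrite lt0n size_eq0.
  have [|z [i [j [aE cE i0 j0]]]] := IH a c _ an cn E'.
    by move: lt; rewrite bE size_cat; lia.
  exists z, i, (i + j)%N; split=> //; last by rewrite addn_gt0 i0.
  by rewrite bE nseqD flatten_cat {1}aE cE.
move=> lt un vn E; have [le|/ltnW le] := leqP (size u) (size v); first exact: aux.
have [|z [i [j []]]] := aux v u _ le vn un (esym E); first by rewrite addnC.
by move=> *; exists z, j, i.
Qed.

Section Primitivity.
Variables (G : gentle) (ST : string_functions G).
Variables (w : word G) (hw : homotopy_band ST w).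
Notation L := (size (parts ST w)).
Implicit Types (i j l : 'I_L) (h : 'I_L * bool).

Lemma band_parts_rot d : (0 < d < L)%N -> rot d (parts ST w) <> parts ST w.
Proof.
move=> /andP[d0 dL] E; apply: (band_primitive hw).
set ps := parts ST w in E d0 dL *.
have un : take d ps != [::] by rewrite -size_eq0 size_take dL -lt0n.
have vn : drop d ps != [::] by rewrite -size_eq0 size_drop subn_eq0 -ltnNge.
have E2 : take d ps ++ drop d ps = drop d ps ++ take d ps.
  by rewrite cat_take_drop -[LHS]E.
have [z [i [j [uE vE i0 j0]]]] := cat_comm_power un vn E2.
have psE : ps = flatten (nseq (i + j) z).
  by rewrite -(cat_take_drop d ps) uE vE nseqD flatten_cat.
have zn : z != [::] by apply: contraNneq un => z0; rewrite uE z0; elim: (i).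
have /and3P[/eqP fE _ sp] := presentation_parts ST (band_string hw).
case: z zn psE {uE vE} => // p z' _; set z := p :: z' => psE.
pose u := flatten (map (@letters G) z).
have uE : u = p.1 :: behead u by [].
pose w' : word G := (p.1, behead u).
have w'E : letters w' = u by [].
have wE : letters w = flatten (nseq (i + j) u).
  by rewrite -fE -/ps psE map_flatten map_nseq; elim: (i + j)%N => // n IHn; rewrite [LHS]flatten_cat IHn.
(* Since [i + j >= 2], the word begins with [u u]: the first copy is a homotopy string, and the
   junction of the two copies shows that it is closed. *)
have wE2 : letters w = u ++ u ++ flatten (nseq (i + j).-2 u).
  by rewrite wE; case: (i) i0 => // i' _; case: (j) j0 => // j' _; rewrite addSn addnS.
exists w', (i + j)%N; split.
- have := band_string hw; rewrite /homotopy_string wE2 w'E.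
  by move=> /cat_sorted2[].
- by rewrite wE2 w'E !size_cat uE /=; lia.
- have := band_string hw; rewrite /homotopy_string wE2.
  have lu : u = w'.1 :: w'.2 by [].
  rewrite lu => /sorted_junction; rewrite -/(wlast w').
  by move=> /andP[/eqP].
- by rewrite addn_gt0 i0.
by rewrite wE.
Qed.

Lemma iter_ordS t l : iter t (@ordS L) l = ((l + t) %% L)%N :> nat.
Proof.
elim: t => [|t IH]; first by rewrite addn0 modn_small.
by rewrite iterS [LHS]/= IH -addn1 modnDml addn1 addnS.
Qed.

Lemma iter_ordS_L l : iter L (@ordS L) l = l.
Proof. by apply: val_inj; rewrite /= iter_ordS modnDr modn_small. Qed.

Lemma iter_inj (T : Type) (f : T -> T) t : injective f -> injective (iter t f).
Proof. by move=> fi; elim: t => // t IH x y /fi/IH. Qed.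

Lemma iter_ord_predK t l : iter t (@ordS L) (iter t (@ord_pred L) l) = l.
Proof. by elim: t l => // t IH l; rewrite iterSr iterS ord_predK IH. Qed.

Lemma iter_ord_pred_L t l : (t <= L)%N ->
  iter (L - t) (@ord_pred L) l = iter t (@ordS L) l.
Proof.
move=> tL; apply: (iter_inj (t := L - t) (@ordS_inj L)).
by rewrite iter_ord_predK -iterD subnK // iter_ordS_L.
Qed.

Lemma letters_sigma l : letters (sigma l) = map (fun a => (a, edge_dir l))
  (if edge_dir l then epath l else rev (epath l)).
Proof.
rewrite /epath; case d: (edge_dir l); last first.
  rewrite /winv [map fst _]map_rev revK -!map_comp -[LHS]map_id; apply/eq_in_map => c cl.
  by move: (edge_dir_letter hw cl); rewrite d; case: c {cl} => a [].
rewrite -map_comp -[LHS]map_id; apply/eq_in_map => c cl.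
by move: (edge_dir_letter hw cl); rewrite d; case: c {cl} => a [].
Qed.

Lemma sigma_eq l l' : edge_dir l = edge_dir l' -> epath l = epath l' ->
  sigma l = sigma l'.
Proof.
move=> d e; have := letters_sigma l; rewrite d e -letters_sigma.
by case: (sigma l) (sigma l') => a s [b t] [-> ->].
Qed.

(** If two positions give the same cyclic sequence, the rotation by their difference fixes the
    sequence of parts, against [band_parts_rot]. *)
Lemma sigma_iter_inj l l' :
  (forall t, (t < L)%N -> sigma (iter t (@ordS L) l) = sigma (iter t (@ordS L) l')) ->
  l = l'.
Proof.
have main (a b : 'I_L) : (a < b)%N ->
    (forall t, (t < L)%N -> sigma (iter t (@ordS L) a) = sigma (iter t (@ordS L) b)) -> False.
  move=> ab E; have bL := ltn_ord b.
  have d0 : (0 < b - a < L)%N by apply/andP; split; lia.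
  apply: (band_parts_rot d0); apply: (can_inj (rotK a)).
  rewrite -rotD; last by rewrite subnKC // ltnW.
  rewrite subnKC; last exact: ltnW.
  apply: (@eq_from_nth _ w); first by rewrite !size_rot.
  have nth_rot (c : 'I_L) t : (t < L)%N ->
      nth w (rot c (parts ST w)) t = sigma (iter t (@ordS L) c).
    move=> tL; rewrite (sigma_nth w) iter_ordS /rot nth_cat size_drop nth_drop.
    have cL := ltn_ord c.
    have [lt|ge] := ltnP t (L - c); first by rewrite modn_small //; lia.
    have -> : (c + t = (t - (L - c)) + L)%N by lia.
    by rewrite modnDr modn_small ?nth_take //; lia.
  by move=> t; rewrite size_rot => tL; rewrite !nth_rot // E.
move=> E; apply: val_inj; have [lt|lt|//] := ltngtP (val l) (val l').
  by case: (main _ _ lt E).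
by case: (main _ _ lt) => t tL; rewrite E.
Qed.

Definition hopp h : 'I_L * bool := (h.1, ~~ h.2).
(** Crosses the edge of [h] and takes the other half-edge at the node reached; iterating it runs
    around the band without ever turning back. *)
Definition hnext h := hmate (hopp h).

Lemma hnextE h : hnext h = if h.2 then (ord_pred h.1, true) else (ordS h.1, false).
Proof. by case: h => l []. Qed.

Lemma iter_hnext t l e :
  iter t hnext (l, e) = (iter t (if e then @ord_pred L else @ordS L) l, e).
Proof. by elim: t => //= t ->; rewrite hnextE; case: (e). Qed.

Lemma hout_opp h : hout (hopp h) = ~~ hout h.
Proof. by rewrite /hout; case: h => l []; case: edge_dir. Qed.

Lemma hside_next h h' : hout h = hout h' -> epath h.1 = epath h'.1 ->
  hside (hnext h) = hside (hnext h').
Proof. by move=> o e; rewrite !hside_mate // /hside !hout_opp o e. Qed.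

Fixpoint agree t h h' : bool := if t is t'.+1 then
  [&& hout h == hout h', epath h.1 == epath h'.1 & agree t' (hnext h) (hnext h')]
  else true.

Lemma agreeP t h h' : agree t h h' -> forall s, (s < t)%N ->
  hout (iter s hnext h) = hout (iter s hnext h') /\
  epath (iter s hnext h).1 = epath (iter s hnext h').1.
Proof.
elim: t h h' => // t IH h h' /= /and3P[/eqP o /eqP e a] [_|s lt] //.
by rewrite !iterSr; apply: IH.
Qed.

(* Two opposite directions of travel would meet, at an edge or at a node. *)
Lemma agree_opposite l l' : hside (l, false) = hside (l', true) ->
  ~~ agree L.+1 (l, false) (l', true).
Proof.
move=> s0; apply/negP=> /agreeP A.
have side t : (t <= L)%N ->
    hside (iter t hnext (l, false)) = hside (iter t hnext (l', true)).
  case: t => // t tL; rewrite !iterS; have [o e] := A t (ltnW tL).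
  exact: hside_next.
pose d := ((l' + L - l) %% L)%N.
have lL := ltn_ord l; have lL' := ltn_ord l'.
have dL : (d < L)%N by rewrite ltn_mod; lia.
have dE : iter d (@ordS L) l = l'.
  apply: val_inj; rewrite /= iter_ordS /d modnDmr.
  have -> : (l + (l' + L - l) = l' + L)%N by lia.
  by rewrite modnDr modn_small.
have meet t : (t <= d)%N -> iter t (@ord_pred L) l' = iter (d - t) (@ordS L) l.
  move=> td; apply: (iter_inj (t := t) (@ordS_inj L)).
  by rewrite iter_ord_predK -iterD subnKC // dE.
(* For odd [d] the walks arrive at a common node with mate half-edges, which lie on opposite sides.
   For even [d] they stand at the two ends of one edge, which is outgoing at one end and incoming at
   the other. *)
have [od|ev] := boolP (odd d).
  have dd := odd_double_half d; rewrite od in dd.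
  have /= := side d./2.+1; rewrite !iter_hnext /= meet; last by lia.
  have -> : (d - d./2 = d./2.+1)%N by lia.
  move=> H; have := hside_mate hw (iter d./2.+1 (@ordS L) l, false).
  by rewrite /hmate /= -H; [case: hside|lia].
have dd := odd_double_half d; rewrite (negPf ev) in dd.
have [] := A d./2; first by lia.
rewrite !iter_hnext meet; last by lia.
have -> : (d - d./2 = d./2)%N by lia.
by rewrite /hout /=; case: edge_dir.
Qed.

(** Opposite directions are excluded by [agree_opposite], and equal directions give equal cyclic
    sequences. A walk towards lower indices is compared at its steps [L - t], with [t = 0] included;
    this requires agreement on [L.+1] edges. *)
Lemma agree_inj h h' : hside h = hside h' -> agree L.+1 h h' -> h = h'.
Proof.
have sym t (a b : 'I_L * bool) : agree t a b = agree t b a.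
  elim: t a b => //= t IH a b; rewrite IH [hout a == _]eq_sym.
  by rewrite [epath a.1 == _]eq_sym.
case: h h' => l e [l' e'] s A; have [E|ne] := eqVneq e e'; last first.
  case: e e' ne s A => -[] // _ s A.
    by move: A; rewrite sym (negPf (agree_opposite (esym s))).
  by move: A; rewrite (negPf (agree_opposite s)).
rewrite -E in A *; congr (_, _); apply: sigma_iter_inj => t tL.
have eqs u : (u <= L)%N -> sigma (iter u hnext (l, e)).1 = sigma (iter u hnext (l', e)).1.
  move=> uL; have [] := agreeP A (s := u) uL; rewrite !iter_hnext /hout /=.
  by move=> d; apply: sigma_eq; move: d; case: e {A s E}; do 2!case: edge_dir.
case: e eqs {s A E} => eqs.
  by have := eqs (L - t)%N (leq_subr _ _); rewrite !iter_hnext /= !iter_ord_pred_L // ltnW.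
by have := eqs t (ltnW tL); rewrite !iter_hnext.
Qed.

End Primitivity.

Import Order.TTheory GRing.Theory Num.Theory.
Local Open Scope ring_scope.

(** * Traces and functionals on spaces of linear maps *)

Section Trace.
Import VectorInternalTheory.
Variable k : fieldType.
Implicit Types U V : vectType k.

Definition ltrace U (f : 'End(U)) : k^o := \tr (f2mx f).

Lemma f2mx_comp U V W (g : 'Hom(V, W)) (f : 'Hom(U, V)) :
  f2mx (g \o f)%VF = f2mx f *m f2mx g.
Proof.
have -> : (g \o f)%VF = Hom (f2mx f *m f2mx g); last by [].
apply/lfunP=> u; rewrite comp_lfunE.
by rewrite !unlock /= r2vK mulmxA.
Qed.

Lemma f2mx_linear U V : linear (@f2mx k U V).
Proof.
move=> a f g; have -> : a *: f + g = Hom (a *: f2mx f + f2mx g); last by [].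
apply/lfunP=> u; rewrite add_lfunE scale_lfunE !unlock /= mulmxDr linearD /=.
by rewrite -scalemxAr linearZ.
Qed.

Lemma ltraceC U V (g : 'Hom(V, U)) (f : 'Hom(U, V)) :
  ltrace (g \o f)%VF = ltrace (f \o g)%VF.
Proof. by rewrite /ltrace !f2mx_comp mxtrace_mulC. Qed.

Lemma ltrace_linear U : linear (@ltrace U).
Proof. by move=> a f g; rewrite /ltrace f2mx_linear linearP. Qed.

HB.instance Definition _ U :=
  GRing.isLinear.Build k 'End(U) k^o _ (@ltrace U) (@ltrace_linear U).

Lemma ltrace_nondegenerate U V (q : 'Hom(U, V)) :
  (forall f : 'Hom(V, U), ltrace (q \o f)%VF = 0) -> q = 0.
Proof.
move=> q0; have E : f2mx q = 0; last first.
  by apply/lfunP=> u; rewrite zero_lfunE unlock /= E mulmx0 linear0.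
apply/matrixP=> i j; rewrite mxE; have := q0 (Hom (delta_mx j i)).
rewrite /ltrace f2mx_comp /= => <-.
rewrite /mxtrace (bigD1 j) //= big1 => [|l nl].
  rewrite addr0 mxE (bigD1 i) //= big1 => [|l nl]; first by rewrite mxE !eqxx mul1r addr0.
  by rewrite mxE (negPf nl) andbF mul0r.
by rewrite mxE big1 // => l' _; rewrite mxE (negPf nl) mul0r.
Qed.

(** The trace pairing of Hom(U, V) with Hom(V, U) is perfect; the entries of [z] are the values of
    [F] on the matrix units. *)
Lemma ltrace_represents U V (F : 'Hom(U, V) -> k^o) : linear F ->
  exists z : 'Hom(V, U), forall f, F f = ltrace (z \o f)%VF.
Proof.
move=> lF.
exists (Hom (\matrix_(j, i) F (Hom (delta_mx i j)))) => f.
rewrite /ltrace f2mx_comp /= {1}(_ : f = \sum_(c : 'I_(dim U) * 'I_(dim V))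
  f2mx f c.1 c.2 *: Hom (delta_mx c.1 c.2)); last first.
  apply: val_inj; rewrite /= (lin_sumZ (@f2mx_linear U V)).
  by rewrite {1}[f2mx f]matrix_sum_delta pair_big.
rewrite lin_sumZ // -(pair_bigA _ (fun i j => f2mx f i j *: F (Hom (delta_mx i j)))) /=.
by apply: eq_bigr => i _; rewrite mxE; apply: eq_bigr => j _; rewrite mxE.
Qed.

End Trace.

Lemma functional_factor (k : fieldType) (V0 V1 : vectType k) (D : 'Hom(V0, V1))
    (F : 'Hom(V0, k^o)) : (forall v, D v = 0 -> F v = 0) ->
  exists Z : 'Hom(V1, k^o), (Z \o D)%VF = F.
Proof.
move=> F0; exists (F \o D^-1)%VF; apply/lfunP=> v; rewrite !comp_lfunE.
have /F0 : D (v - D^-1%VF (D v)) = 0.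
  by rewrite linearB /= limg_lfunVK ?subrr // memv_img ?memvf.
by rewrite linearB => /subr0_eq.
Qed.

(** * Representations *)

Section Representations.
Variables (k : fieldType) (G : gentle).
Implicit Types (M N : rep k G) (x y z : vertex G).

Lemma kG_decomp (x y : vertex G) (e : kG k x y) :
  e = \sum_p e p *: (kpath k p : kG k x y).
Proof.
apply/ffunP=> q; rewrite sum_ffunE (bigD1 q) //= big1 => [|s ns].
  by rewrite !ffunE eqxx addr0 [RHS]mulr1.
by rewrite !ffunE eq_sym (negPf ns) [LHS]mulr0.
Qed.

Lemma ract_kpath M x y (e : kG k x y) :
  ract M e = \sum_p e p *: ract M (kpath k p).
Proof. by rewrite {1}[e]kG_decomp; apply: lin_sumZ; apply: ract_linear. Qed.

Lemma kcomp_kpath x y z (p : Path y z) (q : Path x y) :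
  kcomp (kpath k p) (kpath k q) =
  \sum_(r : Path x z | r == p ++ q :> seq _) kpath k r.
Proof.
apply/ffunP=> /= r; rewrite sum_ffunE ffunE.
rewrite (bigD1 p) //= [X in _ + X]big1 => [|s ns]; last first.
  by rewrite big1 // => t _; rewrite ffunE (negPf ns) scale0r.
rewrite addr0 (eq_bigr (fun s => if s == q then 1 else 0 : k)); last first.
  by move=> s _; rewrite !ffunE eqxx scale1r; case: ifP.
rewrite -big_mkcondr /=; under [RHS]eq_bigr do rewrite ffunE.
have [E|ne] := eqVneq (p ++ q) r.
  rewrite (bigD1 q) /=; last by rewrite E !eqxx.
  rewrite big1 => [|s /andP[/andP[_ /eqP->]]]; last by rewrite eqxx.
  rewrite (bigD1 r) /= ?E // eqxx big1 => [|s /andP[/eqP s1 s2]]; first by [].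
  by move: s2; rewrite -eq_arrows s1 -E eqxx.
rewrite big1 => [|s /andP[/eqP rE /eqP sq]]; last by rewrite -sq rE eqxx in ne.
rewrite big1 // => s /eqP sE; case: eqP => // rs; by rewrite rs sE eqxx in ne.
Qed.

Lemma kid_kpath (x : vertex G) : kid k x = kpath k (path1 x) :> kG k x x.
Proof. by []. Qed.

Lemma ract_cat M x y z (p : Path y z) (q : Path x y) v :
  ract M (kpath k p) (ract M (kpath k q) v) =
  \sum_(r : Path x z | r == p ++ q :> seq _) ract M (kpath k r) v.
Proof.
rewrite -comp_lfunE -ractM kcomp_kpath.
have rl := @ract_linear _ _ M x z.
rewrite (eq_bigr (fun r => 1 *: kpath k r)) => [|r _]; last by rewrite scale1r.
rewrite big_mkcond (eq_bigr (fun r : Path x z => ((r == p ++ q :> seq _)%:R : k) *: kpath k r)).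
  rewrite (lin_sumZ rl) sum_lfunE [RHS]big_mkcond; apply: eq_bigr => r _.
  by case: ifP; rewrite ?scale1r // scale0r zero_lfunE.
by move=> r _; case: ifP; rewrite ?scale0r.
Qed.

Definition mk_rhom M N (f : forall x, 'Hom(M x, N x))
  (H : forall x y (p : Path x y) u,
     f y (ract M (kpath k p) u) = ract N (kpath k p) (f x u)) : rhom M N.
Proof.
exists f => x y e; apply/lfunP=> u; rewrite !comp_lfunE [in LHS]ract_kpath [in RHS]ract_kpath.
rewrite !sum_lfunE linear_sum; apply: eq_bigr => p _.
by rewrite !scale_lfunE linearZ /= H.
Defined.

Lemma rcompv M N (P : rep k G) (g : rhom N P) (f : rhom M N) x u :
  rcomp g f x u = g x (f x u).
Proof. exact: comp_lfunE. Qed.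

Section Kernel.
Variables (M N : rep k G) (f : rhom M N).

Definition krep_act x y (e : kG k x y) :
    'Hom(subvs_of (lker (f x)), subvs_of (lker (f y))) :=
  linfun (fun u => vsproj (lker (f y)) (ract M e (vsval u))).

Lemma krep_actE x y (e : kG k x y) u : vsval (krep_act e u) = ract M e (vsval u).
Proof.
rewrite /krep_act lfunLE ?vsprojK //; last by move=> a v w; rewrite !linearP.
by rewrite memv_ker rmapE; have := valP u; rewrite memv_ker => /eqP->; rewrite linear0.
Qed.

Definition krep : rep k G.
Proof.
exists (fun x => subvs_of (lker (f x))) krep_act.
- move=> x y a e e'; apply/lfunP=> u; apply: val_inj.
  rewrite /= krep_actE ract_linear !add_lfunE !scale_lfunE.
  by rewrite linearP /= !krep_actE.
- move=> x; apply/lfunP=> u; apply: val_inj.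
  by rewrite /= krep_actE ract1 !lfunE.
move=> x y z e e'; apply/lfunP=> u; apply: val_inj.
by rewrite /= krep_actE ractM !comp_lfunE !krep_actE.
Defined.

Definition krep_in : rhom krep M.
Proof.
exists (fun x => linfun (vsval : subvs_of (lker (f x)) -> M x)) => x y e.
by apply/lfunP=> u; rewrite !comp_lfunE !lfunE /= krep_actE.
Defined.

Lemma krep_inE x u : krep_in x u = vsval u.
Proof. by rewrite /= lfunE. Qed.
End Kernel.

Definition radd M N (f g : rhom M N) : rhom M N.
Proof.
by exists (fun x => f x + g x) => x y e; rewrite comp_lfunDl comp_lfunDr !rmapP.
Defined.

Lemma rpair_actE M N x y (e : kG k x y) u :
  ract (rpair M N) e u = (ract M e u.1, ract N e u.2).
Proof. by rewrite /= pair_mxE !zero_lfunE addr0 add0r. Qed.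

Definition rcopair M1 M2 N (f : rhom M1 N) (g : rhom M2 N) : rhom (rpair M1 M2) N.
Proof.
exists (fun x => linfun (fun u : M1 x * M2 x => f x u.1 + g x u.2)) => x y e.
have lin z : linear (fun u : M1 z * M2 z => f z u.1 + g z u.2).
  by move=> a u v; rewrite /= !linearP /= scalerDr addrACA.
apply/lfunP=> u; rewrite !comp_lfunE rpair_actE (lfunLE (lin x)) (lfunLE (lin y)) /=.
by rewrite !rmapE linearD.
Defined.
Lemma rcopairE M1 M2 N (f : rhom M1 N) (g : rhom M2 N) x u :
  rcopair f g x u = f x u.1 + g x u.2.
Proof.
rewrite /= lfunLE // => a v w; by rewrite /= !linearP /= scalerDr addrACA.
Qed.

Definition rpairing M N1 N2 (f : rhom M N1) (g : rhom M N2) : rhom M (rpair N1 N2).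
Proof.
exists (fun x => linfun (fun u : M x => (f x u, g x u))) => x y e.
have lin z : linear (fun u : M z => (f z u, g z u)).
  by move=> a u v; rewrite !linearP.
apply/lfunP=> u; rewrite !comp_lfunE rpair_actE (lfunLE (lin x)) (lfunLE (lin y)) /=.
by rewrite !rmapE.
Defined.
Lemma rpairingE M N1 N2 (f : rhom M N1) (g : rhom M N2) x u :
  rpairing f g x u = (f x u, g x u).
Proof. by rewrite /= lfunLE // => a v w; rewrite !linearP. Qed.

Definition rpr2 M N : rhom (rpair M N) N.
Proof. exact: (rcopair (rzero M N) (rid N)). Defined.
Lemma rpr1E M N x u : rpr1 M N x u = u.1.
Proof. exact: pair_pr1E. Qed.
Lemma rpr2E M N x u : rpr2 M N x u = u.2.
Proof. by rewrite /rpr2 rcopairE /= zero_lfunE lfunE add0r. Qed.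

(** Projectivity is defined by lifting along epimorphisms, and [d] need not be one. The pullback of
    [d] and [f], which is the kernel of [(d, - f)], does map onto [P], and a section of that map
    gives the lift. *)
Lemma projective_lift (P B C : rep k G) (d : rhom B C) (f : rhom P C) :
  projective P -> (forall x u, exists v, d x v = f x u) ->
  exists h : rhom P B, forall x u, d x (h x u) = f x u.
Proof.
move=> Pproj surj.
pose p := rcopair d (ropp f).
have psurj x : limg ((rcomp (rpr2 B P) (krep_in p)) x) = fullv.
  apply/eqP; rewrite eqEsubv subvf andTb; apply/subvP=> u _.
  have [v vE] := surj x u.
  have vk : (v, u) \in lker (p x).
    by rewrite memv_ker rcopairE /= opp_lfunE vE subrr.
  apply/memv_imgP; exists (vsproj (lker (p x)) (v, u)); first exact: memvf.
  by rewrite rcompv rpr2E krep_inE vsprojK.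
have [h hE] := Pproj _ _ _ (rid P) psurj.
exists (rcomp (rpr1 B P) (rcomp (krep_in p) h)) => x u.
have /lfunP/(_ u) := hE x; rewrite comp_lfunE !rcompv rpr2E krep_inE rpr1E.
rewrite [in RHS]lfunE /= => E; rewrite -[in RHS]E.
have := valP (h x u); rewrite memv_ker rcopairE opp_lfunE subr_eq0.
by move=> /eqP.
Qed.

End Representations.

Lemma isucc_ind (P : int -> Prop) : (forall n, P (isucc n)) -> forall n, P n.
Proof. by move=> H n; rewrite -[n](subrK 1); apply: H. Qed.

Lemma isucc_inj : injective isucc.
Proof. by move=> m n; rewrite /isucc; lia. Qed.

(* Inverts the shift on graded families, the transport along
   [(n - 1) + 1 = n] being confined to this proof. *)
Lemma unshift (A : int -> Type) (F : forall n, A (isucc n)) :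
  exists F' : forall n, A n, forall n, F' (isucc n) = F n.
Proof.
have E n : isucc (n - 1) = n by rewrite /isucc subrK.
exists (fun n => ecast m (A m) (E n) (F (n - 1))) => n.
move: (E (isucc n)); have -> : isucc n - 1 = n by rewrite /isucc addrK.
by move=> e; rewrite eq_axiomK.
Qed.

Lemma dim0P (k : fieldType) (V : vectType k) (v : V) : dim V = 0%N -> v = 0.
Proof.
move=> V0; apply/eqP; rewrite -memv0.
suff -> : (0 = fullv :> {vspace V})%VS by apply: memvf.
by apply/eqP; rewrite eq_sym -dimv_eq0 dimvf V0.
Qed.

(** * Homotopies *)

Section Homotopy.
Variables (k : fieldType) (G : gentle).
Implicit Types X Y Z W : cplx k G.

Lemma cdiff2v X n x u : cdiff X (isucc n) x (cdiff X n x u) = 0.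
Proof. by move/lfunP/(_ u): (cdiff2 X n x); rewrite comp_lfunE zero_lfunE. Qed.

Lemma cfunv X Y (f : cmap X Y) n x u :
  f (isucc n) x (cdiff X n x u) = cdiff Y n x (f n x u).
Proof. by move/lfunP/(_ u): (cfunP f n x); rewrite !comp_lfunE. Qed.

Lemma mk_cmap X Y (f : forall n, rhom (X n) (Y n)) :
  (forall n x u, f (isucc n) x (cdiff X n x u) = cdiff Y n x (f n x u)) ->
  {f' : cmap X Y | forall n x u, f' n x u = f n x u}.
Proof.
move=> H; have H' n x : (f (isucc n) x \o cdiff X n x = cdiff Y n x \o f n x)%VF.
  by apply/lfunP=> u; rewrite !comp_lfunE H.
by exists (CMap H').
Qed.

Lemma homotopicP X Y (f g : cmap X Y) : homotopic f g <->
  exists h : forall n, rhom (X (isucc n)) (Y n), forall n x u,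
    f (isucc n) x u - g (isucc n) x u =
    cdiff Y n x (h n x u) + h (isucc n) x (cdiff X (isucc n) x u).
Proof.
split=> -[h hE]; exists h => n x.
  by move=> u; move/lfunP/(_ u): (hE n x); rewrite !add_lfunE opp_lfunE !comp_lfunE.
by apply/lfunP=> u; rewrite !add_lfunE opp_lfunE !comp_lfunE hE.
Qed.

Lemma ceq_homotopic X Y (f g : cmap X Y) :
  (forall n x u, f n x u = g n x u) -> homotopic f g.
Proof.
move=> E; apply/homotopicP; exists (fun n => rzero _ _) => n x u.
by rewrite E subrr /= !zero_lfunE linear0 addr0.
Qed.

Lemma homotopic_sym X Y (f g : cmap X Y) : homotopic f g -> homotopic g f.
Proof.
move=> /homotopicP[h hE]; apply/homotopicP; exists (fun n => ropp (h n)) => n x u.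
by rewrite /= !opp_lfunE linearN -opprD -hE opprB.
Qed.

Lemma homotopic_trans X Y (f g h : cmap X Y) :
  homotopic f g -> homotopic g h -> homotopic f h.
Proof.
move=> /homotopicP[a aE] /homotopicP[b bE]; apply/homotopicP.
exists (fun n => radd (a n) (b n)) => n x u.
rewrite /= !add_lfunE linearD addrACA -aE -bE.
by rewrite addrA subrK.
Qed.

Lemma ccompv X Y Z (g : cmap Y Z) (f : cmap X Y) n x u :
  ccomp g f n x u = g n x (f n x u).
Proof. exact: comp_lfunE. Qed.
Lemma cidv X n x u : cid X n x u = u.
Proof. exact: lfunE. Qed.
Lemma czerov X Y n x u : czero X Y n x u = 0.
Proof. exact: zero_lfunE. Qed.

Lemma homotopic_compl X Y Z (g : cmap Y Z) (f f' : cmap X Y) :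
  homotopic f f' -> homotopic (ccomp g f) (ccomp g f').
Proof.
move=> /homotopicP[h hE]; apply/homotopicP.
exists (fun n => rcomp (g n) (h n)) => n x u.
by rewrite !ccompv !rcompv -linearB hE linearD /= cfunv.
Qed.

Lemma homotopic_compr X Y Z (g g' : cmap Y Z) (f : cmap X Y) :
  homotopic g g' -> homotopic (ccomp g f) (ccomp g' f).
Proof.
move=> /homotopicP[h hE]; apply/homotopicP.
exists (fun n => rcomp (h n) (f (isucc n))) => n x u.
by rewrite !ccompv !rcompv hE cfunv.
Qed.

Definition cadd X Y (f g : cmap X Y) : cmap X Y.
Proof.
exists (fun n => radd (f n) (g n)) => n x.
by rewrite /= comp_lfunDl comp_lfunDr !cfunP.
Defined.
Definition copp X Y (f : cmap X Y) : cmap X Y.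
Proof.
exists (fun n => ropp (f n)) => n x.
by rewrite /= comp_lfunNl comp_lfunNr !cfunP.
Defined.
Lemma caddv X Y (f g : cmap X Y) n x u : cadd f g n x u = f n x u + g n x u.
Proof. exact: add_lfunE. Qed.
Lemma coppv X Y (f : cmap X Y) n x u : copp f n x u = - f n x u.
Proof. exact: opp_lfunE. Qed.

Lemma shiftv X n x u : cdiff (shift X) n x u = - cdiff X (isucc n) x u.
Proof. exact: opp_lfunE. Qed.

(* The solution is constructed by descending induction on the degree, starting
   where W vanishes; exactness and projectivity give each next component. *)
Lemma null_homotopy W (C : int -> rep k G)
    (dC : forall n, rhom (C n) (C (isucc n))) (phi : forall n, rhom (W n) (C n)) :
  (forall n x c, dC (isucc n) x c = 0 -> exists b, dC n x b = c) ->
  (forall n x u, phi (isucc n) x (cdiff W n x u) = dC n x (phi n x u)) ->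
  exists h : forall n, rhom (W (isucc n)) (C n), forall n x u,
    phi (isucc n) x u = dC n x (h n x u) + h (isucc n) x (cdiff W (isucc n) x u).
Proof.
move=> exC phiE; have [N HN] := cobj_bounded W.
pose good (h : forall n, rhom (W (isucc n)) (C n)) n := forall x u,
  phi (isucc n) x u = dC n x (h n x u) + h (isucc n) x (cdiff W (isucc n) x u).
have step j : exists h : forall n, rhom (W (isucc n)) (C n),
    forall n : int, N%:Z - j%:Z <= n -> good h n.
  elim: j => [|j [h hE]].
    exists (fun n => rzero _ _) => n le x u.
    have lt : (N < `|isucc n|)%N by rewrite /isucc; lia.
    by rewrite (@dim0P _ _ u (HN _ lt x)) !linear0 addr0.
  pose n0 : int := N%:Z - j.+1%:Z.
  pose psi := radd (phi (isucc n0)) (ropp (rcomp (h (isucc n0)) (cdiff W (isucc n0)))).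
  have psiE x u : psi x u =
      phi (isucc n0) x u - h (isucc n0) x (cdiff W (isucc n0) x u).
    by rewrite /= add_lfunE opp_lfunE comp_lfunE.
  have [|g gE] := projective_lift (d := dC n0) (f := psi) (@cobj_projective _ _ W (isucc n0)).
    move=> x u; apply: exC; rewrite psiE linearB /= -phiE.
    rewrite (hE (isucc n0)) ?cdiff2v ?linear0 ?addr0 ?subrr //.
    by rewrite /n0 /isucc; lia.
  exists (dfwith h g) => n le.
  have [->|ne] := eqVneq n n0 => x u.
    rewrite dfwith_in dfwith_out; last by rewrite /isucc; lia.
    by rewrite gE psiE subrK.
  by rewrite !dfwith_out; [apply: hE|..]; move: ne le; rewrite /n0 /isucc; lia.
(* The construction starts in degree [N] and after [2N + 2] steps reaches degree [- N - 2], below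
   which [W] vanishes again. *)
have [h hE] := step (N + N).+2; exists h => n x u.
have [le|lt] := leP (N%:Z - (N + N).+2%:Z) n; first exact: hE.
have lt' : (N < `|isucc n|)%N by rewrite /isucc; lia.
by rewrite (@dim0P _ _ u (HN _ lt' x)) !linear0 addr0.
Qed.

End Homotopy.

(** * Automorphisms of vector spaces *)

Section Automorphisms.
Variable k : fieldType.
Implicit Types A B : autom k.

Lemma amapv A B (f : ahom A B) v : f (aact A v) = aact B (f v).
Proof. by have /lfunP/(_ v) := amapP f; rewrite !comp_lfunE. Qed.

Lemma aact_injective A : injective (aact A).
Proof. by apply/lker0P; rewrite aact_inj. Qed.

Lemma mk_ahom A B (f : 'Hom(A, B)) : (forall v, f (aact A v) = aact B (f v)) ->
  {f' : ahom A B | f' =1 f}.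
Proof.
move=> H; have H' : (f \o aact A)%VF = (aact B \o f)%VF.
  by apply/lfunP=> v; rewrite !comp_lfunE H.
by exists (AHom H').
Qed.

Lemma aiso_of_bijective A B (g : ahom A B) :
  lker g == 0%VS -> limg g = fullv -> aiso B A.
Proof.
move=> g0 gf; have gK := lker0_lfunK g0; have gVK := limg_fullP gf.
have [|f fE] := @mk_ahom B A (g^-1)%VF.
  move=> v; apply: (can_inj gK); rewrite gVK amapv gVK //.
exists f, g; split; apply/lfunP=> v; rewrite comp_lfunE [RHS]lfunE /=.
  by move: (fE v) => ->.
by rewrite fE.
Qed.

Section Restriction.
Variables (A : autom k) (U : {vspace A}) (UA : (aact A @: U <= U)%VS).

Definition asub_act : 'End(subvs_of U) :=
  linfun (fun u => vsproj U (aact A (vsval u))).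
Lemma asub_actE u : vsval (asub_act u) = aact A (vsval u).
Proof.
rewrite /asub_act lfunLE ?vsprojK //; last by move=> a v w; rewrite !linearP.
by apply: (subvP UA); rewrite memv_img // subvsP.
Qed.
Fact asub_inj : lker asub_act = 0%VS.
Proof.
apply/eqP/lker0P=> u v E; apply: val_inj; apply: (@aact_injective A).
by rewrite -!asub_actE E.
Qed.
Definition asub : autom k := Autom asub_inj.
End Restriction.

Lemma aindecomposable_dsum A (U V : {vspace A}) :
  (aact A @: U <= U)%VS -> (aact A @: V <= V)%VS -> (U :&: V = 0)%VS ->
  (U + V = fullv)%VS -> aindecomposable A -> U = 0%VS \/ V = 0%VS.
Proof.
move=> UA VA UV0 UVf [_ ind].
pose B b : autom k := if b then asub UA else asub VA.
pose g0 (w : asum B) := vsval (w true : asub UA) + vsval (w false : asub VA).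
have lg0 : linear g0.
  by move=> a v w; rewrite /g0 !dsumDE !dsumZE !linearP /= scalerDr addrACA.
have [|g gE] := @mk_ahom (asum B) A (linfun g0).
  move=> w; rewrite (lfunLE lg0 w) (lfunLE lg0 (aact (asum B) w)) /g0 linearD /=.
  by rewrite !dsum_diagE /= !asub_actE.
have gE' w : g w = g0 w by rewrite gE lfunLE.
have gi : lker g == 0%VS.
  apply/eqP; apply/eqP; rewrite -subv0; apply/subvP=> w; rewrite memv_ker gE' /g0 memv0.
  rewrite addr_eq0 => /eqP E.
  have w1 : vsval (w true : asub UA) = 0.
    apply/eqP; rewrite -memv0 -UV0 memv_cap subvsP E memvN; exact: subvsP.
  apply/eqP/ffunP=> -[].
    by rewrite dsum0E; apply: val_inj; rewrite /= w1.
  rewrite dsum0E; apply: val_inj => /=.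
  by apply/eqP; rewrite -oppr_eq0; apply/eqP; rewrite -E w1.
have gs : limg g = fullv.
  apply/eqP; rewrite eqEsubv subvf andTb -UVf; apply/subvP=> v /memv_addP[u uU [v' vV ->]].
  pose w : asum B := [ffun b => if b as b return B b then vsproj U u else vsproj V v'].
  by apply/memv_imgP; exists w; rewrite ?memvf // gE' /g0 !ffunE !vsprojK.
have sub0 (W : {vspace A}) : fullv = 0%VS :> {vspace subvs_of W} -> W = 0%VS.
  move=> W0; apply/eqP; rewrite -subv0; apply/subvP=> v vW; rewrite memv0.
  have : vsproj W v \in 0%VS by rewrite -W0 memvf.
  by rewrite memv0 => /eqP E; rewrite -(vsprojK vW) E.
have [] := ind (asub UA) (asub VA) (aiso_of_bijective gi gs).
  by move=> /sub0; left.
by move=> /sub0; right.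
Qed.

(* Fitting: kernel and image of a high power of phi are stable and complementary. *)
Lemma aindecomposable_local A (phi : ahom A A) : aindecomposable A ->
  injective phi \/ injective (fun v => v - phi v).
Proof.
move=> ind; pose F n := iter n (fun f : 'End(A) => (phi \o f)%VF) \1%VF.
have FE n v : F n v = iter n phi v.
  elim: n => [|n IH]; first by rewrite lfunE.
  by rewrite /F iterS comp_lfunE -/(F n) IH.
have FD m n v : F (m + n)%N v = F m (F n v) by rewrite !FE iterD.
have Fmu n v : F n (aact A v) = aact A (F n v).
  by rewrite !FE; elim: n => //= n ->; rewrite amapv.
have Fi n u v : iter n phi u - iter n phi v = F n (u - v) by rewrite linearB /= !FE.
pose d n := \dim (lker (F n)).
have dle n : (d n <= d n.+1)%N.
  apply: dimvS; apply/subvP=> v; rewrite !memv_ker !FE /= => /eqP->.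
  by rewrite linear0.
(* The dimensions of the kernels increase and are at most [dim A], so two consecutive ones must
   agree. *)
have [n dn] : exists n, d n = d n.+1.
  have [//|no] := boolP [exists n : 'I_(dim A).+1, d n == d n.+1].
    by move=> /existsP[n /eqP]; exists n.
  have inc n : (n <= (dim A).+1 -> n <= d n)%N.
    elim: n => // n IH ln; have := no; rewrite negb_exists => /forallP/(_ (Ordinal ln)) /= ne.
    by have := dle n; rewrite leq_eqVlt (negPf ne) /=; apply: leq_trans; apply: IH; apply: ltnW.
  have := inc _ (leqnn _); have : (d (dim A).+1 <= dim A)%N.
    by rewrite -[X in (_ <= X)%N]dimvf; apply/dimvS/subvf.
  by move=> le1 le2; have := leq_trans le2 le1; rewrite ltnn.
have kE j v : F (n + j)%N v = 0 -> F n v = 0.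
  elim: j v => [|j IH] v; first by rewrite addn0.
  rewrite addnS -addSn addnC FD => E.
  have: F j v \in lker (F n.+1).
    by rewrite memv_ker -FD addnC FD; move: E; rewrite -FD addnC FD => ->.
  have /eqP <- : (lker (F n) == lker (F n.+1)).
    rewrite eqEdim -/(d n.+1) -dn leqnn andbT; apply/subvP=> u.
    by rewrite !memv_ker !FE /= => /eqP->; rewrite linear0.
  by rewrite memv_ker -FD => /eqP; apply: IH.
have cap0 : (lker (F n) :&: limg (F n) = 0)%VS.
  apply/eqP; rewrite -subv0; apply/subvP=> v; rewrite memv_cap memv_ker memv0.
  move=> /andP[/eqP v0 /memv_imgP[u _ uE]]; move: v0; rewrite uE -FD => /kE ->.
  by [].
have sumf : (lker (F n) + limg (F n) = fullv)%VS.
  apply/eqP; rewrite eqEdim subvf /= dimv_disjoint_sum //.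
  by rewrite -(limg_ker_dim (F n) fullv) capfv.
have [||k0|i0] := aindecomposable_dsum _ _ cap0 sumf ind.
- apply/subvP=> _ /memv_imgP[u uk ->]; move: uk; rewrite !memv_ker Fmu => /eqP->.
  by rewrite linear0.
- apply/subvP=> _ /memv_imgP[_ /memv_imgP[u _ ->] ->].
  by rewrite -Fmu memv_img ?memvf.
- left=> u v E; apply/eqP; rewrite -subr_eq0 -memv0 -k0 memv_ker; apply/eqP.
  by apply: (kE 1%N); rewrite FD [F 1%N _]FE /= linearB /= E subrr linear0.
(* Now the image of the [n]-th power is zero, so [phi] is nilpotent, and a difference [u - v] that
   is fixed by [phi] vanishes. *)
right=> u v /eqP E.
have E1 : phi (u - v) = u - v.
  have uE : u = v - phi v + phi u by rewrite -(eqP E) subrK.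
  by rewrite linearB /= {2}uE [RHS]addrAC [v - _]addrC addrK addrC.
apply/eqP; rewrite -subr_eq0.
have : F n (u - v) \in limg (F n) by rewrite memv_img ?memvf.
rewrite i0 memv0 FE; suff -> : iter n phi (u - v) = u - v by [].
by elim: (n) => //= j ->.
Qed.

End Automorphisms.

Arguments ract : simpl never.
Arguments band_obj : simpl never.
Arguments band_diff : simpl never.

(** * Coefficients of band complexes *)

Section Coef.
Variables (k : fieldType) (G : gentle).

Section One.
Variables (K : vectType k) (x y : vertex G).
Implicit Types (f : {ffun Path x y -> K}) (p : seq (arrow G)).

(** The sum has at most one term. Indexing coefficients by bare sequences, with value 0 off the
    paths from [x] to [y], avoids transport between types of paths when sequences are cut or
    joined. *)
Definition coef_at p f : K := \sum_(q : Path x y | q == p :> seq _) f q.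
Notation coef f p := (coef_at p f).

Lemma coef_path f (q : Path x y) : coef f q = f q.
Proof.
rewrite /coef_at (bigD1 q) //= big1 ?addr0 // => q' /andP[/eqP/arrows_inj->].
by rewrite eqxx.
Qed.
Lemma coef_notin f p : ~~ gpath x y p -> coef f p = 0.
Proof.
by move=> np; rewrite /coef_at big1 // => q /eqP qp; move: np; rewrite -qp arrowsP.
Qed.
Lemma coef_linear p : linear (coef_at p).
Proof.
move=> a f g; rewrite /coef_at scaler_sumr -big_split; apply: eq_bigr => q _ /=.
by rewrite !ffunE.
Qed.
Lemma coef0 p : coef (0 : {ffun Path x y -> K}) p = 0.
Proof. by rewrite /coef_at big1 // => q _; rewrite ffunE. Qed.
HB.instance Definition _ p := GRing.isLinear.Build k {ffun Path x y -> K} K _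
  (coef_at p) (@coef_linear p).
Lemma coef_ext f g : (forall p, gpath x y p -> coef f p = coef g p) -> f = g.
Proof.
by move=> E; apply/ffunP=> q; rewrite -!coef_path E // arrowsP.
Qed.
Lemma coef_ffun (F : seq (arrow G) -> K) p :
  coef [ffun q : Path x y => F q] p = if gpath x y p then F p else 0.
Proof.
case: ifPn => [h|/coef_notin->//].
by rewrite -(mkPathE h) coef_path ffunE.
Qed.
End One.
Notation coef f p := (coef_at p f).

Lemma coef_act (K : vectType k) x y z (t : Path y z) (f : {ffun Path x y -> K}) r :
  coef (ract (tproj K x) (kpath k t) f) r =
  if gpath x z r && prefix t r then coef f (drop (size t) r) else 0.
Proof.
have [h|/coef_notin->//] := boolP (gpath x z r).
rewrite -{1}(mkPathE h) coef_path /= tproj_actE ffunE mkPathE.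
rewrite (bigD1 t) //= [X in _ + X]big1 => [|p np].
  rewrite addr0 ffunE eqxx; case: ifP => [/prefixP[s E]|np].
    have hs : gpath x y s by move: h; rewrite E => /gpath_catr'; apply; apply: arrowsP.
    rewrite E drop_size_cat // -{2}(mkPathE hs) coef_path (bigD1 (mkPath hs)) /= ?eqxx //.
    rewrite scale1r big1 ?addr0 // => q /andP[/eqP Eq nq].
    by case/negP: nq; rewrite -eq_arrows /=; move: Eq => /eqP; rewrite eqseq_cat // eqxx.
  by rewrite big1 // => q /eqP E; move: np; rewrite -E prefix_prefix.
by rewrite big1 // => q _; rewrite ffunE (negPf np) scale0r.
Qed.

Lemma coef_tmap (K K' : vectType k) s (mu : 'Hom(K, K')) x x' y
    (f : {ffun Path x y -> K}) r : gpath x' x s ->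
  coef (tmap s mu x x' y f) r =
  if gpath x' y r && suffix s r then mu (coef f (take (size r - size s) r)) else 0.
Proof.
move=> hs; have [h|/coef_notin->//] := boolP (gpath x' y r).
rewrite -{1}(mkPathE h) coef_path /= tmap_mapE ffunE mkPathE.
case: ifP => [/suffixP[p E]|ns]; last first.
  by rewrite big1 // => q /eqP E; move: ns; rewrite -E suffix_suffix.
have hp : gpath x y p by move: h; rewrite E => /gpath_catl; apply.
rewrite E size_cat addnK take_size_cat // -{2}(mkPathE hp) coef_path.
rewrite (bigD1 (mkPath hp)) /= ?eqxx // big1 ?addr0 // => q /andP[/eqP Eq nq].
case/negP: nq; rewrite -eq_arrows mkPathE; apply/eqP.
by rewrite -(take_size_cat s (erefl (size q))) Eq -(addnK (size s) (size q)) -size_cat Eq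
  size_cat addnK take_size_cat.
Qed.

End Coef.

Notation coef f p := (coef_at p f).

Section BandCoef.
Variables (k : fieldType) (G : gentle) (ST : string_functions G) (m : int).
Variables (w : word G) (hw : homotopy_band ST w).
Notation L := (size (parts ST w)).
Notation band n mu := (band_obj ST m w mu n).
Notation node n := {i : 'I_L | band_degree m i == n}.
Implicit Types (i j l : 'I_L) (x y z : vertex G) (p q r : seq (arrow G)).
Implicit Types (mu : autom k).

(** The node is likewise a bare index, with value 0 if its degree is not [n], so that coordinates in
    all degrees are indexed in the same way. *)
Definition bco_at mu n y i p (a : band n mu y) : mu :=
  \sum_(i' : node n | val i' == i)
     coef ((a : dsum (fun i' : node n => tproj mu (band_vertex (val i')) y)) i') p.

Notation bco a i p := (bco_at i p a).

Definition bmk mu n y (F : 'I_L -> seq (arrow G) -> mu) : band n mu y :=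
  [ffun i' : node n => [ffun q : Path (band_vertex (val i')) y => F (val i') q]].

Arguments bmk {mu n y} F.

Lemma bcoE mu n y (a : band n mu y) (i' : node n) p :
  bco a (val i') p = coef ((a : dsum (fun i' : node n => tproj mu (band_vertex (val i')) y)) i') p.
Proof.
rewrite /bco_at (bigD1 i') //= big1 ?addr0 // => j /andP[/eqP/val_inj->].
by rewrite eqxx.
Qed.

Lemma bco_deg mu n y (a : band n mu y) i p : band_degree m i <> n -> bco a i p = 0.
Proof.
by move=> ne; rewrite /bco_at big1 // => i' /eqP E; case: ne; rewrite -E; apply/eqP/(valP i').
Qed.

Lemma bco_notin mu n y (a : band n mu y) i p :
  ~~ gpath (band_vertex i) y p -> bco a i p = 0.
Proof.
move=> np; rewrite /bco_at big1 // => i' /eqP E; rewrite coef_notin // E.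
exact: np.
Qed.

Lemma bco_linear mu n y i p : linear (@bco_at mu n y i p).
Proof.
move=> c a b; rewrite /bco_at scaler_sumr -big_split; apply: eq_bigr => i' _ /=.
by rewrite dsumDE dsumZE coef_linear.
Qed.

HB.instance Definition _ mu n y i p := GRing.isLinear.Build k (band n mu y) mu _
  (@bco_at mu n y i p) (@bco_linear mu n y i p).

Lemma bco_ext mu n y (a b : band n mu y) :
  (forall i p, band_degree m i = n -> gpath (band_vertex i) y p -> bco a i p = bco b i p) ->
  a = b.
Proof.
move=> E; apply/ffunP=> i'; apply: coef_ext => p hp; rewrite -!bcoE E //.
by apply/eqP/(valP i').
Qed.

Lemma bco_mk mu n y F i p : bco (@bmk mu n y F) i p =
  if (band_degree m i == n) && gpath (band_vertex i) y p then F i p else 0.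
Proof.
case: ifPn => [/andP[di hp]|]; last first.
  by rewrite negb_and => /orP[/eqP/bco_deg->|/bco_notin->].
rewrite -[i]/(val (Sub i di : node n)) bcoE ffunE.
by rewrite coef_ffun hp.
Qed.

Lemma bco_act mu n y z (t : Path y z) (a : band n mu y) i r :
  bco (ract (band n mu) (kpath k t) a) i r =
  if gpath (band_vertex i) z r && prefix t r then bco a i (drop (size t) r) else 0.
Proof.
have [/eqP di|/eqP di] := boolP (band_degree m i == n); last first.
  by rewrite !bco_deg // if_same.
rewrite -[i]/(val (Sub i (introT eqP di) : {i : 'I_L | band_degree m i == n})).
by rewrite !bcoE dsum_diagE coef_act.
Qed.

Definition chop p r := take (size r - size p) r.
Lemma chop_cat p q : chop p (q ++ p) = q.
Proof. by rewrite /chop size_cat addnK take_size_cat. Qed.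

Lemma coef_band_term mu i j l y (u : {ffun Path (band_vertex j) y -> mu}) r :
  coef (band_term mu i j l y u) r =
  if [&& esrc l == i, etgt l == j, gpath (band_vertex i) y r & suffix (epath l) r]
  then band_mu mu l (coef u (chop (epath l) r)) else 0.
Proof.
have h := epath_gpath hw l; move: h; rewrite /band_term /esrc /etgt /epath /edge_dir.
rewrite ![_ == i]eq_sym ![_ == j]eq_sym.
have [d|d] := boolP (direct (letters (sigma l))) => h /=.
  rewrite direct_inverse //=; case: eqP => [E|_] /=; last by rewrite zero_lfunE coef0.
  case: eqP => [E'|_] /=; last by rewrite zero_lfunE coef0.
  by rewrite coef_tmap // E E'.
rewrite (edge_inverse hw d) /=; case: eqP => [E|_] /=; last by rewrite zero_lfunE coef0.
case: eqP => [E'|_] /=; last by rewrite zero_lfunE coef0.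
by rewrite coef_tmap // E E'.
Qed.

(** In terms of edges, direct and inverse parts need no longer be told apart: the edge [l]
    multiplies on the right by [epath l], from the summand at [etgt l] to the summand at
    [esrc l]. *)
Lemma bco_diff mu n y (a : band n mu y) i r :
  bco (band_diff ST m w mu n y a) i r =
  \sum_(l | esrc l == i) if gpath (band_vertex i) y r && suffix (epath l) r
     then band_mu mu l (bco a (etgt l) (chop (epath l) r)) else 0.
Proof.
have [/eqP di|/eqP di] := boolP (band_degree m i == isucc n); last first.
  rewrite bco_deg // big1 // => l /eqP E; rewrite (bco_deg a) ?linear0 ?if_same //.
  by move=> E'; apply: di; rewrite -E edge_degree // E'.
rewrite -[i in LHS]/(val (Sub i (introT eqP di) : node (isucc n))) bcoE /=.
rewrite dsum_mxE linear_sum /=.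
transitivity (\sum_(j' : node n) \sum_l
   if [&& esrc l == i, etgt l == val j', gpath (band_vertex i) y r & suffix (epath l) r]
   then band_mu mu l (bco a (val j') (chop (epath l) r)) else 0).
  apply: eq_bigr => j' _; rewrite sum_lfunE linear_sum /=; apply: eq_bigr => l _.
  by rewrite coef_band_term bcoE.
rewrite exchange_big [RHS]big_mkcond; apply: eq_bigr => l _ /=.
case: (_ =P i) => [E|_] /=; last by rewrite big1.
case: ifP => [rl|_]; last by rewrite big1 // => j' _; rewrite andbF.
have dl : band_degree m (etgt l) == n.
  by apply/eqP; apply: isucc_inj; rewrite -edge_degree // E.
rewrite (bigD1 (Sub (etgt l) dl : node n)) //= eqxx big1 ?addr0 // => j' nj'.
by case: eqP => // El; case/eqP: nj'; apply: val_inj.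
Qed.

End BandCoef.
Arguments bmk {k G ST m w mu n y} F.

Section BandCoef.
Variables (k : fieldType) (G : gentle) (ST : string_functions G) (m : int).
Variables (w : word G) (hw : homotopy_band ST w).
Notation L := (size (parts ST w)).
Notation band n mu := (band_obj ST m w mu n).
Notation node n := {i : 'I_L | band_degree m i == n}.
Implicit Types (i j l : 'I_L) (x y z : vertex G) (p q r : seq (arrow G)).
Implicit Types (mu : autom k).

Notation bco a i p := (bco_at i p a).

(** The element [1 (x) v] of the summand at [i], where 1 is the trivial path; these elements
    generate the band object. *)
Definition bgen mu n i (v : mu) : band n mu (band_vertex i) :=
  bmk (fun j p => if (j == i) && (p == [::]) then v else 0).

Lemma bco_gen mu n i (v : mu) j p : band_degree m i = n ->
  bco (bgen n i v) j p = if (j == i) && (p == [::]) then v else 0.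
Proof.
move=> di; rewrite bco_mk; case: (j =P i) => [->|_] /=; last by rewrite if_same.
by case: (p =P [::]) => [->|_]; rewrite ?if_same // gpath_nil di !eqxx.
Qed.

Lemma bgen_linear mu n i : linear (@bgen mu n i).
Proof.
move=> c u v; apply: bco_ext => j p di hp; rewrite bco_linear !bco_mk.
by do 2?[case: ifP => _]; rewrite ?scaler0 ?addr0.
Qed.
HB.instance Definition _ mu n i := GRing.isLinear.Build k mu (band n mu (band_vertex i)) _
  (@bgen mu n i) (@bgen_linear mu n i).

Lemma band_decomp mu n y (a : band n mu y) :
  a = \sum_i \sum_(p : Path (band_vertex i) y)
        ract (band n mu) (kpath k p) (bgen n i (bco a i p)).
Proof.
apply: bco_ext => j r dj hr; rewrite linear_sum /= (bigD1 j) //= [X in _ + X]big1 => [|i ne].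
  rewrite addr0 linear_sum /= (bigD1 (mkPath hr)) //= [X in _ + X]big1 => [|p np].
    rewrite addr0 bco_act hr mkPathE prefix_refl drop_size /=.
    by rewrite bco_gen // !eqxx.
  rewrite bco_act hr /=; case: ifP => // /prefixP[s rE]; rewrite bco_gen // eqxx.
  case: eqP => // s0; case/negP: np; rewrite -eq_arrows mkPathE.
  by move: s0; rewrite rE drop_size_cat // => ->; rewrite cats0.
rewrite linear_sum big1 // => p _ /=; rewrite bco_act hr /=; case: ifP => // _.
by rewrite bco_mk [j == i]eq_sym (negPf ne) if_same.
Qed.

Lemma rhom_band mu n (M : rep k G) (e : rhom (band n mu) M) y (a : band n mu y) :
  e y a = \sum_i \sum_(p : Path (band_vertex i) y)
        ract M (kpath k p) (e (band_vertex i) (bgen n i (bco a i p))).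
Proof.
rewrite {1}[a]band_decomp linear_sum; apply: eq_bigr => i _ /=.
by rewrite linear_sum; apply: eq_bigr => p _; apply: (rmapE e).
Qed.

Lemma rhom_band_ext mu n (M : rep k G) (e e' : rhom (band n mu) M) :
  (forall i v, band_degree m i = n ->
     e (band_vertex i) (bgen n i v) = e' (band_vertex i) (bgen n i v)) ->
  forall y (a : band n mu y), e y a = e' y a.
Proof.
move=> E y a; rewrite [LHS]rhom_band [RHS]rhom_band; apply: eq_bigr => i _.
apply: eq_bigr => p _; have [di|/eqP di] := eqVneq (band_degree m i) n; first by rewrite E.
by rewrite (bco_deg a) // !linear0.
Qed.

Lemma bco_rhom mu mu' n n' (e : rhom (band n mu) (band n' mu')) y (a : band n mu y) j r :
  bco (e y a) j r = \sum_i \sum_(p : Path (band_vertex i) y)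
    if gpath (band_vertex j) y r && prefix p r
    then bco (e (band_vertex i) (bgen n i (bco a i p))) j (drop (size p) r) else 0.
Proof.
rewrite {1}rhom_band linear_sum; apply: eq_bigr => i _ /=.
by rewrite linear_sum; apply: eq_bigr => p _ /=; rewrite bco_act.
Qed.

Section BandLift.
Variables (mu : autom k) (n : int) (M : rep k G).
Variable gam : forall i, 'Hom(mu, M (band_vertex i)).

(** Yoneda's lemma for the projective summands: a morphism is determined by arbitrary linear maps
    [gam i] prescribing its values on the generators. *)
Definition blift_fun y (a : band n mu y) : M y :=
  \sum_i \sum_(p : Path (band_vertex i) y) ract M (kpath k p) (gam i (bco a i p)).
Lemma blift_linear y : linear (@blift_fun y).
Proof.
move=> c a b; rewrite scaler_sumr -big_split; apply: eq_bigr => i _ /=.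
rewrite scaler_sumr -big_split; apply: eq_bigr => p _ /=.
by rewrite bco_linear !linearP.
Qed.

Definition blift : rhom (band n mu) M.
Proof.
apply: (@mk_rhom _ _ _ _ (fun y => linfun (@blift_fun y))) => y z t a.
rewrite (lfunLE (@blift_linear y)) (lfunLE (@blift_linear z)) linear_sum.
apply: eq_bigr => i _ /=; rewrite linear_sum /=.
under [RHS]eq_bigr do rewrite ract_cat big_mkcond.
rewrite exchange_big /=; apply: eq_bigr => r _.
rewrite bco_act arrowsP /=; case: ifP => [/prefixP[s rE]|np].
  have hs : gpath (band_vertex i) y s.
    by have := arrowsP r; rewrite rE => /gpath_catr'; apply; apply: arrowsP.
  rewrite rE drop_size_cat // (bigD1 (mkPath hs)) //= eqxx big1 ?addr0 // => p np.
  case: eqP => // /eqP; rewrite eqseq_cat // eqxx /= => /eqP sp.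
  by case/negP: np; rewrite -eq_arrows mkPathE sp.
rewrite !linear0 big1 // => p _; case: eqP => // rE.
by rewrite rE prefix_prefix in np.
Defined.

Lemma bliftE y a : blift y a = blift_fun a.
Proof. by rewrite /= lfunLE //; apply: blift_linear. Qed.

Lemma blift_gen i v : band_degree m i = n -> blift (band_vertex i) (bgen n i v) = gam i v.
Proof.
move=> di; rewrite bliftE /blift_fun (bigD1 i) //= [X in _ + X]big1 ?addr0 => [|j ne]; last first.
  by rewrite big1 // => p _; rewrite bco_gen // (negPf ne) !linear0.
rewrite (bigD1 (path1 (band_vertex i))) //= [X in _ + X]big1 ?addr0 => [|p ne]; last first.
  rewrite bco_gen // eqxx /=; case: eqP => [E|_]; last by rewrite !linear0.
  by case/negP: ne; rewrite -eq_arrows E.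
by rewrite bco_gen // !eqxx -kid_kpath ract1 lfunE.
Qed.
End BandLift.

Section BandMap.
Variables (mu mu' : autom k) (phi : 'Hom(mu, mu')) (n : int).

Definition bmap_fun y (a : band n mu y) : band n mu' y :=
  bmk (fun i p => phi (bco a i p)).
Lemma bmap_funE y (a : band n mu y) i p : bco (bmap_fun a) i p = phi (bco a i p).
Proof.
rewrite bco_mk; case: ifPn => //; rewrite negb_and => /orP[/eqP|] h.
  by rewrite bco_deg ?linear0.
by rewrite bco_notin ?linear0.
Qed.
Lemma bmap_linear y : linear (@bmap_fun y).
Proof.
move=> c a b; apply: bco_ext => i p _ _.
by rewrite bco_linear !bmap_funE bco_linear linearP.
Qed.
Definition bmap : rhom (band n mu) (band n mu').
Proof.
apply: (@mk_rhom _ _ _ _ (fun y => linfun (@bmap_fun y))) => y z t a.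
rewrite (lfunLE (@bmap_linear y)) (lfunLE (@bmap_linear z)).
apply: bco_ext => i p _ _; rewrite bmap_funE !bco_act bmap_funE.
by case: ifP; rewrite ?linear0.
Defined.
Lemma bco_map y (a : band n mu y) i p : bco (bmap y a) i p = phi (bco a i p).
Proof. by rewrite /= (lfunLE (@bmap_linear y)) bmap_funE. Qed.
End BandMap.

End BandCoef.

Section SeqAction.
Variables (k : fieldType) (G : gentle).
Implicit Types (M N : rep k G) (x y z : vertex G) (p : seq (arrow G)).

(* Zero if p is not a path from x to y. *)
Definition sact M x y p : 'Hom(M x, M y) :=
  \sum_(q : Path x y | q == p :> seq _) ract M (kpath k q).

Lemma sact_path M x y (q : Path x y) : sact M x y q = ract M (kpath k q).
Proof.
rewrite /sact (bigD1 q) //= big1 ?addr0 // => q' /andP[/eqP/arrows_inj->].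
by rewrite eqxx.
Qed.
Lemma sact_notin M x y p : ~~ gpath x y p -> sact M x y p = 0.
Proof.
by move=> np; rewrite /sact big1 // => q /eqP qp; move: np; rewrite -qp arrowsP.
Qed.
Lemma sact_rmap M N (f : rhom M N) x y p u : f y (sact M x y p u) = sact N x y p (f x u).
Proof.
by rewrite !sum_lfunE linear_sum; apply: eq_bigr => q _; apply: (rmapE f).
Qed.
Lemma sact_cat M x y z p q u : gpath x y q -> gpath y z p ->
  sact M y z p (sact M x y q u) = sact M x z (p ++ q) u.
Proof.
move=> hq hp; rewrite -(mkPathE hq) -(mkPathE hp) !sact_path ract_cat /sact.
by rewrite sum_lfunE.
Qed.
End SeqAction.

(** * Chain maps between band complexes *)

Section BandMaps.
Variables (k : fieldType) (G : gentle) (ST : string_functions G) (m : int).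
Variables (w : word G) (hw : homotopy_band ST w).
Notation L := (size (parts ST w)).
Notation band n mu := (band_obj ST m w mu n).
Notation bco a i p := (bco_at i p a).
Implicit Types (i j l : 'I_L) (x y z : vertex G) (p q r : seq (arrow G)).
Implicit Types (mu : autom k).

Lemma band_mu_inj mu l : injective (@band_mu _ _ ST w mu l).
Proof.
rewrite /band_mu; case: ifP => _; first exact: aact_injective.
by move=> u v; rewrite !lfunE.
Qed.
Lemma band_mu_surj mu l v : exists u, @band_mu _ _ ST w mu l u = v.
Proof.
have k0 : lker (@band_mu _ _ ST w mu l) == 0%VS by apply/lker0P/band_mu_inj.
by exists ((@band_mu _ _ ST w mu l)^-1%VF v); rewrite lker0_lfunVK.
Qed.

Lemma bco_sact mu n y z p (a : band n mu y) i r :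
  bco (sact (band n mu) y z p a) i r =
  if [&& gpath y z p, gpath (band_vertex i) z r & prefix p r]
  then bco a i (drop (size p) r) else 0.
Proof.
have [h|/sact_notin->] := boolP (gpath y z p); last by rewrite zero_lfunE linear0.
by rewrite -(mkPathE h) sact_path bco_act.
Qed.

Lemma band_diff_gen mu n i v : band_degree m i = n ->
  band_diff ST m w mu n (band_vertex i) (bgen m n i v) =
  \sum_(l | etgt l == i) sact (band (isucc n) mu) (band_vertex (esrc l))
     (band_vertex i) (epath l) (bgen m (isucc n) (esrc l) (band_mu mu l v)).
Proof.
move=> di; apply: bco_ext => j r dj hr; rewrite bco_diff // linear_sum /=.
rewrite big_mkcond [RHS]big_mkcond; apply: eq_bigr => l _ /=.
have dl : etgt l = i -> band_degree m (esrc l) = isucc n.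
  by move=> El; rewrite edge_degree // El di.
rewrite hr bco_gen //; case: (etgt l =P i) => [El|] /=; last first.
  by rewrite linear0 !if_same.
have hl : gpath (band_vertex (esrc l)) (band_vertex i) (epath l) by rewrite -El epath_gpath.
rewrite bco_sact hl hr /= bco_gen; last exact: dl.
rewrite [esrc l == j]eq_sym; case: (j =P _) => [_|] /=; last by rewrite if_same.
have [->|ne] := eqVneq r (epath l).
  by rewrite suffix_refl prefix_refl drop_size /chop subnn take0 eqxx.
case: ifP => [/suffixP[s rE]|_].
  rewrite {1}rE chop_cat; case: eqP => [s0|_]; first by rewrite rE s0 eqxx in ne.
  rewrite linear0; case: ifP => // /prefixP[t rE']; case: eqP => // t0.
  by move: ne; rewrite rE' -{2}(cats0 (epath l)) -t0 rE' drop_size_cat // eqxx.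
case: ifP => // /prefixP[t rE']; case: eqP => // t0.
by move: ne; rewrite rE' -{2}(cats0 (epath l)) -t0 rE' drop_size_cat // eqxx.
Qed.

Section ChainMaps.
Variables (mu mu' : autom k).
Variable e : cmap (band_cplx m hw mu) (band_cplx m hw mu').

(** The entry of [e] from the summand at [i] to the one at [j], at the path [p]. It is taken in the
    degree of [i], so that no degree has to be carried along, and it is zero if [j] has another
    degree. *)
Definition mcoef i j p (v : mu) : mu' :=
  bco (e (band_degree m i) (band_vertex i) (bgen m _ i v)) j p.

Lemma mcoefE n i j p v : band_degree m i = n ->
  bco (e n (band_vertex i) (bgen m n i v)) j p = mcoef i j p v.
Proof. by move=> <-. Qed.

Lemma mcoef_linear i j p : linear (mcoef i j p).
Proof. by move=> c u v; rewrite /mcoef linearP /= linearP /= bco_linear. Qed.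
HB.instance Definition _ i j p := GRing.isLinear.Build k mu mu' _ (mcoef i j p)
  (mcoef_linear i j p).

Lemma mcoef_notin i j p v : ~~ gpath (band_vertex j) (band_vertex i) p ->
  mcoef i j p v = 0.
Proof. exact: bco_notin. Qed.

(** The equation [d e = e d] on the generator at [i], read at the path [r] of the summand at [j].
    Constraints on the coefficients at trivial paths result from taking for [r] the path of an
    edge. *)
Lemma edge_equation i j r v : gpath (band_vertex j) (band_vertex i) r ->
  \sum_(l | esrc l == j) (if suffix (epath l) r
     then band_mu mu' l (mcoef i (etgt l) (chop (epath l) r) v) else 0) =
  \sum_(l | etgt l == i) (if prefix (epath l) r
     then mcoef (esrc l) j (drop (size (epath l)) r) (band_mu mu l v) else 0).
Proof.
move=> hr; set n := band_degree m i.
have H : e (isucc n) (band_vertex i) (band_diff ST m w mu n (band_vertex i) (bgen m n i v)) =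
    band_diff ST m w mu' n (band_vertex i) (e n (band_vertex i) (bgen m n i v)).
  exact: (cfunv e (n := n)).
have {H} := congr1 (@bco_at _ _ _ _ _ mu' (isucc n) _ j r) H.
rewrite band_diff_gen // linear_sum linear_sum /= bco_diff // => E.
transitivity (\sum_(l | esrc l == j)
    if gpath (band_vertex j) (band_vertex i) r && suffix (epath l) r
    then band_mu mu' l (bco (e n (band_vertex i) (bgen m n i v)) (etgt l) (chop (epath l) r))
    else 0).
  by apply: eq_bigr => l _; rewrite hr.
rewrite -{}E; apply: eq_bigr => l /eqP El.
have hl : gpath (band_vertex (esrc l)) (band_vertex i) (epath l) by rewrite -El epath_gpath.
rewrite (sact_rmap (e (isucc n))) bco_sact hl hr /=.
by case: ifP => // _; rewrite mcoefE // edge_degree // El.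
Qed.

(** Take [r = epath l'] in [edge_equation]. Distinct edges starting at one node, or ending at one
    node, lie on different sides, so at most one term of each sum survives. *)
Lemma eps_in i j l l' v : etgt l = i -> etgt l' = j ->
  iside ST (epath l) = iside ST (epath l') -> band_vertex i = band_vertex j ->
  band_mu mu' l' (mcoef i j [::] v) = if prefix (epath l) (epath l')
    then mcoef (esrc l) (esrc l') (drop (size (epath l)) (epath l')) (band_mu mu l v)
    else 0.
Proof.
move=> li lj s xij; have hr := epath_gpath hw l'; rewrite lj -xij in hr.
have := edge_equation v hr; rewrite (bigD1 l') //= suffix_refl /chop subnn take0 lj.
rewrite [X in _ + X = _]big1 ?addr0 => [->|l2 /andP[/eqP e2 n2]]; last first.
  case: ifP => // /suffixP[t tE]; case/eqP: n2; apply: (esrc_inj hw e2).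
  by rewrite tE oside_cat ?epath_neq0.
rewrite (bigD1 l) ?li //= [X in _ + X]big1 ?addr0 // => l2 /andP[/eqP e2 n2].
case: ifP => // /prefixP[t tE]; case/eqP: n2; apply: (etgt_inj hw); rewrite ?e2 ?li //.
by rewrite s tE iside_cat ?epath_neq0.
Qed.

(** Again [r = epath l'], but the right hand sum is now zero: the side in question is taken at [i]
    by the edge [l], which starts there. *)
Lemma eps_in_out i j l l' v : esrc l = i -> etgt l' = j ->
  oside ST (epath l) = iside ST (epath l') -> band_vertex i = band_vertex j ->
  mcoef i j [::] v = 0.
Proof.
move=> li lj s xij; have hr := epath_gpath hw l'; rewrite lj -xij in hr.
have := edge_equation v hr; rewrite (bigD1 l') //= suffix_refl /chop subnn take0 lj.
rewrite [X in _ + X = _]big1 ?addr0 => [E|l2 /andP[/eqP e2 n2]]; last first.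
  case: ifP => // /suffixP[t tE]; case/eqP: n2; apply: (esrc_inj hw e2).
  by rewrite tE oside_cat ?epath_neq0.
apply: (@band_mu_inj mu' l'); rewrite E linear0 big1 // => l2 /eqP e2.
case: ifP => // /prefixP[t tE]; have := esrc_etgt hw (etrans li (esym e2)).
by rewrite s tE iside_cat ?epath_neq0 //; case: iside.
Qed.

(** The counterpart of [eps_in] for outgoing edges, with [r = epath l]; here the edge of the second
    node is the shorter one. *)
Lemma eps_out i j l l' v : esrc l = i -> esrc l' = j ->
  oside ST (epath l) = oside ST (epath l') -> band_vertex i = band_vertex j ->
  mcoef i j [::] (band_mu mu l v) = if suffix (epath l') (epath l)
    then band_mu mu' l' (mcoef (etgt l) (etgt l') (chop (epath l') (epath l)) v)
    else 0.
Proof.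
move=> li lj s xij; have hr := epath_gpath hw l; rewrite li xij in hr.
have := edge_equation v hr; rewrite [in X in _ = X -> _](bigD1 l) //= prefix_refl drop_size li.
rewrite [X in _ = _ + X]big1 ?addr0 => [<-|l2 /andP[/eqP e2 n2]]; last first.
  case: ifP => // /prefixP[t tE]; case/eqP: n2; apply: (etgt_inj hw e2).
  by rewrite tE iside_cat ?epath_neq0.
rewrite (bigD1 l') ?lj //= [X in _ + X]big1 ?addr0 // => l2 /andP[/eqP e2 n2].
case: ifP => // /suffixP[t tE]; case/eqP: n2; apply: (esrc_inj hw); rewrite ?e2 ?lj //.
by rewrite -s tE oside_cat ?epath_neq0.
Qed.

End ChainMaps.

End BandMaps.

(** * The order on the nodes of a band *)

Lemma add_lt a b c : a = (b + c)%N -> c != 0%N -> (b < a)%N.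
Proof. lia. Qed.
Lemma sub_lt a b c N : a = (c + b)%N -> c != 0%N -> (a < N)%N ->
  (N.*2 - a < N.*2 - b)%N.
Proof. lia. Qed.

Section HalfEdgeOrder.
Variables (G : gentle) (ST : string_functions G).
Variables (w : word G) (hw : homotopy_band ST w).
Notation L := (size (parts ST w)).
Implicit Types (i j l : 'I_L) (h : 'I_L * bool).

Lemma hout_esrc h : hout h -> [/\ hnode h = esrc h.1,
  hside h = oside ST (epath h.1) & hnode (hnext h) = etgt h.1].
Proof.
case: h => l e o; split; last 2 first.
- by rewrite /hside o.
- by rewrite hnode_mate -etgt_half; move: o; rewrite /hout /= => /eqP->.
by rewrite -esrc_half; move: o; rewrite /hout /= => /eqP->.
Qed.
Lemma hin_etgt h : ~~ hout h -> [/\ hnode h = etgt h.1,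
  hside h = iside ST (epath h.1) & hnode (hnext h) = esrc h.1].
Proof.
case: h => l e o; split; last 2 first.
- by rewrite /hside (negPf o).
- by rewrite hnode_mate -esrc_half; move: o; rewrite /hout /=; case: e; case: edge_dir.
by rewrite -etgt_half; move: o; rewrite /hout /=; case: e; case: edge_dir.
Qed.

(* The walks leaving a vertex on a given side are ordered lexicographically,
   the labels being compared as follows: short incoming < long incoming < long
   outgoing < short outgoing. The order of the initial parts of length t is
   that of the numbers [hvalue t], read in a large enough base. *)
Definition hbound : nat := (\max_l size (@epath G ST w l)).+1.
Definition hlabel h : nat :=
  if hout h then (hbound.*2 - size (epath h.1))%N else size (epath h.1).
Fixpoint hvalue t h : nat :=
  if t is t'.+1 then (hlabel h * hbound.*2 ^ t' + hvalue t' (hnext h))%N else 0%N.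

Lemma size_epath l : (0 < size (epath l) < hbound)%N.
Proof.
rewrite lt0n size_eq0 epath_neq0 // ltnS.
exact: (leq_bigmax (F := fun l => size (@epath G ST w l)) l).
Qed.

(** The lengths of edges lie strictly between 0 and [hbound], so incoming labels are below [hbound],
    outgoing ones above it, and all are digits in base [hbound.*2]. *)
Lemma hlabel_bound h : (hlabel h < hbound.*2)%N.
Proof. by have := size_epath h.1; rewrite /hlabel; case: hout; lia. Qed.

Lemma hvalue_bound t h : (hvalue t h < hbound.*2 ^ t)%N.
Proof.
elim: t h => [|t IH] h //=; have := IH (hnext h); have := hlabel_bound h.
rewrite expnS => le1 le2; have := leq_mul le1 (leqnn (hbound.*2 ^ t)%N).
rewrite mulSn; lia.
Qed.

Lemma hvalue_lt t h h' : (hlabel h < hlabel h')%N -> (hvalue t.+1 h < hvalue t.+1 h')%N.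
Proof.
move=> lt /=; have := hvalue_bound t (hnext h).
have := leq_mul lt (leqnn (hbound.*2 ^ t)%N); rewrite mulSn; lia.
Qed.

End HalfEdgeOrder.

Section Triangular.
Variables (k : fieldType) (G : gentle) (ST : string_functions G) (m : int).
Variables (w : word G) (hw : homotopy_band ST w).
Notation L := (size (parts ST w)).
Notation band n mu := (band_obj ST m w mu n).
Notation bco a i p := (bco_at i p a).
Implicit Types (i j l : 'I_L) (x y z : vertex G) (p q r : seq (arrow G)).
Variables (mu mu' : autom k).
Variable e : cmap (band_cplx m hw mu) (band_cplx m hw mu').

Lemma eps_vertex i j v : mcoef e i j [::] v <> 0 -> band_vertex i = band_vertex j.
Proof.
have [/eqP-> //|np] := boolP (band_vertex i == band_vertex j).
by rewrite mcoef_notin // gpath_nil.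
Qed.

(** A nonzero coefficient compares the first edges of the two walks by [eps_in] and [eps_out]:
    either the label grows, or the edges coincide and the coefficient passes on to the next nodes.
    By [eps_in_out] it never leads from an outgoing to an incoming half-edge. *)
Lemma eps_order t h h' v : hside h = hside h' ->
  mcoef e (hnode h) (hnode h') [::] v <> 0 ->
  (hvalue t h < hvalue t h')%N || agree t h h'.
Proof.
elim: t h h' v => [|t IH] h h' v; first by rewrite orbT.
move=> s ne; have xE := eps_vertex ne.
have [o|o] := boolP (hout h); have [o'|o'] := boolP (hout h').
- have [n1 s1 nx1] := hout_esrc o; have [n2 s2 nx2] := hout_esrc o'.
  have [u uE] := @band_mu_surj _ _ ST w mu h.1 v.
  have ss : oside ST (epath h.1) = oside ST (epath h'.1) by rewrite -s1 -s2.
  have := eps_out e u (esym n1) (esym n2) ss xE; rewrite uE.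
  case: ifP => [/suffixP[q E] H|_ H]; last by case: ne.
  have sE := congr1 size E; rewrite size_cat in sE.
  have [q0|qn] := eqVneq q [::]; last first.
    have /andP[_ lt] := size_epath h.1; rewrite -size_eq0 in qn.
    by rewrite hvalue_lt // /hlabel o o'; apply: sub_lt sE qn lt.
  have EE : epath h.1 = epath h'.1 by rewrite E q0.
  have ne' : mcoef e (hnode (hnext h)) (hnode (hnext h')) [::] u <> 0.
    rewrite nx1 nx2 => E0; apply: ne; rewrite H E -{1}[epath h'.1]cat0s.
    by rewrite q0 chop_cat E0 linear0.
  have oE : hout h = hout h' by rewrite o o'.
  have := IH _ _ _ (hside_next hw oE EE) ne'.
  rewrite /= oE EE !eqxx /hlabel oE EE /= => /orP[lt|->]; last by rewrite orbT.
  by rewrite ltn_add2l lt.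
- have [n1 s1 _] := hout_esrc o; have [n2 s2 _] := hin_etgt o'.
  case: ne; apply: (eps_in_out e v (esym n1) (esym n2) _ xE).
  by rewrite -s1 -s2.
- rewrite hvalue_lt // /hlabel (negPf o) o'.
  by have := size_epath h.1; have := size_epath h'.1; lia.
have [n1 s1 nx1] := hin_etgt o; have [n2 s2 nx2] := hin_etgt o'.
have ss : iside ST (epath h.1) = iside ST (epath h'.1) by rewrite -s1 -s2.
have := eps_in e v (esym n1) (esym n2) ss xE.
case: ifP => [/prefixP[q E] H|_ H]; last first.
  by case: ne; apply: (@band_mu_inj _ _ _ _ mu' h'.1); rewrite H linear0.
have sE := congr1 size E; rewrite size_cat in sE.
have [q0|qn] := eqVneq q [::]; last first.
  rewrite hvalue_lt // /hlabel (negPf o) (negPf o').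
  by rewrite -size_eq0 in qn; apply: add_lt sE qn.
have EE : epath h.1 = epath h'.1 by rewrite E q0 cats0.
have ne' : mcoef e (hnode (hnext h)) (hnode (hnext h')) [::] (band_mu mu h.1 v) <> 0.
  rewrite nx1 nx2 => E0; apply: ne; apply: (@band_mu_inj _ _ _ _ mu' h'.1).
  by rewrite H E drop_size_cat // q0 E0 linear0.
have oE : hout h = hout h' by rewrite (negPf o) (negPf o').
have := IH _ _ _ (hside_next hw oE EE) ne'.
rewrite /= oE EE !eqxx /hlabel oE EE /= => /orP[lt|->]; last by rewrite orbT.
by rewrite ltn_add2l lt.
Qed.

(** By [agree_inj], [L.+1] edges suffice to separate the nodes. The choice of the side [true] is
    arbitrary, but has to be the same for all nodes. *)
Definition node_rank i : nat := hvalue L.+1 (half_edge i true).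

Lemma eps_triangular i j v : mcoef e i j [::] v <> 0 ->
  i = j \/ (node_rank i < node_rank j)%N.
Proof.
rewrite -{1}(half_edge_node i true) -{1}(half_edge_node j true).
have s : hside (half_edge i true) = hside (half_edge j true) by rewrite !half_edge_side.
move=> /(eps_order L.+1 s) /orP[lt|a]; first by right.
left; rewrite -(half_edge_node i true) -(half_edge_node j true).
by congr hnode; apply: (agree_inj hw s a).
Qed.

(* The element of shortest path length, and among these of smallest node rank,
   in the support of an element of the kernel would survive. *)
Lemma eps_injective : (forall i, injective (mcoef e i i [::])) ->
  forall n y, injective (e n y).
Proof.
move=> inj n y; suff ker0 (a : band n mu y) : e n y a = 0 -> a = 0.
  by move=> a b E; apply/subr0_eq/ker0; rewrite linearB /= E subrr.
move=> ea0.
suff a0 s : forall i p, (size p < s)%N -> bco a i p = 0.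
  by apply: bco_ext => i p _ _; rewrite (a0 (size p).+1) ?linear0.
elim: s => // s IHs i p; rewrite ltnS leq_eqVlt => /orP[/eqP|]; last exact: IHs.
have [R] := ubnP (node_rank i); elim: R i p => // R IHR i p rk ps.
have [/eqP di|/eqP/(bco_deg a)->//] := boolP (band_degree m i == n).
have [hp|/(bco_notin a)->//] := boolP (gpath (band_vertex i) y p).
apply: (inj i); rewrite linear0.
have := congr1 (@bco_at _ _ _ _ _ mu' n _ i p) ea0; rewrite linear0 bco_rhom // hp => <-.
rewrite (bigD1 i) //= (bigD1 (mkPath hp)) //= prefix_refl drop_size mcoefE //.
rewrite [X in _ + X + _]big1 => [|q nq]; last first.
  case: ifP => // /prefixP[t pE].
  have [t0|tn] := eqVneq t [::].
    by case/negP: nq; rewrite -eq_arrows mkPathE pE t0 cats0.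
  rewrite (IHs i q) ?linear0 //; rewrite -ps; apply: (add_lt (c := size t)).
    by rewrite pE size_cat.
  by rewrite size_eq0.
(* Other nodes contribute either through a shorter path, excluded by [IHs], or through [p] itself,
   and then from a node of smaller rank, excluded by [IHR]. *)
rewrite [X in _ + _ + X]big1 ?addr0 // => j nj.
rewrite big1 // => q _; case: ifP => // /prefixP[t pE].
have [t0|tn] := eqVneq t [::]; last first.
  rewrite (IHs j q) ?linear0 //; rewrite -ps; apply: (add_lt (c := size t)).
    by rewrite pE size_cat.
  by rewrite size_eq0.
have qp : q = p :> seq _ by rewrite pE t0 cats0.
rewrite qp drop_size; have [/eqP dj|/eqP/(bco_deg a)->] := boolP (band_degree m j == n); last first.
  by rewrite !linear0.
rewrite mcoefE //; apply/eqP/idPn => /eqP ne.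
have [E|lt] := eps_triangular ne; first by rewrite E eqxx in nj.
by apply: ne; rewrite (IHR j p) ?linear0 //; apply: leq_trans lt _.
Qed.

Lemma eps_comm l v : band_mu mu' l (mcoef e (etgt l) (etgt l) [::] v) =
  mcoef e (esrc l) (esrc l) [::] (band_mu mu l v).
Proof. by rewrite (@eps_in _ _ _ _ _ _ _ _ e _ _ l l) // prefix_refl drop_size. Qed.

Lemma eps_const i j v : mcoef e i i [::] v = mcoef e j j [::] v.
Proof.
have step l : (0 < l)%N -> mcoef e l l [::] =1 mcoef e (ord_pred l) (ord_pred l) [::].
  move=> l0 u; have := eps_comm l u; rewrite /band_mu eqn0Ngt l0 /= !lfunE /=.
  by rewrite /esrc /etgt; case: edge_dir.
have L0 := band_parts hw; pose i0 : 'I_L := Ordinal L0.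
suff all0 t l : l = t :> nat -> mcoef e l l [::] v = mcoef e i0 i0 [::] v.
  by rewrite (all0 i) // (all0 j).
elim: t l => [|t IH] l lt; first by congr (mcoef e _ _ _ _); apply: val_inj.
rewrite step ?lt // IH //= lt; have := ltn_ord l; rewrite lt => tL.
have -> : ((t.+1 + L).-1 = t + L)%N by lia.
by rewrite modnDr modn_small // ltnW.
Qed.

Definition eps0 : 'I_L := Ordinal (band_parts hw).

(** All edges but the one of index 0 carry the identity, which makes the diagonal coefficients equal
    at all nodes. The remaining edge then yields commutation with the automorphisms. *)
Lemma eps_ahom : {phi : ahom mu mu' | forall i v, phi v = mcoef e i i [::] v}.
Proof.
have [|phi phiE] := @mk_ahom k mu mu' (linfun (mcoef e eps0 eps0 [::])).
  move=> v; rewrite !lfunE /=; have := eps_comm eps0 v.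
  rewrite /band_mu /= (eps_const (esrc eps0) eps0) => <-.
  by rewrite (eps_const (etgt eps0) eps0).
by exists phi => i v; rewrite phiE lfunE /=; apply: eps_const.
Qed.

End Triangular.

(** * Serre duality for band complexes *)

Section Exactness.
Variables (k : fieldType) (G : gentle) (ST : string_functions G).
Variables (w : word G) (hw : homotopy_band ST w).
Notation L := (size (parts ST w)).
Variable mu : autom k.
Implicit Types (i j l : 'I_L) (x z : vertex G) (p q r : seq (arrow G)).

Notation bmu := (@band_mu k G ST w mu).
Definition band_muV l : 'End(mu) := (bmu l)^-1%VF.
Lemma band_mu_ker l : lker (bmu l) == 0%VS.
Proof. exact/lker0P/band_mu_inj. Qed.
Lemma band_muK l : cancel (bmu l) (band_muV l).
Proof. exact: lker0_lfunK (band_mu_ker l). Qed.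
Lemma band_muVK l : cancel (band_muV l) (bmu l).
Proof. exact: lker0_lfunVK (band_mu_ker l). Qed.

(** With this sign, the two half-edges at a node enter with opposite orientations of the band, and
    the cycle condition at a trivial path becomes the equality in [hval_const]. *)
Definition esign l : k := (-1) ^+ ~~ edge_dir l.
Lemma esignK l : esign l * esign l = 1.
Proof. by rewrite /esign -expr2 sqrr_sign. Qed.

Lemma sum_half_edges (V : nmodType) (F H : 'I_L -> V) i :
  \sum_(l | etgt l == i) F l + \sum_(l | esrc l == i) H l =
  (if edge_dir i then H i else F i) +
  (if edge_dir (ordS i) then F (ordS i) else H (ordS i)).
Proof.
transitivity (\sum_(l | l == i) (if edge_dir l then H l else F l) +
              \sum_(l | l == ordS i) (if edge_dir l then F l else H l)); last first.
  by rewrite !big_pred1_eq.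
rewrite [X in X + _ = _]big_mkcond [X in _ + X = _]big_mkcond.
rewrite [X in _ = X + _]big_mkcond [X in _ = _ + X]big_mkcond -!big_split; apply: eq_bigr => l _ /=.
have E : (l == ordS i) = (ord_pred l == i).
  by rewrite -[l == ordS i](inj_eq (@ord_pred_inj L)) ordSK.
by rewrite /etgt /esrc E; case: edge_dir; case: eqP; case: eqP; rewrite ?addr0 ?add0r // addrC.
Qed.

Variable y : vertex G.
Variables A B : 'I_L -> seq (arrow G) -> mu.
Hypothesis B0 : forall i p, ~~ gpath y (band_vertex i) p -> B i p = 0.
Notation dA A i r := (\sum_(l | esrc l == i) (if suffix (epath l) r
  then bmu l (A (etgt l) (chop (epath l) r)) else 0)).
Notation thA A i p := (\sum_(l | etgt l == i) (if prefix p (epath l)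
  then esign l *: band_muV l (A (esrc l) (drop (size p) (epath l))) else 0)).
Notation dB B i p := (\sum_(l | esrc l == i) bmu l (B (etgt l) (epath l ++ p))).
Hypothesis dA0 : forall i r, gpath (band_vertex i) y r -> dA A i r = 0.
Hypothesis dB0 : forall i p, gpath y (band_vertex i) p -> thA A i p + dB B i p = 0.

Lemma dA_single A' l r : dA A' (esrc l) (r ++ epath l) = bmu l (A' (etgt l) r).
Proof.
rewrite (bigD1 l) //= suffix_suffix chop_cat big1 ?addr0 // => l' /andP[/eqP e n].
case: ifP => // /suffixP[t tE]; case/eqP: n; apply: (esrc_inj hw e).
by rewrite -(oside_cat ST t) ?epath_neq0 // -tE oside_cat ?epath_neq0.
Qed.

Lemma A_target l r : gpath (band_vertex (esrc l)) y (r ++ epath l) -> A (etgt l) r = 0.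
Proof.
by move=> h; apply: (@band_mu_inj _ _ _ _ mu l); rewrite -dA_single dA0 ?linear0.
Qed.

Lemma not_esrc l l' : etgt l = esrc l' -> oside ST (epath l') <> iside ST (epath l).
Proof. by move=> /esym/(esrc_etgt hw) ->; case: iside. Qed.

(** In this lemma and the next three, a nontrivial path [p] sees only the edge on its own side:
    [thA] is zero if that edge is outgoing, [dB] if it is incoming, and the other sum has at most
    one term. *)
Lemma dB_in B' l p : (forall i q, ~~ gpath y (band_vertex i) q -> B' i q = 0) ->
  p != [::] -> iside ST p = iside ST (epath l) -> dB B' (etgt l) p = 0.
Proof.
move=> B'0 pn s; rewrite big1 // => l' /eqP e; rewrite B'0 ?linear0 //.
apply/negP=> /gpath_cat_side-/(_ ST pn (epath_neq0 _)); rewrite s.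
by apply: not_esrc.
Qed.

Lemma dB_single B' l p : (forall i q, ~~ gpath y (band_vertex i) q -> B' i q = 0) ->
  p != [::] -> iside ST p = oside ST (epath l) ->
  dB B' (esrc l) p = bmu l (B' (etgt l) (epath l ++ p)).
Proof.
move=> B'0 pn s; rewrite (bigD1 l) //= big1 ?addr0 // => l' /andP[/eqP e n].
rewrite B'0 ?linear0 //; apply/negP=> /gpath_cat_side-/(_ ST pn (epath_neq0 _)).
by rewrite s => /(esrc_inj hw e) E; rewrite E eqxx in n.
Qed.

Lemma thA_out A' l p : p != [::] -> iside ST p = oside ST (epath l) ->
  thA A' (esrc l) p = 0.
Proof.
move=> pn s; rewrite big1 // => l' /eqP e; case: ifP => // /prefixP[t tE].
case: (not_esrc e); by rewrite -s tE iside_cat.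
Qed.

Lemma thA_in A' l p : p != [::] -> iside ST p = iside ST (epath l) ->
  thA A' (etgt l) p = if prefix p (epath l)
    then esign l *: band_muV l (A' (esrc l) (drop (size p) (epath l))) else 0.
Proof.
move=> pn s; rewrite (bigD1 l) //= big1 ?addr0 // => l' /andP[/eqP e n].
case: ifP => // /prefixP[t tE]; case/eqP: n; apply: (etgt_inj hw e).
by rewrite tE iside_cat.
Qed.

Lemma scale_muV_eq0 l (u : mu) : esign l *: band_muV l u = 0 -> u = 0.
Proof.
move=> E; apply: (can_inj (band_muVK l)); rewrite linear0.
by rewrite -[LHS]scale1r -(esignK l) -scalerA E scaler0.
Qed.

(** On the side of an incoming edge the cycle condition at [p] has only its [theta] term, so the
    coefficient in that term must vanish. *)
Lemma A_interior l p q : epath l = p ++ q -> p != [::] ->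
  gpath y (band_vertex (etgt l)) p -> A (esrc l) q = 0.
Proof.
move=> E pn hp; have s : iside ST p = iside ST (epath l) by rewrite E iside_cat.
have := dB0 hp; rewrite (thA_in A pn s) (dB_in B0 pn s) addr0.
by rewrite {1 2}E prefix_prefix drop_size_cat // => /scale_muV_eq0.
Qed.

Lemma B_source l p : p != [::] -> B (etgt l) (epath l ++ p) = 0.
Proof.
move=> pn; have [h|/B0//] := boolP (gpath y (band_vertex (etgt l)) (epath l ++ p)).
have s : iside ST p = oside ST (epath l) := esym (gpath_cat_side ST h pn (epath_neq0 l)).
have hp : gpath y (band_vertex (esrc l)) p.
  have [z hz hz'] := gpath_split h.
  by rewrite (gpath_src_uniq (epath_gpath hw l) hz').
have := dB0 hp; rewrite (thA_out A pn s) add0r (dB_single B0 pn s) => E.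
by apply: (@band_mu_inj _ _ _ _ mu l); rewrite E linear0.
Qed.

Definition hval (h : 'I_L * bool) : mu :=
  if hout h then esign h.1 *: bmu h.1 (B (etgt h.1) (epath h.1))
  else - band_muV h.1 (A (esrc h.1) (epath h.1)).

(** At a trivial path the cycle condition [dB0] has one term for each half-edge at the node; up to
    signs it says that both prescribe the same value. *)
Lemma hval_const h h' : hnode h = hnode h' -> band_vertex (hnode h) = y -> hval h = hval h'.
Proof.
have main i : band_vertex i = y -> hval (i, true) = hval (ordS i, false).
  move=> xi; have hi : gpath y (band_vertex i) [::] by rewrite gpath_nil xi.
  have := dB0 hi.
  rewrite (eq_bigr (fun l => esign l *: band_muV l (A (esrc l) (epath l)))); last first.
    by move=> l _; rewrite drop0 prefix0s.
  rewrite [X in _ + X](eq_bigr (fun l => bmu l (B (etgt l) (epath l)))); last first.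
    by move=> l _; rewrite cats0.
  rewrite sum_half_edges /hval /hout /= /esign.
  do 2!case: edge_dir => /=; rewrite ?expr0 ?expr1 ?scale1r ?scaleN1r => /eqP;
    by rewrite addr_eq0 => /eqP.
move=> n x; have [->//|->] := hnode_mateP n.
move: n x; case: h' => i [] n x; rewrite /hmate /=.
  by rewrite -main //; rewrite -x n.
by rewrite main ?ord_predK //; rewrite -x n.
Qed.

(* A preimage of the cycle (A, B): along the half-edge on the side of the path,
   its coefficients are read off A if the edge is incoming and off B if it is
   outgoing. At a trivial path both half-edges give the same value, by
   [hval_const]. *)
Definition sol_coef i r : mu := let h := half_edge i (oside ST r) in let l := h.1 in
  if hout h then
    if suffix r (epath l) then
      if (r == epath l) && edge_dir l then 0
      else esign l *: bmu l (B (etgt l) (chop r (epath l)))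
    else 0
  else - band_muV l (A (esrc l) (r ++ epath l)).

(** The component of the preimage in the Nakayama image. The value [B i [::]] can be produced across
    either half-edge at [i]; the tests on [edge_dir], here and in [sol_coef], leave it to the
    half-edge [(i, true)] alone. *)
Definition nsol_coef i p : mu := let h := half_edge i (iside ST p) in let l := h.1 in
  if hout h then 0 else
    if prefix (epath l) p then
      if (p == epath l) && ~~ edge_dir l then 0
      else band_muV l (B (esrc l) (drop (size (epath l)) p))
    else 0.

Lemma half_edge_src l b : oside ST (epath l) = b -> half_edge (esrc l) b = (l, edge_dir l).
Proof.
move=> s; apply: (half_edge_inj hw); first by rewrite half_edge_node esrc_half.
by rewrite half_edge_side // hside_src.
Qed.
Lemma half_edge_tgt l b : iside ST (epath l) = b -> half_edge (etgt l) b = (l, ~~ edge_dir l).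
Proof.
move=> s; apply: (half_edge_inj hw); first by rewrite half_edge_node etgt_half.
by rewrite half_edge_side // hside_tgt.
Qed.

Lemma sol_coef_src l r : oside ST r = oside ST (epath l) -> sol_coef (esrc l) r =
  if suffix r (epath l) then if (r == epath l) && edge_dir l then 0
      else esign l *: bmu l (B (etgt l) (chop r (epath l))) else 0.
Proof. by move=> s; rewrite /sol_coef (half_edge_src (esym s)) /hout /= eqxx. Qed.
Lemma sol_coef_tgt l r : oside ST r = iside ST (epath l) ->
  sol_coef (etgt l) r = - band_muV l (A (esrc l) (r ++ epath l)).
Proof.
by move=> s; rewrite /sol_coef (half_edge_tgt (esym s)) /hout /=; case: edge_dir.
Qed.
Lemma sol_coef_nil h : band_vertex (hnode h) = y -> sol_coef (hnode h) [::] = hval h.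
Proof.
move=> x; rewrite /sol_coef; set h' := half_edge _ _.
have -> : hval h = hval h' by apply: hval_const; rewrite ?half_edge_node.
rewrite /hval suffix0s /chop subn0 take_size eq_sym.
by rewrite (negPf (epath_neq0 _)).
Qed.
Lemma nsol_coef_tgt l p : iside ST p = iside ST (epath l) -> nsol_coef (etgt l) p =
  if prefix (epath l) p then if (p == epath l) && ~~ edge_dir l then 0
      else band_muV l (B (esrc l) (drop (size (epath l)) p)) else 0.
Proof.
by move=> s; rewrite /nsol_coef (half_edge_tgt (esym s)) /hout /=; case: (edge_dir l).
Qed.

Definition sol i r := if gpath (band_vertex i) y r then sol_coef i r else 0.
Definition nsol i p := if gpath y (band_vertex i) p then nsol_coef i p else 0.

Lemma nsol0 i p : ~~ gpath y (band_vertex i) p -> nsol i p = 0.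
Proof. by rewrite /nsol => /negPf->. Qed.

(** Compare [r] with the edge on its side. If [r] ends in the path of an outgoing edge, the
    coefficient is reached across that edge. In all other cases both sides vanish, by [A_target] for
    an incoming edge and by [A_interior] for an outgoing one; for trivial [r] either edge will
    do. *)
Lemma A_bound i r : gpath (band_vertex i) y r -> - dA sol i r = A i r.
Proof.
move=> hr; have [r0|rn] := eqVneq r [::].
  rewrite r0 in hr *; rewrite big1 => [|l _]; last by rewrite suffixs0 (negPf (epath_neq0 _)).
  have xi : band_vertex i = y by move: hr; rewrite gpath_nil => /eqP.
  rewrite oppr0; have [[l li _]|[l li _]] := edge_at_side hw i true.
    rewrite -li (@A_interior l (epath l) [::]) ?cats0 ?epath_neq0 //.
    by rewrite -xi -li epath_gpath.
  by rewrite -li A_target // -xi -li epath_gpath.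
have [[l li s]|[l li s]] := edge_at_side hw i (oside ST r); last first.
  rewrite big1 => [|l' /eqP e]; last first.
    case: ifP => // /suffixP[t tE]; case: (not_esrc (etrans li (esym e))).
    by rewrite s tE oside_cat ?epath_neq0.
  rewrite oppr0 -li A_target //.
  have hl := epath_gpath hw l; rewrite li in hl.
  by rewrite (gpath_cat ST hl hr (epath_neq0 l) rn) s.
have [/suffixP[p rE]|ns] := boolP (suffix (epath l) r).
  rewrite rE -li dA_single /sol.
  have hp : gpath (band_vertex (etgt l)) y p.
    have := hr; rewrite rE => /gpath_split[z hz hz'].
    by have := epath_gpath hw l; rewrite li => /gpath_tgt_uniq/(_ hz) ->.
  rewrite hp; have [p0|pn] := eqVneq p [::].
    rewrite p0 -etgt_half sol_coef_nil /hval /hout /=; last first.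
      by rewrite etgt_half; move: hp; rewrite p0 gpath_nil => /eqP.
    by case: (edge_dir l); rewrite /= linearN /= opprK band_muVK.
  rewrite sol_coef_tgt ?linearN /= ?opprK ?band_muVK //.
  by have := hr; rewrite rE => /gpath_cat_side-/(_ ST (epath_neq0 l) pn).
rewrite big1 => [|l' /eqP e]; last first.
  case: ifP => // sl; case/negP: ns; have -> // : l = l'.
  apply: (esrc_inj hw); first by rewrite li e.
  by have /suffixP[t tE] := sl; rewrite s tE oside_cat ?epath_neq0.
have hl := epath_gpath hw l; rewrite li in hl.
have := gpath_suffix (ST := ST) hr hl; rewrite s eqxx !orbT (negPf ns) orbF.
move=> /(_ isT) /suffixP[t tE]; rewrite oppr0 -li (A_interior tE) //.
  by apply: contraNneq ns => t0; rewrite tE t0 suffix_refl.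
have := hl; rewrite tE => /gpath_split[z hz hz'].
by rewrite (gpath_tgt_uniq hr hz).
Qed.

Lemma nsol_edge l p : gpath y (band_vertex (etgt l)) (epath l ++ p) ->
  nsol (etgt l) (epath l ++ p) =
  if (p == [::]) && ~~ edge_dir l then 0 else band_muV l (B (esrc l) p).
Proof.
move=> h; rewrite /nsol h nsol_coef_tgt ?iside_cat ?epath_neq0 // prefix_prefix drop_size_cat //.
have -> // : (epath l ++ p == epath l) = (p == [::]).
by rewrite -{2}(cats0 (epath l)) eqseq_cat // eqxx.
Qed.

(** For nontrivial [p], an outgoing edge on its side reaches the coefficient through [nsol]. An
    incoming edge reaches it through [sol] if [p] is a prefix of its path; otherwise [p] is longer
    than that path and [B] vanishes by [B_source]. *)
Lemma B_bound i p : gpath y (band_vertex i) p -> thA sol i p + dB nsol i p = B i p.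
Proof.
move=> hp; have [p0|pn] := eqVneq p [::].
  rewrite p0 in hp *; have xi : band_vertex i = y by move: hp; rewrite gpath_nil => /eqP.
  have hin l : etgt l = i -> sol (esrc l) (epath l) =
      if edge_dir l then 0 else esign l *: bmu l (B i [::]).
    move=> li; have hl := epath_gpath hw l; rewrite li xi in hl.
    by rewrite /sol hl sol_coef_src // suffix_refl eqxx /chop subnn take0 li.
  have hou l : esrc l = i -> nsol (etgt l) (epath l) =
      if edge_dir l then band_muV l (B i [::]) else 0.
    move=> li; have hl := epath_gpath hw l; rewrite li xi in hl.
    have := @nsol_edge l [::]; rewrite cats0 li => /(_ hl) ->.
    by case: edge_dir.
  rewrite (eq_bigr (fun l => if edge_dir l then 0 else B i [::])); last first.
    move=> l /eqP li; rewrite prefix0s drop0 hin //; case: edge_dir; rewrite ?linear0 ?scaler0 //.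
    by rewrite linearZ /= band_muK scalerA esignK scale1r.
  rewrite [X in _ + X](eq_bigr (fun l => if edge_dir l then B i [::] else 0)); last first.
    by move=> l /eqP li; rewrite cats0 hou //; case: edge_dir; rewrite ?linear0 // band_muVK.
  by rewrite sum_half_edges; do 2!case: edge_dir; rewrite addr0.
have [[l li s]|[l li s]] := edge_at_side hw i (iside ST p).
  rewrite -li (thA_out sol pn (esym s)) add0r (dB_single nsol0 pn (esym s)).
  have hl : gpath y (band_vertex (etgt l)) (epath l ++ p).
    rewrite -li in hp; by rewrite (gpath_cat ST hp (epath_gpath hw l) pn (epath_neq0 l)) s.
  by rewrite nsol_edge // (negPf pn) /= band_muVK.
rewrite -li (thA_in sol pn (esym s)) (dB_in nsol0 pn (esym s)) addr0.
have hl := epath_gpath hw l; rewrite li in hl.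
have := gpath_prefix (ST := ST) hp hl; rewrite s eqxx !orbT => /(_ isT).
case: ifP => [/prefixP[q qE] _|np /=]; last first.
  move=> /prefixP[q qE]; rewrite qE B_source //.
  by apply: contraFneq np => q0; rewrite qE q0 cats0 prefix_refl.
rewrite {1}qE drop_size_cat //.
have hq : gpath (band_vertex (esrc l)) y q.
  have := hl; rewrite qE => /gpath_split[z hz hz'].
  by rewrite (gpath_src_uniq hp hz').
rewrite /sol hq; have [q0|qn] := eqVneq q [::].
  rewrite q0 -esrc_half sol_coef_nil /hval /hout /=; last first.
    by rewrite esrc_half; move: hq; rewrite q0 gpath_nil => /eqP.
  by rewrite eqxx linearZ /= band_muK scalerA esignK scale1r qE q0 cats0.
rewrite sol_coef_src; last by rewrite qE oside_cat.
rewrite {1}qE suffix_suffix; case: eqP => [E|_] /=.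
  case/eqP: pn; have := congr1 size qE; rewrite size_cat E => /eqP.
  by rewrite -{1}(add0n (size _)) eqn_add2r eq_sym size_eq0 => /eqP.
by rewrite qE chop_cat linearZ /= band_muK scalerA esignK scale1r.
Qed.

End Exactness.

(** * Injective representations and the Nakayama image of a band complex *)

Section Injective.
Variables (k : fieldType) (G : gentle).
Implicit Types x y z t : vertex G.

Lemma kcomp1 x y (e : kG k x y) : kcomp e (kid k x) = e.
Proof.
rewrite /kcomp {1}[e]kG_decomp [RHS]kG_decomp (lin_sumZ (conv_linearl _)).
apply: eq_bigr => p _; congr (_ *: _).
rewrite -[LHS]/(kcomp (kpath k p) (kpath k (path1 x))) kcomp_kpath.
have p1 : arrows p ++ arrows (path1 x) = arrows p := cats0 _.
rewrite p1 (bigD1 p) //= big1 ?addr0 // => r /andP[/eqP/arrows_inj->].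
by rewrite eqxx.
Qed.

Definition precomp x y z (e : kG k y z) : 'Hom(kG k z x, kG k y x) :=
  linfun (fun f : kG k z x => kcomp f e).
Lemma precompE x y z (e : kG k y z) (f : kG k z x) : precomp x e f = kcomp f e.
Proof. by rewrite /precomp lfunLE //; apply: conv_linearl. Qed.

Section Irep.
Variables (K : vectType k) (x : vertex G).

(* D k Gamma(-, x) (x) K, the injective representation at x *)
Definition irep_act y z (e : kG k y z) : 'Hom('Hom(kG k y x, K), 'Hom(kG k z x, K)) :=
  linfun (fun f : 'Hom(kG k y x, K) => (f \o precomp x e)%VF).
Lemma irep_actE y z (e : kG k y z) (f : 'Hom(kG k y x, K)) g :
  irep_act e f g = f (kcomp g e).
Proof.
rewrite /irep_act lfunLE ?comp_lfunE ?precompE // => c u v.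
by rewrite comp_lfunDl -comp_lfunZl.
Qed.

Definition irep : rep k G.
Proof.
exists (fun y => 'Hom(kG k y x, K)) irep_act.
- move=> y z c e e'; apply/lfunP=> f; apply/lfunP=> g.
  rewrite add_lfunE scale_lfunE irep_actE.
  rewrite add_lfunE scale_lfunE !irep_actE /kcomp conv_linearr linearP.
  by [].
- by move=> y; apply/lfunP=> f; apply/lfunP=> g; rewrite irep_actE kcomp1 lfunE.
move=> y z t e f; apply/lfunP=> u; apply/lfunP=> g.
rewrite comp_lfunE !irep_actE; congr (u _).
by rewrite /kcomp -convA.
Defined.
End Irep.
End Injective.

Section NuBand.
Variables (k : fieldType) (G : gentle) (ST : string_functions G) (m : int).
Variables (w : word G) (hw : homotopy_band ST w).
Notation L := (size (parts ST w)).
Variable mu : autom k.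
Implicit Types (i j l : 'I_L) (x y z : vertex G) (p q r : seq (arrow G)).
Notation band n := (band_obj ST m w mu n).
Notation bco a i p := (bco_at i p a).
Notation node n := {i : 'I_L | isucc (band_degree m i) == n}.

(* The image of the band complex under the Nakayama functor, shifted by one. *)
Definition nband n : rep k G := rsum (fun i : node n => irep mu (band_vertex (val i))).

Definition nfun n y (b : nband n y) (i : node n) : 'Hom(kG k y (band_vertex (val i)), mu) :=
  (b : dsum (fun i : node n => irep mu (band_vertex (val i)) y)) i.

Definition nco_at n y i p (b : nband n y) : mu :=
  \sum_(i' : node n | val i' == i)
    \sum_(q : Path y (band_vertex (val i')) | q == p :> seq _) nfun b i' (kpath k q).
Notation nco b i p := (nco_at i p b).

Lemma nco_linear n y i p : linear (@nco_at n y i p).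
Proof.
move=> c a b; rewrite /nco_at scaler_sumr -big_split; apply: eq_bigr => i' _ /=.
rewrite scaler_sumr -big_split; apply: eq_bigr => q _ /=.
by rewrite /nfun dsumDE dsumZE add_lfunE scale_lfunE.
Qed.
HB.instance Definition _ n y i p := GRing.isLinear.Build k (nband n y) mu _
  (@nco_at n y i p) (@nco_linear n y i p).

Lemma nco_path n y (b : nband n y) (i' : node n) (q : Path y (band_vertex (val i'))) :
  nco b (val i') q = nfun b i' (kpath k q).
Proof.
rewrite /nco_at (bigD1 i') //= [X in _ + X]big1 ?addr0 => [|j /andP[/eqP/val_inj->]].
  rewrite (bigD1 q) //= big1 ?addr0 // => q' /andP[/eqP/arrows_inj->].
  by rewrite eqxx.
by rewrite eqxx.
Qed.

Lemma nco_deg n y (b : nband n y) i p : isucc (band_degree m i) <> n -> nco b i p = 0.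
Proof.
move=> ne; rewrite /nco_at big1 // => i' /eqP E; case: ne; rewrite -E.
by apply/eqP/(valP i').
Qed.

Lemma nco_notin n y (b : nband n y) i p :
  ~~ gpath y (band_vertex i) p -> nco b i p = 0.
Proof.
move=> np; rewrite /nco_at big1 // => i' /eqP E; rewrite big1 // => q /eqP qp.
by move: np; rewrite -E -qp arrowsP.
Qed.

Lemma nco_ext n y (a b : nband n y) :
  (forall i p, isucc (band_degree m i) = n -> gpath y (band_vertex i) p ->
     nco a i p = nco b i p) -> a = b.
Proof.
move=> E; apply/ffunP=> i'; apply/lfunP=> e.
rewrite [e]kG_decomp !linear_sum; apply: eq_bigr => q _ /=.
rewrite !linearZ /=; congr (_ *: _).
rewrite -[LHS]/(nfun a i' (kpath k q)) -[RHS]/(nfun b i' (kpath k q)) -!nco_path.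
by apply: E; [apply/eqP/(valP i')|apply: arrowsP].
Qed.

Definition nmk n y (F : 'I_L -> seq (arrow G) -> mu) : nband n y :=
  [ffun i' : node n => linfun (fun e : kG k y (band_vertex (val i')) =>
     \sum_q e q *: F (val i') (arrows q))].
Arguments nmk {n y} F.

Lemma nco_mk n y F i p : nco (@nmk n y F) i p =
  if (isucc (band_degree m i) == n) && gpath y (band_vertex i) p then F i p else 0.
Proof.
case: ifPn => [/andP[di hp]|]; last first.
  by rewrite negb_and => /orP[/eqP/nco_deg->|/nco_notin->].
rewrite -[i]/(val (Sub i di : node n)) -(mkPathE hp) nco_path /nfun ffunE lfunLE.
  rewrite (bigD1 (mkPath hp)) //= big1 ?addr0 => [|q nq].
    by rewrite ffunE eqxx scale1r.
  by rewrite ffunE (negPf nq) scale0r.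
move=> c e f; rewrite scaler_sumr -big_split; apply: eq_bigr => q _ /=.
by rewrite !ffunE scalerDl scalerA.
Qed.

Lemma nco_act n y z (t : Path y z) (b : nband n y) i p :
  nco (ract (nband n) (kpath k t) b) i p =
  if gpath z (band_vertex i) p then nco b i (p ++ t) else 0.
Proof.
have [hp|/nco_notin->//] := boolP (gpath z (band_vertex i) p).
have [di|/eqP di] := boolP (isucc (band_degree m i) == n); last by rewrite !nco_deg.
rewrite -[i]/(val (Sub i di : node n)) -{1}(mkPathE hp) nco_path.
rewrite /nfun [ract _ _]/= dsum_diagE irep_actE kcomp_kpath linear_sum /=.
rewrite /nco_at (bigD1 (Sub i di : node n)) //= [X in _ + X]big1 ?addr0 => [|j].
  by [].
by move=> /andP[/eqP E /eqP[]]; apply: val_inj.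
Qed.

(** The edge [l] gives the map from the projective at [esrc l] to the injective at [etgt l] which
    sends [q] to the functional supported on the path [p] with [p ++ q = epath l], tensored with the
    inverse of [band_mu l] and a sign. *)
Definition theta_fun n y (a : band n y) : nband n y :=
  nmk (fun i p => \sum_(l | etgt l == i) (if prefix p (epath l)
    then esign k l *: band_muV mu l (bco a (esrc l) (drop (size p) (epath l))) else 0)).

Lemma theta_funE n y (a : band n y) i p : gpath y (band_vertex i) p ->
  nco (theta_fun a) i p = \sum_(l | etgt l == i) (if prefix p (epath l)
    then esign k l *: band_muV mu l (bco a (esrc l) (drop (size p) (epath l))) else 0).
Proof.
move=> hp; rewrite nco_mk hp andbT; case: eqP => // di.
rewrite big1 // => l /eqP li; rewrite bco_deg ?linear0 ?scaler0 ?if_same //.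
by rewrite edge_degree // li.
Qed.

Lemma theta_linear n y : linear (@theta_fun n y).
Proof.
move=> c a b; apply: nco_ext => i p _ hp.
rewrite linearP /= !theta_funE // scaler_sumr -big_split; apply: eq_bigr => l _ /=.
case: ifP => _; last by rewrite scaler0 addr0.
by rewrite bco_linear linearP /= scalerDr !scalerA mulrC.
Qed.

Definition theta n : rhom (band n) (nband n).
Proof.
apply: (@mk_rhom _ _ _ _ (fun y => linfun (@theta_fun n y))) => y z t a.
rewrite (lfunLE (@theta_linear n y)) (lfunLE (@theta_linear n z)).
apply: nco_ext => i p _ hp; rewrite nco_act hp theta_funE //.
transitivity (\sum_(l | etgt l == i)
  (if gpath y (band_vertex i) (p ++ t) && prefix (p ++ t) (epath l)
   then esign k l *: band_muV mu l (bco a (esrc l) (drop (size (p ++ t)) (epath l)))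
   else 0)); last first.
  have [ht|ht] := boolP (gpath _ _ _); first by rewrite theta_funE.
  by rewrite nco_notin // big1.
apply: eq_bigr => l /eqP li; have hl := epath_gpath hw l; rewrite li in hl.
case: ifP => [/prefixP[q qE]|np]; last first.
  case: ifP => // /andP[_ /prefixP[q qE]].
  by rewrite qE -catA prefix_prefix in np.
rewrite {1}qE drop_size_cat // bco_act.
have hq : gpath (band_vertex (esrc l)) z q by move: hl; rewrite qE => /gpath_catr'; apply.
rewrite hq /=; case: ifP => [/prefixP[r rE]|np].
  have hr : gpath (band_vertex (esrc l)) y r.
    by move: hq; rewrite rE => /gpath_catr'; apply; apply: arrowsP.
  have ht : gpath y (band_vertex i) (p ++ t).
    by move: hl; rewrite qE rE catA => /gpath_catl; apply.
  by rewrite ht {1 2}qE rE catA prefix_prefix !drop_size_cat.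
rewrite linear0 scaler0; case: ifP => // /andP[_ /prefixP[r rE]].
move: rE; rewrite qE -catA => /eqP; rewrite eqseq_cat // eqxx /= => /eqP E.
by rewrite E prefix_prefix in np.
Defined.

Lemma thetaE n y (a : band n y) i p : gpath y (band_vertex i) p ->
  nco (theta n y a) i p = \sum_(l | etgt l == i) (if prefix p (epath l)
    then esign k l *: band_muV mu l (bco a (esrc l) (drop (size p) (epath l))) else 0).
Proof. by move=> hp; rewrite /= lfunLE ?theta_funE //; apply: theta_linear. Qed.

Definition ndiff_fun n y (b : nband n y) : nband (isucc n) y :=
  nmk (fun i p => \sum_(l | esrc l == i) band_mu mu l (nco b (etgt l) (epath l ++ p))).

Lemma ndiff_funE n y (b : nband n y) i p : gpath y (band_vertex i) p ->
  nco (ndiff_fun b) i p =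
  \sum_(l | esrc l == i) band_mu mu l (nco b (etgt l) (epath l ++ p)).
Proof.
move=> hp; rewrite nco_mk hp andbT; case: eqP => // di.
rewrite big1 // => l /eqP li; rewrite nco_deg ?linear0 //.
by move=> E; apply: di; rewrite -E -li edge_degree.
Qed.

Lemma ndiff_linear n y : linear (@ndiff_fun n y).
Proof.
move=> c a b; apply: nco_ext => i p _ hp.
rewrite linearP /= !ndiff_funE // scaler_sumr -big_split; apply: eq_bigr => l _ /=.
by rewrite linearP /= linearP.
Qed.

Definition ndiff n : rhom (nband n) (nband (isucc n)).
Proof.
apply: (@mk_rhom _ _ _ _ (fun y => linfun (@ndiff_fun n y))) => y z t b.
rewrite (lfunLE (@ndiff_linear n y)) (lfunLE (@ndiff_linear n z)).
apply: nco_ext => i p _ hp; rewrite nco_act hp ndiff_funE //.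
transitivity (\sum_(l | esrc l == i) band_mu mu l (nco b (etgt l) (epath l ++ p ++ t))).
  apply: eq_bigr => l /eqP li; rewrite nco_act; congr (band_mu _ _ _).
  case: ifPn => [_|np]; first by rewrite catA.
  rewrite nco_notin //; apply: contra np; rewrite catA => /gpath_catl; apply.
  exact: arrowsP.
have [ht|ht] := boolP (gpath y (band_vertex i) (p ++ t)); first by rewrite ndiff_funE.
rewrite nco_notin // big1 // => l /eqP li; rewrite nco_notin ?linear0 //.
apply: contra ht => /gpath_catr'; apply; have := epath_gpath hw l; by rewrite li.
Defined.

Lemma ndiffE n y (b : nband n y) i p : gpath y (band_vertex i) p ->
  nco (ndiff n y b) i p =
  \sum_(l | esrc l == i) band_mu mu l (nco b (etgt l) (epath l ++ p)).
Proof. by move=> hp; rewrite /= lfunLE ?ndiff_funE //; apply: ndiff_linear. Qed.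

(* The mapping cone of [theta]. Its exactness says that [theta] is a
   quasi-isomorphism: the band complex is its own Auslander-Reiten translate. *)
Definition ncone n : rep k G := rpair (band (isucc n)) (nband n).

Definition ncone_diff n : rhom (ncone n) (ncone (isucc n)) :=
  rpair_mx (ropp (band_diff ST m w mu (isucc n))) (rzero _ _)
    (theta (isucc n)) (ndiff n).

Lemma ncone_diffE n y (a : band (isucc n) y) (b : nband n y) :
  ncone_diff n y (a, b) =
  (- band_diff ST m w mu (isucc n) y a, theta (isucc n) y a + ndiff n y b).
Proof. by rewrite /ncone_diff /= pair_mxE /= zero_lfunE addr0 opp_lfunE. Qed.

Lemma ncone_exact n y (c : ncone (isucc n) y) : ncone_diff (isucc n) y c = 0 ->
  exists b, ncone_diff n y b = c.
Proof.
case: c => a b; rewrite ncone_diffE => -[/eqP da0 db0].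
pose A i p := bco a i p; pose B i p := nco b i p.
have B0 i p : ~~ gpath y (band_vertex i) p -> B i p = 0 by apply: nco_notin.
have dA0 i r : gpath (band_vertex i) y r -> \sum_(l | esrc l == i)
    (if suffix (epath l) r then band_mu mu l (A (etgt l) (chop (epath l) r)) else 0) = 0.
  move=> hr; move: da0; rewrite oppr_eq0 => /eqP/(congr1 (@bco_at _ _ _ _ _ mu _ _ i r)).
  by rewrite bco_diff // linear0 hr.
have dB0 i p : gpath y (band_vertex i) p -> \sum_(l | etgt l == i)
    (if prefix p (epath l) then
     esign k l *: band_muV mu l (A (esrc l) (drop (size p) (epath l))) else 0) +
    \sum_(l | esrc l == i) band_mu mu l (B (etgt l) (epath l ++ p)) = 0.
  move=> hp; have := congr1 (@nco_at _ _ i p) db0.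
  by rewrite linearD linear0 /= thetaE // ndiffE.
pose a' : band (isucc n) y := bmk (sol y A B).
pose b' : nband n y := nmk (nsol y B).
exists (a', b'); rewrite ncone_diffE; congr (_, _).
  apply: bco_ext => i r di hr; rewrite linearN /= bco_diff //.
  rewrite -[RHS](A_bound hw B0 dA0 dB0 hr); congr (- _); apply: eq_bigr => l /eqP li.
  rewrite hr /=; case: ifP => // _; congr (band_mu _ _ _); rewrite bco_mk.
  have -> : band_degree m (etgt l) == isucc n.
    by apply/eqP/isucc_inj; rewrite -edge_degree // li.
  by rewrite /= /sol; case: (gpath _ _ _).
apply: nco_ext => i p di hp; rewrite linearD /= thetaE // ndiffE //.
rewrite -[RHS](B_bound hw B0 dB0 hp); congr (_ + _); apply: eq_bigr => l /eqP li.
  case: ifP => // _; congr (_ *: band_muV _ _ _); rewrite bco_mk.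
  by rewrite edge_degree // li di eqxx /= /sol; case: (gpath _ _ _).
congr (band_mu _ _ _); rewrite nco_mk -edge_degree // li.
by have -> : band_degree m i = n; [exact: isucc_inj|rewrite eqxx /= /nsol; case: (gpath _ _ _)].
Qed.

End NuBand.
Arguments nmk {k G ST m w mu n y} F.

Section DegreeCast.
Variables (k : fieldType) (G : gentle) (W : cplx k G).

(* Zero if a differs from b. *)
Definition wcast a b x : 'Hom(W a x, W b x) :=
  if a =P b is ReflectT E then ecast c ('Hom(W a x, W c x)) E \1%VF else 0.

Lemma wcast_id a x u : wcast a a x u = u.
Proof.
rewrite /wcast; case: eqP => // E.
by rewrite eq_axiomK lfunE.
Qed.

Lemma wcast_sact a b x y p u : wcast a b y (sact (W a) x y p u) = sact (W b) x y p (wcast a b x u).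
Proof.
have [<-|ne] := eqVneq a b; first by rewrite !wcast_id.
by rewrite /wcast; case: eqP => [E|_]; [rewrite E eqxx in ne|rewrite !zero_lfunE linear0].
Qed.
End DegreeCast.

Lemma comp_lfun_suml (k : fieldType) (U V T : vectType k) (I : finType) (P : pred I)
    (F : I -> 'Hom(V, T)) (f : 'Hom(U, V)) :
  ((\sum_(i | P i) F i) \o f)%VF = \sum_(i | P i) (F i \o f)%VF.
Proof.
by apply/lfunP=> u; rewrite comp_lfunE !sum_lfunE; apply: eq_bigr => i _; rewrite comp_lfunE.
Qed.
Lemma comp_lfun_sumr (k : fieldType) (U V T : vectType k) (I : finType) (P : pred I)
    (F : I -> 'Hom(U, V)) (f : 'Hom(V, T)) :
  (f \o \sum_(i | P i) F i)%VF = \sum_(i | P i) (f \o F i)%VF.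
Proof.
apply/lfunP=> u; rewrite comp_lfunE !sum_lfunE linear_sum.
by apply: eq_bigr => i _; rewrite comp_lfunE.
Qed.

(** * Non-degeneracy of the trace form *)

Section Serre.
Variables (k : fieldType) (G : gentle) (ST : string_functions G) (m : int).
Variables (w : word G) (hw : homotopy_band ST w).
Notation L := (size (parts ST w)).
Variable mu : autom k.
Implicit Types (i j l : 'I_L) (x y z : vertex G) (p q r : seq (arrow G)).
Notation band n := (band_obj ST m w mu n).
Notation X := (band_cplx m hw mu).
Notation bco a i p := (bco_at i p a).
Notation nco b i p := (nco_at i p b).
Notation deg := (band_degree m).
Notation vtx := (@band_vertex G ST w).
Notation bmu := (@band_mu k G ST w mu).

Definition edge_coef (t : cmap X (shift X)) l : 'End(mu) :=
  linfun (fun v => bco (t (deg (etgt l)) (vtx (etgt l)) (bgen m _ (etgt l) v)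
    : band (isucc (deg (etgt l))) (vtx (etgt l))) (esrc l) (epath l)).
Lemma edge_coefE t l v : edge_coef t l v =
  bco (t (deg (etgt l)) (vtx (etgt l)) (bgen m _ (etgt l) v)
    : band (isucc (deg (etgt l))) (vtx (etgt l))) (esrc l) (epath l).
Proof. by rewrite /edge_coef lfunLE // => c a b; rewrite linearP linearP; apply: bco_linear. Qed.

(* The trace form of Serre duality: the signs and the inverse automorphisms are
   those for which the form vanishes on null-homotopic maps. *)
Definition serre_form (t : cmap X (shift X)) : k^o :=
  \sum_l esign k l *: ltrace (band_muV mu l \o edge_coef t l)%VF.

Variables (W : cplx k G) (beta : cmap W (shift X)).

Definition coef_beta i l : 'Hom(W (deg i) (vtx i), mu) :=
  linfun (fun u => bco (beta (deg i) (vtx i) u : band (isucc (deg i)) (vtx i)) (esrc l) (epath l)).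
Lemma coef_betaE i l u : coef_beta i l u =
  bco (beta (deg i) (vtx i) u : band (isucc (deg i)) (vtx i)) (esrc l) (epath l).
Proof. by rewrite /coef_beta lfunLE // => c a b; rewrite linearP; apply: bco_linear. Qed.

Notation gdata := (dsum (fun i => 'Hom(mu, W (deg i) (vtx i)) : vectType k)).
Notation gdata1 := (dsum (fun i => 'Hom(mu, W (isucc (deg i)) (vtx i)) : vectType k)).

(** The families [g] are the morphisms of graded objects from [X] to [W], which need not commute
    with the differentials. *)
Definition gmap (g : gdata) n : rhom (band n) (W n) :=
  blift m n (fun i => (wcast W (deg i) n (vtx i) \o g i)%VF).

Definition gterm i j l (f : 'Hom(mu, W (deg i) (vtx i))) : 'Hom(mu, W (isucc (deg j)) (vtx j)) :=
  (sact (W (isucc (deg j))) (vtx i) (vtx j) (epath l) \o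
   (wcast W (deg i) (isucc (deg j)) (vtx i) \o (f \o bmu l)))%VF.

(** This is [d g - g d] on generators; families with value zero define chain maps. *)
Definition gdiff_fun (g : gdata) : gdata1 := [ffun i =>
  (cdiff W (deg i) (vtx i) \o g i)%VF - \sum_(l | etgt l == i) gterm i l (g (esrc l))].

Lemma gterm_linear i j l : linear (@gterm i j l).
Proof.
move=> c f f'; apply/lfunP=> u.
by rewrite /gterm !(comp_lfunE, add_lfunE, scale_lfunE) !linearP.
Qed.
HB.instance Definition _ i j l := GRing.isLinear.Build k _ _ _ (@gterm i j l)
  (@gterm_linear i j l).

Lemma gdiff_linear : linear gdiff_fun.
Proof.
move=> c g g'; apply/ffunP=> i; rewrite dsumDE dsumZE !ffunE.
rewrite comp_lfunDr -comp_lfunZr scalerBr addrACA -opprD; congr (_ - _).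
rewrite scaler_sumr -big_split; apply: eq_bigr => l _ /=.
by rewrite dsumDE dsumZE linearP.
Qed.
Definition gdiff : 'Hom(gdata, gdata1) := linfun gdiff_fun.
Lemma gdiffE g i : gdiff g i =
  (cdiff W (deg i) (vtx i) \o g i)%VF - \sum_(l | etgt l == i) gterm i l (g (esrc l)).
Proof. by rewrite /gdiff lfunLE ?ffunE //; apply: gdiff_linear. Qed.

Lemma gmap_gen g n i v : deg i = n ->
  gmap g n (vtx i) (bgen m n i v) = wcast W (deg i) n (vtx i) (g i v).
Proof. by move=> di; rewrite /gmap blift_gen // comp_lfunE. Qed.

Lemma gmap_cmap g : gdiff g = 0 ->
  {f : cmap X W | forall n x u, f n x u = gmap g n x u}.
Proof.
move=> g0; apply: mk_cmap => n x u; rewrite -!rcompv.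
move: x u; have H := @rhom_band_ext _ _ _ _ _ mu n _ (rcomp (gmap g (isucc n)) (band_diff ST m w mu n))
  (rcomp (cdiff W n) (gmap g n)).
apply: H => i v di; case: n / di.
rewrite !rcompv gmap_gen // wcast_id band_diff_gen // linear_sum /=.
have /lfunP/(_ v) : gdiff g i = 0 by rewrite g0 dsum0E.
rewrite gdiffE add_lfunE opp_lfunE comp_lfunE sum_lfunE zero_lfunE => /eqP.
rewrite subr_eq0 => /eqP ->; apply: eq_bigr => l /eqP li.
rewrite /gterm !comp_lfunE (sact_rmap (gmap g _)) gmap_gen //.
by rewrite edge_degree // li.
Qed.

(** The extension of [f |-> serre_form (ccomp beta f)] from chain maps to all graded morphisms. *)
Definition gform_fun (g : gdata) : k^o := \sum_i \sum_(l | etgt l == i)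
  esign k l *: ltrace (band_muV mu l \o (coef_beta i l \o g i))%VF.
Lemma gform_linear : linear gform_fun.
Proof.
move=> c g g'; rewrite scaler_sumr -big_split; apply: eq_bigr => i _ /=.
rewrite scaler_sumr -big_split; apply: eq_bigr => l _ /=.
rewrite dsumDE dsumZE !comp_lfunDr -!comp_lfunZr linearP /= scalerDr.
by rewrite !scalerA mulrC.
Qed.

Lemma sum_etgt (V : nmodType) (F : 'I_L -> 'I_L -> V) :
  \sum_i \sum_(l | etgt l == i) F i l = \sum_l F (etgt l) l.
Proof.
rewrite (exchange_big_dep xpredT) //=; apply: eq_bigr => l _.
by rewrite (big_pred1 (etgt l)) // => i; rewrite /= eq_sym.
Qed.

Hypothesis beta0 : forall f : cmap X W, serre_form (ccomp beta f) = 0.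

Lemma gform_vanish (g : gdata) : gdiff g = 0 -> gform_fun g = 0.
Proof.
move=> /gmap_cmap[f fE]; rewrite -(beta0 f) /gform_fun sum_etgt.
apply: eq_bigr => l _; congr (_ *: ltrace (_ \o _)%VF); apply/lfunP=> v.
rewrite comp_lfunE coef_betaE edge_coefE ccompv fE gmap_gen // wcast_id.
by [].
Qed.

Lemma serre_representation : exists z : forall i, 'Hom(W (isucc (deg i)) (vtx i), mu),
  forall i u, \sum_(l | etgt l == i) esign k l *: band_muV mu l (coef_beta i l u) =
    z i (cdiff W (deg i) (vtx i) u) - \sum_(l | esrc l == i) bmu l (z (etgt l)
      (sact (W (isucc (deg (etgt l)))) (vtx i) (vtx (etgt l)) (epath l)
        (wcast W (deg i) (isucc (deg (etgt l))) (vtx i) u))).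
Proof.
have [|Z ZE] := @functional_factor _ _ _ gdiff (linfun gform_fun).
  by move=> g /gform_vanish; rewrite lfunLE //; apply: gform_linear.
have /fin_all_exists[z zE] i : exists z : 'Hom(W (isucc (deg i)) (vtx i), mu),
    forall f : 'Hom(mu, W (isucc (deg i)) (vtx i)),
      Z (dsum_inj (fun i => 'Hom(mu, W (isucc (deg i)) (vtx i)) : vectType k) i f) =
      ltrace (z \o f)%VF.
  by apply: ltrace_represents => c f f'; rewrite !linearP.
exists z => i u.
pose q : 'Hom(W (deg i) (vtx i), mu) :=
  \sum_(l | etgt l == i) esign k l *: (band_muV mu l \o coef_beta i l)%VF
  - (z i \o cdiff W (deg i) (vtx i))%VF
  + \sum_(l | esrc l == i) (bmu l \o (z (etgt l) \o
      (sact (W (isucc (deg (etgt l)))) (vtx i) (vtx (etgt l)) (epath l) \o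
        wcast W (deg i) (isucc (deg (etgt l))) (vtx i))))%VF.
suff q0 : q = 0.
  have /lfunP/(_ u) := q0; rewrite /q !add_lfunE opp_lfunE !sum_lfunE zero_lfunE comp_lfunE.
  move=> /eqP; rewrite -addrA addr_eq0 opprD opprK => /eqP E.
  rewrite (eq_bigr (fun l => (esign k l *: (band_muV mu l \o coef_beta i l)%VF) u)).
    rewrite E; congr (_ - _); apply: eq_bigr => l _.
    by rewrite !comp_lfunE.
  by move=> l _; rewrite scale_lfunE comp_lfunE.
apply: ltrace_nondegenerate => f.
pose g : gdata := dsum_inj (fun i => 'Hom(mu, W (deg i) (vtx i)) : vectType k) i f.
have gi : g i = f by rewrite /g dsum_injE dfwith_in.
have gj j : i != j -> g j = 0 by move=> ne; rewrite /g dsum_injE dfwith_out.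
have /lfunP/(_ g) := ZE; rewrite comp_lfunE (lfunLE gform_linear).
rewrite /gform_fun (bigD1 i) //= [X in _ = _ + X]big1 ?addr0 => [|j]; last first.
  rewrite eq_sym => ne; rewrite big1 // => l _.
  by rewrite gj // !comp_lfun0r linear0 scaler0.
rewrite gi (dsum_decomp (gdiff g)) linear_sum /=.
under eq_bigr do rewrite zE gdiffE comp_lfunDr linearD /=.
rewrite big_split /= (bigD1 i) //= [X in _ + X + _]big1 ?addr0 => [|j]; last first.
  by rewrite eq_sym => ne; rewrite gj // !comp_lfun0r linear0.
have H : \sum_j ltrace (z j \o - \sum_(l | etgt l == j) gterm j l (g (esrc l)))%VF =
    - ltrace ((\sum_(l | esrc l == i) (bmu l \o (z (etgt l) \o
      (sact (W (isucc (deg (etgt l)))) (vtx i) (vtx (etgt l)) (epath l) \o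
        wcast W (deg i) (isucc (deg (etgt l))) (vtx i))))%VF) \o f)%VF.
  transitivity (- \sum_j \sum_(l | etgt l == j) ltrace (z j \o gterm j l (g (esrc l)))%VF).
    rewrite -sumrN; apply: eq_bigr => j _; rewrite comp_lfunNr linearN /= comp_lfun_sumr.
    by congr (- _); rewrite linear_sum; apply: eq_bigr => l _. 
  rewrite (sum_etgt (fun j l => ltrace (z j \o gterm j l (g (esrc l)))%VF)).
  congr (- _); rewrite comp_lfun_suml linear_sum [RHS]big_mkcond; apply: eq_bigr => l _ /=.
  case: eqP => [li|/eqP ne]; last by rewrite gj 1?eq_sym // linear0 comp_lfun0r linear0.
  rewrite -[in RHS]comp_lfunA [RHS]ltraceC /gterm; case: i / li u f g gi gj q => _ f g gi _ _.
  rewrite gi !comp_lfunA; reflexivity.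
move=> E; rewrite /q !comp_lfunDl !linearD /= -addrA comp_lfunNl linearN /=.
rewrite -[X in _ + (_ + X)]opprK -H -opprD -comp_lfunA gi in E *.
rewrite E comp_lfun_suml linear_sum /= -sumrB big1 // => l _.
by rewrite -comp_lfunZl linearZ /= comp_lfunA subrr.
Qed.

Section NuMap.
Variable z : forall i, 'Hom(W (isucc (deg i)) (vtx i), mu).

Definition numap_fun n y (u : W n y) : nband ST m w mu n y :=
  nmk (fun i p => z i (wcast W n (isucc (deg i)) (vtx i) (sact (W n) y (vtx i) p u))).
Lemma numap_funE n y (u : W n y) i p : nco (numap_fun u) i p =
  z i (wcast W n (isucc (deg i)) (vtx i) (sact (W n) y (vtx i) p u)).
Proof.
rewrite nco_mk; case: ifPn => //; rewrite negb_and => /orP[ne|np].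
  rewrite /wcast; case: eqP => [E|_]; last by rewrite zero_lfunE linear0.
  by rewrite E eqxx in ne.
by rewrite sact_notin // zero_lfunE !linear0.
Qed.
Lemma numap_linear n y : linear (@numap_fun n y).
Proof.
move=> c u v; apply: nco_ext => i p _ _.
by rewrite linearP /= !numap_funE !linearP.
Qed.
Definition numap n : rhom (W n) (nband ST m w mu n).
Proof.
apply: (@mk_rhom _ _ _ _ (fun y => linfun (@numap_fun n y))) => x y t u.
rewrite (lfunLE (@numap_linear n x)) (lfunLE (@numap_linear n y)).
apply: nco_ext => i p _ hp; rewrite nco_act hp !numap_funE -sact_path.
by rewrite sact_cat // arrowsP.
Defined.
Lemma numapE n y u i p : nco (numap n y u) i p =
  z i (wcast W n (isucc (deg i)) (vtx i) (sact (W n) y (vtx i) p u)).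
Proof. by rewrite /= (lfunLE (@numap_linear n y)) numap_funE. Qed.
End NuMap.

(** The [z i] assemble to a null homotopy [numap] of [theta beta], so that [beta] and [numap]
    together form a chain map into the exact complex [ncone]. The first component of a null homotopy
    of this map is one for [beta]. *)
Theorem serre_nondegenerate : homotopic beta (czero W (shift X)).
Proof.
have [z zE] := serre_representation.
pose phi n : rhom (W n) (ncone ST m w mu n) :=
  rpairing (beta n : rhom (W n) (band (isucc n))) (numap z n).
have phiE n y u : phi n y u = (beta n y u : band (isucc n) y, numap z n y u).
  exact: rpairingE.
have phid n y u : phi (isucc n) y (cdiff W n y u) = ncone_diff m hw mu n y (phi n y u).
  rewrite !phiE ncone_diffE; congr (_, _); first by rewrite cfunv shiftv.
  apply: nco_ext => i p /isucc_inj di hp; case: n / di u => u.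
  rewrite linearD /= thetaE // ndiffE // numapE wcast_id -(sact_rmap (cdiff W (deg i))).
  have := zE i (sact (W (deg i)) y (vtx i) p u) => /eqP; rewrite eq_sym subr_eq => /eqP ->.
  congr (_ + _); apply: eq_bigr => l /eqP li.
    rewrite coef_betaE (sact_rmap (beta (deg i))).
    have := @bco_sact _ _ _ m w mu (isucc (deg i)) y (vtx i) p (beta (deg i) y u) (esrc l) (epath l).
    have hl := epath_gpath hw l; rewrite li in hl; rewrite hp hl /= => ->.
    by case: ifP => _ //; rewrite linear0 scaler0.
  rewrite numapE; congr (bmu l (z (etgt l) _)).
  have hl := epath_gpath hw l; rewrite li in hl.
  by rewrite -wcast_sact sact_cat.
have [h hE] := null_homotopy (@ncone_exact _ _ _ m _ hw mu) phid.
apply/homotopicP; exists (fun n => rcomp (rpr1 _ _) (h n)) => n x u.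
rewrite czerov subr0 !rcompv !rpr1E shiftv.
have := hE n x u; rewrite phiE; case: (h n x u) => a b.
by rewrite ncone_diffE => /(congr1 fst).
Qed.

End Serre.

(** * Degreewise split sequences *)

Section SplitExact.
Variables (k : fieldType) (G : gentle) (X E Z : cplx k G).
Variables (u : cmap X E) (v : cmap E Z).
Variables (j : forall n, rhom (Z n) (E n)) (r : forall n, rhom (E n) (X n)).
Hypothesis vj : forall n x a, v n x (j n x a) = a.
Hypothesis ru : forall n x a, r n x (u n x a) = a.
Hypothesis urjv : forall n x a, u n x (r n x a) + j n x (v n x a) = a.

Lemma vu n x a : v n x (u n x a) = 0.
Proof.
have := urjv (u n x a); rewrite ru => E0.
rewrite -(vj (v n x (u n x a))) (_ : j n x _ = 0) ?linear0 //.
by apply: (addrI (u n x a)); rewrite E0 addr0.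
Qed.

Lemma rj n x a : r n x (j n x a) = 0.
Proof.
have := urjv (j n x a); rewrite vj => E0.
rewrite -(ru (r n x (j n x a))) (_ : u n x _ = 0) ?linear0 //.
by apply: (addIr (j n x a)); rewrite E0 add0r.
Qed.

(** With respect to the decomposition of [E] by [u] and [j] the differential is triangular, and this
    is its off-diagonal entry. *)
Definition conn_comp n : rhom (Z n) (X (isucc n)) :=
  rcomp (r (isucc n)) (rcomp (cdiff E n) (j n)).

Lemma conn_compE n x a : conn_comp n x a = r (isucc n) x (cdiff E n x (j n x a)).
Proof. by rewrite /conn_comp !rcompv. Qed.

Lemma diff_j n x a : cdiff E n x (j n x a) =
  j (isucc n) x (cdiff Z n x a) + u (isucc n) x (conn_comp n x a).
Proof.
rewrite -[LHS]urjv addrC conn_compE; congr (j _ x _ + _).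
by rewrite cfunv vj.
Qed.

Lemma r_diff n x a : r (isucc n) x (cdiff E n x a) =
  cdiff X n x (r n x a) + conn_comp n x (v n x a).
Proof.
rewrite -[in LHS](urjv a) !linearD /= -cfunv ru diff_j linearD /= rj ru.
by rewrite add0r.
Qed.

Lemma conn_diff n x a : conn_comp (isucc n) x (cdiff Z n x a) =
  - cdiff X (isucc n) x (conn_comp n x a).
Proof.
apply/eqP; rewrite -addr_eq0 addrC; apply/eqP.
have := r_diff (cdiff E n x (j n x a)).
rewrite cdiff2v linear0 cfunv vj -conn_compE => <-.
by [].
Qed.

Lemma conn_exists : {t : cmap Z (shift X) | forall n x a, t n x a = conn_comp n x a}.
Proof.
apply: (@mk_cmap _ _ Z (shift X) conn_comp) => n x a.
by rewrite shiftv conn_diff.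
Qed.

Variable t : cmap Z (shift X).
Hypothesis tE : forall n x a, t n x a = conn_comp n x a.

Lemma conn_null (W1 W2 : cplx k G) (h : cmap W1 (shift W2)) :
  homotopic h (czero _ _) -> exists s : forall n, rhom (W1 n) (W2 n),
  forall n x a, h n x a = - cdiff W2 n x (s n x a) + s (isucc n) x (cdiff W1 n x a).
Proof.
move=> /homotopicP[s sE].
have [s' s'E] := @unshift (fun n => rhom (W1 n) (W2 n)) s.
exists s'; apply: isucc_ind => n x a; have := sE n x a.
by rewrite czerov subr0 shiftv !s'E.
Qed.

Lemma split_exact_lift (W : cplx k G) (h : cmap W Z) :
  homotopic (ccomp t h) (czero _ _) ->
  exists h' : cmap W E, forall n x a, v n x (h' n x a) = h n x a.
Proof.
move=> /conn_null[s sE].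
(* In the decomposition of [E], the component in [X] of the lift is the null homotopy [s] of
   [t h]. *)
pose h1 n : rhom (W n) (E n) := radd (rcomp (j n) (h n)) (rcomp (u n) (s n)).
have h1E n x a : h1 n x a = j n x (h n x a) + u n x (s n x a).
  by rewrite /h1 [radd _ _ _]/= add_lfunE !comp_lfunE.
have [|h' h'E] := @mk_cmap _ _ W E h1.
  move=> n x a; rewrite !h1E linearD /= diff_j -addrA cfunv; congr (_ + _).
  rewrite -cfunv -linearD /=; congr (u _ x _).
  by have := sE n x a; rewrite ccompv tE => ->; rewrite addrAC addNr add0r.
by exists h' => n x a; rewrite h'E h1E linearD /= vj vu addr0.
Qed.

Lemma split_exact_extension (W : cplx k G) (h : cmap X W) :
  homotopic (ccomp (shift_map h) t) (czero _ _) ->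
  exists h' : cmap E W, forall n x a, h' n x (u n x a) = h n x a.
Proof.
move=> /conn_null[s sE].
pose h1 n : rhom (E n) (W n) := radd (rcomp (h n) (r n)) (ropp (rcomp (s n) (v n))).
have h1E n x a : h1 n x a = h n x (r n x a) - s n x (v n x a).
  by rewrite /h1 [radd _ _ _]/= add_lfunE opp_lfunE !comp_lfunE.
have [|h' h'E] := @mk_cmap _ _ E W h1.
  move=> n x a; rewrite !h1E r_diff linearB linearD /= -cfunv -addrA; congr (_ + _).
  have := sE n x (v n x a); rewrite ccompv tE [shift_map h n]/= => ->.
  by rewrite cfunv addrK.
by exists h' => n x a; rewrite h'E h1E ru vu linear0 subr0.
Qed.

Lemma cone_diffE n x (a : X (isucc n) x) (e : E n x) :
  cdiff (cone u) n x (a, e) = (- cdiff X (isucc n) x a, u (isucc n) x a + cdiff E n x e).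
Proof. by rewrite /= pair_mxE /= zero_lfunE addr0 opp_lfunE. Qed.

Lemma is_ciso_id (Y : cplx k G) : is_ciso (cid Y).
Proof. by exists (cid Y); split; apply: ceq_homotopic => n x a; rewrite ccompv !cidv. Qed.

(** The comparison map from [Z] to the cone is [(- conn_comp, j)], with homotopy inverse induced by
    [v]. Commutation with the differential of the cone forces its sign, which reappears in
    [copp t]. *)
Lemma split_exact_triangle : distinguished u v (copp t).
Proof.
pose c1 n : rhom (Z n) (cone u n) := rpairing (ropp (conn_comp n)) (j n).
have c1E n x a : c1 n x a = (- conn_comp n x a, j n x a).
  by rewrite /c1 rpairingE /= opp_lfunE.
have [|c cE] := @mk_cmap _ _ Z (cone u) c1.
  move=> n x a; rewrite !c1E cone_diffE linearN opprK /=; congr (_, _).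
    by rewrite conn_diff opprK.
  by rewrite linearN diff_j addrCA addNr addr0.
pose q1 n : rhom (cone u n) (Z n) := rcopair (rzero _ _) (v n).
have q1E n x a e : q1 n x (a, e) = v n x e by rewrite /q1 rcopairE /= zero_lfunE add0r.
have [|q qE] := @mk_cmap _ _ (cone u) Z q1.
  by move=> n x [a e]; rewrite cone_diffE !q1E linearD /= vu add0r cfunv.
pose H n : rhom (cone u (isucc n)) (cone u n) :=
  rpairing (rcopair (rzero _ _) (r (isucc n))) (rzero _ _).
have HE n x a e : H n x (a, e) = (r (isucc n) x e, 0).
  by rewrite /H rpairingE rcopairE /= !zero_lfunE add0r.
exists X, E, u, (cid X), (cid E), c; split; split; try exact: is_ciso_id.
- exists q; split.
    by apply: ceq_homotopic => n x a; rewrite ccompv cidv cE qE c1E q1E vj.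
  apply: homotopic_sym; apply/homotopicP; exists H => n x [a e].
  rewrite cidv ccompv cE qE q1E c1E cone_diffE !HE cone_diffE linear0 addr0.
  congr (_, _) => /=.
    by rewrite opprK linearD /= ru r_diff [RHS]addrCA addKr.
  by rewrite addr0 -{1}(urjv e) addrK.
- by apply: ceq_homotopic => n x a; rewrite !ccompv !cidv.
- apply: homotopic_sym; apply/homotopicP.
  exists (fun n => rpairing (r (isucc n)) (rzero _ _)) => n x e.
  rewrite !ccompv cidv cE c1E !rpairingE cone_diffE /= pair_in2E !zero_lfunE linear0 addr0.
  congr (_, _) => /=.
    by rewrite sub0r opprK r_diff addKr.
  by rewrite addr0 -{1}(urjv e) addrK.
apply: ceq_homotopic => n x a; rewrite !ccompv coppv tE cE c1E /= lfunE /=.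
by rewrite pair_pr1E.
Qed.

End SplitExact.

(** * Cocones *)

Section Extension.
Variables (k : fieldType) (G : gentle) (Z W : cplx k G) (s : cmap Z (shift W)).

(* The complex Z (+) W twisted by s, that is, the cocone of s. *)
Definition ext_diff n : rhom (rpair (Z n) (W n)) (rpair (Z (isucc n)) (W (isucc n))) :=
  rpair_mx (cdiff Z n) (rzero _ _) (s n : rhom (Z n) (W (isucc n))) (cdiff W n).

Lemma ext_diffE n x (a : Z n x) (b : W n x) :
  ext_diff n x (a, b) = (cdiff Z n x a, (s n x a : W (isucc n) x) + cdiff W n x b).
Proof. by rewrite /ext_diff /= pair_mxE /= zero_lfunE addr0. Qed.

Definition ext_cplx : cplx k G.
Proof.
exists (fun n => rpair (Z n) (W n)) ext_diff.
- move=> n x; apply/lfunP=> -[a b]; rewrite comp_lfunE zero_lfunE !ext_diffE.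
  rewrite cdiff2v cfunv shiftv linearD /= cdiff2v addr0 addNr.
  by [].
- by move=> n; apply: rpair_projective; apply: cobj_projective.
have [N HN] := cobj_bounded Z; have [N' HN'] := cobj_bounded W.
exists (maxn N N') => n lt x.
have -> : dim (rpair (Z n) (W n) x) = (dim (Z n x) + dim (W n x))%N by [].
by rewrite HN ?HN' //; lia.
Defined.

Lemma ext_pr_exists : {p : cmap ext_cplx Z | forall n x a, p n x a = a.1}.
Proof.
have [|p pE] := @mk_cmap _ _ ext_cplx Z (fun n => rpr1 (Z n) (W n)).
  by move=> n x [a b]; rewrite [cdiff ext_cplx n x _]ext_diffE !rpr1E.
by exists p => n x a; rewrite pE rpr1E.
Qed.

Variable p : cmap ext_cplx Z.
Hypothesis pE : forall n x a, p n x a = a.1.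

Lemma ext_pr_null : homotopic (ccomp s p) (czero _ _).
Proof.
apply/homotopicP; exists (fun n => rpr2 (Z (isucc n)) (W (isucc n))) => n x [a b].
rewrite czerov subr0 ccompv pE shiftv /=.
rewrite !rpr2E [cdiff ext_cplx _ _ _]ext_diffE /= addrCA addNr addr0.
by [].
Qed.

(** A null homotopy of [t p] has two components: on [W] it is the chain map [e], and on [Z] it is a
    homotopy from [t] to [e s]. *)
Lemma ext_factor (Y : cplx k G) (t : cmap Z (shift Y)) :
  homotopic (ccomp t p) (czero _ _) ->
  exists e : cmap W Y, homotopic t (ccomp (shift_map e) s).
Proof.
move=> /conn_null[h hE].
have [|e eE] := @mk_cmap _ _ W Y (fun n => rcomp (h n) (rin2 (Z n) (W n))).
  move=> n x b; rewrite !rcompv /= !pair_in2E.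
  have := hE n x (0, b); rewrite ccompv pE linear0 [cdiff ext_cplx _ _ _]ext_diffE.
  by rewrite !linear0 add0r => /eqP; rewrite eq_sym addrC subr_eq0 => /eqP.
exists e; apply/homotopicP.
exists (fun n => rcomp (h (isucc n)) (rin1 (Z (isucc n)) (W (isucc n)))) => n x a.
rewrite ccompv [shift_map e _]/= eE shiftv !rcompv /= !pair_in1E !pair_in2E.
have := hE (isucc n) x (a, 0); rewrite ccompv pE /= => ->.
rewrite [cdiff ext_cplx _ _ _]ext_diffE linear0 addr0 -addrA; congr (_ + _).
rewrite -linearB /=; congr (h _ x _); apply: injective_projections => /=.
  by rewrite subr0.
by rewrite subrr.
Qed.

End Extension.

Section StrictInverse.
Variables (k : fieldType) (G : gentle).

(** All spaces are finite dimensional, so injective endomorphisms are bijective, and naturality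
    passes to the inverse maps. *)
Lemma cmap_strict_inverse (X : cplx k G) (e : cmap X X) :
  (forall n x, injective (e n x)) ->
  exists e' : cmap X X, (forall n x a, e n x (e' n x a) = a) /\
                        (forall n x a, e' n x (e n x a) = a).
Proof.
move=> inj; have k0 n x : lker (e n x) == 0%VS by apply/lker0P/inj.
have nat n x y (b : kG k x y) :
    ((e n y)^-1 \o ract (X n) b = ract (X n) b \o (e n x)^-1)%VF.
  apply/lfunP=> a; rewrite !comp_lfunE; apply: (inj n y).
  by rewrite lker0_lfunVK // (rmapE (e n)) lker0_lfunVK.
pose e1 n : rhom (X n) (X n) := RHom (nat n).
have e1K n x a : e n x (e1 n x a) = a by rewrite /= lker0_lfunVK.
have [|e' e'E] := @mk_cmap _ _ X X e1.
  by move=> n x a; apply: (inj (isucc n) x); rewrite e1K cfunv e1K.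
exists e'; split=> n x a; rewrite e'E; first exact: e1K.
by apply: (inj n x); rewrite e1K.
Qed.

End StrictInverse.

Section CSum.
Variables (k : fieldType) (G : gentle) (I : finType) (X : I -> cplx k G).

Definition ccoord n x (a : csum X n x) i : X i n x :=
  (a : dsum (fun i => X i n x)) i.

Lemma csum_diffE n x (a : csum X n x) i :
  ccoord (cdiff (csum X) n x a) i = cdiff (X i) n x (ccoord a i).
Proof. by rewrite /ccoord /= dsum_diagE. Qed.

Lemma ccoord_ext n x (a b : csum X n x) : (forall i, ccoord a i = ccoord b i) -> a = b.
Proof. by move=> E; apply/ffunP. Qed.

Section Tuple.
Variables (M : rep k G) (N : I -> rep k G) (f : forall i, rhom M (N i)).
Definition rsum_tuple_fun x (a : M x) : dsum (fun i => N i x) := [ffun i => f i x a].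
Lemma rsum_tuple_linear x : linear (@rsum_tuple_fun x).
Proof. by move=> c a b; apply/ffunP=> i; rewrite dsumDE dsumZE !ffunE linearP. Qed.
Definition rsum_tuple : rhom M (rsum N).
Proof.
exists (fun x => linfun (@rsum_tuple_fun x)) => x y e; apply/lfunP=> a; apply/ffunP=> i.
rewrite !comp_lfunE (lfunLE (@rsum_tuple_linear y)) (lfunLE (@rsum_tuple_linear x)).
rewrite dsum_diagE !ffunE; exact: (rmapE (f i)).
Defined.
Lemma rsum_tupleE x a i : (rsum_tuple x a : dsum (fun i => N i x)) i = f i x a.
Proof. by rewrite /= (lfunLE (@rsum_tuple_linear x)) ffunE. Qed.
End Tuple.

Definition rsum_proj (N : I -> rep k G) i : rhom (rsum N) (N i).
Proof.
exists (fun x => dsum_proj (fun i => N i x) i) => x y e; apply/lfunP=> a.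
by rewrite !comp_lfunE !dsum_projE dsum_diagE.
Defined.

Lemma cproj_exists i : {p : cmap (csum X) (X i) | forall n x a, p n x a = ccoord a i}.
Proof.
have [|p pE] := @mk_cmap _ _ (csum X) (X i) (fun n => rsum_proj (fun i => X i n) i).
  by move=> n x a; rewrite /= !dsum_projE dsum_diagE.
by exists p => n x a; rewrite pE /= dsum_projE.
Qed.

Lemma cinj_exists i : {p : cmap (X i) (csum X) | forall n x a l,
  ccoord (p n x a) l = dfwith (fun l => 0 : X l n x) a l}.
Proof.
have [|p pE] := @mk_cmap _ _ (X i) (csum X) (fun n => rsum_inj (fun i => X i n) i).
  move=> n x a; apply: ccoord_ext => l; rewrite csum_diffE /ccoord /= !dsum_injE.
  have [<-|ne] := eqVneq i l; first by rewrite !dfwith_in.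
  by rewrite !dfwith_out // linear0.
by exists p => n x a l; rewrite pE /ccoord /= dsum_injE.
Qed.

End CSum.

(** * Local endomorphisms and indecomposability *)

Section LocalIndecomposable.
Variables (k : fieldType) (G : gentle).

Lemma homotopic_retract0 (A Y : cplx k G) (a : cmap A Y) (e e' : cmap Y Y) :
  (forall n x b, e' n x (e n x b) = b) -> homotopic (ccomp e a) (czero A Y) ->
  homotopic a (czero A Y).
Proof.
move=> e'K /(homotopic_compl e') H.
apply: (homotopic_trans (g := ccomp e' (ccomp e a))).
  by apply: ceq_homotopic => n x b; rewrite !ccompv e'K.
apply: homotopic_trans H _; apply: ceq_homotopic => n x b.
by rewrite ccompv !czerov linear0.
Qed.

Lemma is_czero_factor (A Y : cplx k G) (a : cmap A Y) (b : cmap Y A) :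
  homotopic (ccomp b a) (cid A) -> homotopic a (czero A Y) -> is_czero A.
Proof.
move=> H /(homotopic_compl b) H0; apply: homotopic_trans (homotopic_sym H) _.
apply: homotopic_trans H0 _; apply: ceq_homotopic => n x c.
by rewrite ccompv !czerov linear0.
Qed.

(** Let [e] be the projection to the first summand, an idempotent up to homotopy. Then [e]
    annihilates the inclusion of the second summand and [1 - e] that of the first; whichever of the
    two is invertible makes the summand it annihilates zero. *)
Lemma local_indecomposable (Y : cplx k G) : ~ is_czero Y ->
  (forall e : cmap Y Y, exists e' : cmap Y Y, (forall n x a, e' n x (e n x a) = a) \/
     (forall n x a, e' n x (a - e n x a) = a)) ->
  cindecomposable Y.
Proof.
move=> Y0 loc; split=> // X1 X2 [f [g [gf fg]]].
pose X b : cplx k G := if b then X1 else X2.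
have [p pE] : {p : forall b, cmap (csum X) (X b) | forall b n x a, p b n x a = ccoord a b}.
  by exists (fun b => sval (cproj_exists X b)) => b; apply: (svalP (cproj_exists X b)).
have [q qE] : {q : forall b, cmap (X b) (csum X) | forall b n x a l,
    ccoord (q b n x a) l = dfwith (fun l => 0 : X l n x) a l}.
  by exists (fun b => sval (cinj_exists X b)) => b; apply: (svalP (cinj_exists X b)).
have pq b : homotopic (ccomp (ccomp (p b) f) (ccomp g (q b))) (cid (X b)).
  apply: (homotopic_trans (g := ccomp (p b) (ccomp (ccomp f g) (q b)))).
    by apply: ceq_homotopic => n x a; rewrite !ccompv.
  apply: (homotopic_trans (g := ccomp (p b) (q b))).
    apply: homotopic_compl; apply: homotopic_trans (homotopic_compr (q b) fg) _.
    by apply: ceq_homotopic => n x a; rewrite ccompv cidv.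
  by apply: ceq_homotopic => n x a; rewrite ccompv cidv pE qE dfwith_in.
pose e := ccomp g (ccomp (ccomp (q true) (p true)) f).
have eq b : homotopic (ccomp e (ccomp g (q b)))
    (ccomp g (ccomp (q true) (ccomp (p true) (q b)))).
  apply: (homotopic_trans (g := ccomp (ccomp g (ccomp (q true) (p true)))
     (ccomp (ccomp f g) (q b)))).
    by apply: ceq_homotopic => n x a; rewrite !ccompv.
  apply: homotopic_trans (homotopic_compl _ (homotopic_compr (q b) fg)) _.
  by apply: ceq_homotopic => n x a; rewrite !ccompv cidv.
have [e' [e'K|e'K]] := loc e.
  right; apply: (is_czero_factor (pq false)); apply: (homotopic_retract0 e'K).
  apply: homotopic_trans (eq false) _; apply: ceq_homotopic => n x a.
  rewrite !ccompv czerov pE qE dfwith_out // !linear0.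
  by [].
left; apply: (is_czero_factor (pq true)).
apply: (@homotopic_retract0 _ _ _ (cadd (cid Y) (copp e)) e').
  by move=> n x a; rewrite caddv coppv cidv e'K.
have /homotopicP[h hE] := eq true; apply/homotopicP; exists (fun n => ropp (h n)) => n x a.
rewrite czerov subr0 ccompv caddv coppv cidv /= !opp_lfunE linearN -opprD -hE opprB.
congr (_ - _); last by rewrite !ccompv.
have pqK : p true (isucc n) x (q true (isucc n) x a) = a by rewrite pE qE dfwith_in.
by rewrite comp_lfunE !ccompv pqK.
Qed.

End LocalIndecomposable.

(** * Endomorphisms of band complexes *)

Section BandFunctor.
Variables (k : fieldType) (G : gentle) (ST : string_functions G) (m : int).
Variables (w : word G) (hw : homotopy_band ST w).
Notation L := (size (parts ST w)).
Implicit Types (A B C : autom k) (i j l : 'I_L).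
Notation Y mu := (band_cplx m hw mu).
Notation band n mu := (band_obj ST m w mu n).
Notation bco a i p := (bco_at i p a).
Notation Bmap phi n := (@bmap k G ST m w _ _ phi n).

Lemma band_mu_nat A B (phi : ahom A B) l v :
  phi (@band_mu k G ST w A l v) = @band_mu k G ST w B l (phi v).
Proof. by rewrite /band_mu; case: ifP => _; [rewrite amapv|rewrite !lfunE]. Qed.

Lemma bmap_diff A B (phi : ahom A B) n x a :
  Bmap phi (isucc n) x (band_diff ST m w A n x a) = band_diff ST m w B n x (Bmap phi n x a).
Proof.
apply: bco_ext => i r _ _; rewrite bco_map !bco_diff // linear_sum /=.
apply: eq_bigr => l _; case: ifP => _; last by rewrite linear0.
by rewrite band_mu_nat bco_map.
Qed.

Lemma bmap_comp A B C (phi : 'Hom(A, B)) (psi : 'Hom(B, C)) n x a :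
  Bmap psi n x (Bmap phi n x a) = Bmap (psi \o phi)%VF n x a.
Proof. by apply: bco_ext => i r _ _; rewrite !bco_map comp_lfunE. Qed.
Lemma bmap_id A n x (a : band n A x) : Bmap (\1%VF : 'Hom(A, A)) n x a = a.
Proof. by apply: bco_ext => i r _ _; rewrite bco_map lfunE. Qed.
Lemma bmap_add A B (phi psi : 'Hom(A, B)) n x a :
  Bmap (phi + psi) n x a = Bmap phi n x a + Bmap psi n x a.
Proof.
by apply: bco_ext => i r _ _; rewrite linearD /= !bco_map add_lfunE.
Qed.

Lemma band_cmap_exists A B (phi : ahom A B) :
  {f : cmap (Y A) (Y B) | forall n x a, f n x a = Bmap phi n x a}.
Proof.
apply: (@mk_cmap _ _ (Y A) (Y B) (fun n => Bmap phi n)) => n x a.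
exact: bmap_diff.
Qed.

Lemma mcoef_comp_map A B C (phi : ahom B C) (f : cmap (Y A) (Y B)) (h : cmap (Y A) (Y C)) i j p v :
  (forall n x a, h n x a = Bmap phi n x (f n x a)) ->
  mcoef h i j p v = phi (mcoef f i j p v).
Proof. by move=> hE; rewrite /mcoef hE bco_map. Qed.

Lemma bmap_gen A B (phi : 'Hom(A, B)) n i v :
  Bmap phi n (band_vertex i) (bgen m n i v) = bgen m n i (phi v).
Proof.
apply: bco_ext => j p _ _; rewrite bco_map !bco_mk.
by do 2?[case: ifP => _]; rewrite ?linear0.
Qed.

Lemma mcoef_map_comp A B C (phi : ahom A B) (f : cmap (Y B) (Y C)) (h : cmap (Y A) (Y C)) i j p v :
  (forall n x a, h n x a = f n x (Bmap phi n x a)) ->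
  mcoef h i j p v = mcoef f i j p (phi v).
Proof. by move=> hE; rewrite /mcoef hE bmap_gen. Qed.

Lemma mcoef_id A (f : cmap (Y A) (Y A)) i v : (forall n x a, f n x a = a) ->
  mcoef f i i [::] v = v.
Proof. by move=> fE; rewrite /mcoef fE bco_gen // !eqxx. Qed.

(* The differentials involve nontrivial paths only, hence do not contribute. *)
Lemma mcoef_homotopic A B (f g : cmap (Y A) (Y B)) i v : homotopic f g ->
  mcoef f i i [::] v = mcoef g i i [::] v.
Proof.
move=> /homotopicP[h hE]; apply/eqP; rewrite -subr_eq0.
have [n dn] : exists n, band_degree m i = isucc n.
  by exists (band_degree m i - 1); rewrite /isucc subrK.
rewrite -!(mcoefE _ _ _ _ dn) -linearB /= hE linearD /=; apply/eqP.
rewrite (@bco_diff _ _ _ _ _ hw) big1 ?add0r => [|l _]; last first.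
  by rewrite suffixs0 (negPf (epath_neq0 l)) andbF.
rewrite (@band_diff_gen _ _ _ _ _ hw) // !linear_sum big1 // => l _ /=.
rewrite (sact_rmap (h (isucc n))).
have := @bco_sact _ _ _ m w B (isucc n) (band_vertex (esrc l)) (band_vertex i) (epath l).
move=> ->.
by rewrite prefixs0 (negPf (epath_neq0 l)) !andbF.
Qed.

Section Endomorphisms.
Variables (A : autom k) (Aind : aindecomposable A).

Lemma eps_iso (e : cmap (Y A) (Y A)) : (forall i, injective (mcoef e i i [::])) ->
  exists e' : cmap (Y A) (Y A), (forall n x a, e n x (e' n x a) = a) /\
                                (forall n x a, e' n x (e n x a) = a).
Proof. by move=> inj; apply: cmap_strict_inverse; apply: eps_injective. Qed.

(** The diagonal coefficients of [e] and of [1 - e] are [phi] and [1 - phi]. One of these is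
    injective by [aindecomposable_local], and [eps_iso] inverts the corresponding chain map. *)
Lemma band_local (e : cmap (Y A) (Y A)) : exists e' : cmap (Y A) (Y A),
  (forall n x a, e' n x (e n x a) = a) \/ (forall n x a, e' n x (a - e n x a) = a).
Proof.
have [phi phiE] := eps_ahom e; have [inj|inj] := aindecomposable_local phi Aind.
  have [|e' [_ e'K]] := @eps_iso e; last by exists e'; left.
  by move=> i a b; rewrite -!phiE; apply: inj.
have [|e' [_ e'K]] := @eps_iso (cadd (cid (Y A)) (copp e)).
  move=> i a b; rewrite /mcoef !caddv !coppv !cidv !linearB /= => E.
  apply: inj; move: E; rewrite !bco_gen // !eqxx /=.
  by rewrite -!/(mcoef e i i [::] _) -!phiE.
exists e'; right=> n x a; have := e'K n x a; rewrite caddv coppv cidv.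
by [].
Qed.

Lemma band_indecomposable : cindecomposable (Y A).
Proof.
have [A0 _] := Aind; apply: local_indecomposable; last exact: band_local.
move=> /mcoef_homotopic H; apply: A0; apply/eqP; rewrite -subv0; apply/subvP=> v _.
have := H (eps0 hw) v; rewrite mcoef_id => [->|n x a]; last exact: cidv.
by rewrite /mcoef czerov linear0 memv0.
Qed.

End Endomorphisms.

Section SumOfBands.
Variables (I : finType) (mu : I -> autom k).

Definition aproj (i : I) : 'Hom(asum mu, mu i) := dsum_proj (fun i : I => mu i) i.
Lemma aprojE (i : I) (v : asum mu) : aproj i v = (v : dsum (fun i : I => mu i)) i.
Proof. exact: dsum_projE. Qed.

Definition sum_in n : rhom (band n (asum mu)) (csum (fun i : I => Y (mu i)) n) :=
  rsum_tuple (fun i : I => Bmap (aproj i) n).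
Lemma sum_inE n x a (i : I) : ccoord (sum_in n x a) i = Bmap (aproj i) n x a.
Proof. exact: rsum_tupleE. Qed.

Lemma aproj_mu (i : I) l v :
  aproj i (@band_mu k G ST w (asum mu) l v) = @band_mu k G ST w (mu i) l (aproj i v).
Proof.
rewrite /band_mu; case: ifP => _; last by rewrite !lfunE.
by rewrite !aprojE dsum_diagE.
Qed.

(** The two maps are strictly inverse to each other, not only up to homotopy; thus the sequence
    remains degreewise split when the direct sum of band complexes becomes its middle term. *)
Lemma sum_iso_exists :
  {i1 : cmap (Y (asum mu)) (csum (fun i : I => Y (mu i))) &
  {i2 : cmap (csum (fun i : I => Y (mu i))) (Y (asum mu)) |
    (forall n x a, i2 n x (i1 n x a) = a) /\ (forall n x a, i1 n x (i2 n x a) = a)}}.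
Proof.
have [|i1 i1E] := @mk_cmap _ _ (Y (asum mu)) (csum (fun i : I => Y (mu i))) sum_in.
  move=> n x a; apply: ccoord_ext => i; rewrite csum_diffE !sum_inE.
  apply: bco_ext => j p _ _; rewrite bco_map !(bco_diff hw) linear_sum.
  apply: eq_bigr => l _; rewrite bco_map; case: ifP => _ /=; last by rewrite linear0.
  by rewrite aproj_mu.
have inj n x : injective (sum_in n x).
  move=> a b E; apply: bco_ext => j p _ _; apply/ffunP=> i.
  have := congr1 (fun c => ccoord c i) E; rewrite !sum_inE.
  move=> /(congr1 (fun c => bco c j p)); rewrite !bco_map !aprojE.
  by [].
pose J n x (c : csum (fun i : I => Y (mu i)) n x) : band n (asum mu) x :=
  @bmk k G ST m w (asum mu) n x
    (fun j p => [ffun i : I => bco (ccoord c i : band n (mu i) x) j p] : dsum (fun i : I => mu i)).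
have JK n x c : sum_in n x (J n x c) = c.
  apply: ccoord_ext => i; rewrite sum_inE; apply: bco_ext => j p dj hp.
  by rewrite bco_map bco_mk dj hp eqxx /= aprojE ffunE.
have k0 n x : lker (sum_in n x) == 0%VS by apply/lker0P/inj.
have JE n x c : (sum_in n x)^-1%VF c = J n x c.
  by apply: (inj n x); rewrite JK -{1}(JK n x c) lker0_lfunK.
have nat n x y (e : kG k x y) :
    ((sum_in n y)^-1 \o ract (csum (fun i : I => Y (mu i)) n) e =
     ract (band n (asum mu)) e \o (sum_in n x)^-1)%VF.
  apply/lfunP=> c; rewrite !comp_lfunE; apply: (inj n y).
  by rewrite (rmapE (sum_in n)) !JE !JK.
pose s2 n : rhom (csum (fun i : I => Y (mu i)) n) (band n (asum mu)) := RHom (nat n).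
have s2E n x c : s2 n x c = J n x c by apply: JE.
have [|i2 i2E] := @mk_cmap _ _ (csum (fun i : I => Y (mu i))) (Y (asum mu)) s2.
  move=> n x c; apply: (inj (isucc n) x); rewrite !s2E JK.
  have := cfunv i1 (n := n) (s2 n x c); rewrite !i1E s2E JK => ->.
  by [].
exists i1, i2; split=> n x a; rewrite i2E s2E i1E ?JK //.
by apply: (inj n x); rewrite JK.
Qed.
End SumOfBands.

End BandFunctor.

(** * Almost split triangles *)

Lemma split_linear (k : fieldType) (U V T : vectType k) (f : 'Hom(U, V)) (g : 'Hom(V, T)) :
  lker f = 0%VS -> limg f = lker g -> limg g = fullv ->
  {r : 'Hom(V, U) & {j : 'Hom(T, V) |
    [/\ (g \o j)%VF = \1%VF, (r \o f)%VF = \1%VF & (f \o r)%VF + (j \o g)%VF = \1%VF]}}.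
Proof.
move=> f0 fg g1; pose j := (g^-1)%VF; pose r := (f^-1 \o (\1%VF - (j \o g)%VF)%R)%VF.
have gj v : g (j v) = v by apply: limg_fullP.
have gf u : g (f u) = 0.
  by apply/eqP; rewrite -memv_ker -fg memv_img ?memvf.
exists r, j; split; apply/lfunP=> v.
- by rewrite comp_lfunE gj lfunE.
- rewrite /r !comp_lfunE add_lfunE opp_lfunE comp_lfunE gf linear0 subr0 !lfunE /=.
  by rewrite lker0_lfunK // f0.
rewrite add_lfunE /r !comp_lfunE add_lfunE opp_lfunE comp_lfunE lfunE /= limg_lfunVK.
  by rewrite subrK.
by rewrite fg memv_ker linearB /= gj subrr.
Qed.

Section AlmostSplit.
Variables (k : fieldType) (G : gentle).

(* Here t is the connecting map of the sequence of complexes defined by u and v. *)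
Variables (X E Z : cplx k G) (u : cmap X E) (v : cmap E Z) (t : cmap Z (shift X)).
Hypothesis lift : forall (W : cplx k G) (h : cmap W Z),
  homotopic (ccomp t h) (czero _ _) -> exists h' : cmap W E, homotopic (ccomp v h') h.
Hypothesis extension : forall (W : cplx k G) (h : cmap X W),
  homotopic (ccomp (shift_map h) t) (czero _ _) ->
  exists h' : cmap E W, homotopic (ccomp h' u) h.
Hypothesis local : forall e : cmap X X, exists e' : cmap X X,
  (forall n x a, e' n x (e n x a) = a) \/ (forall n x a, e' n x (a - e n x a) = a).
Hypothesis v_nonsplit : ~ split_epi v.
Hypothesis kills : forall (W : cplx k G) (h : cmap W Z), ~ split_epi h ->
  homotopic (ccomp t h) (czero _ _).

Lemma right_almost_split_of_kills : right_almost_split v.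
Proof. by split=> // W h nh; apply: lift; apply: kills. Qed.

(* If h t is nonzero then the cocone of h t is not split over Z, so t = e h t for
   some e, and e h is neither invertible nor in the radical. *)
Lemma left_almost_split_of_kills : ~ split_mono u -> left_almost_split u.
Proof.
move=> u_nonsplit; split=> // W h nh; apply: extension.
pose s := ccomp (shift_map h) t; have [p pE] := ext_pr_exists s.
(* If [p] has a section, [s] is null-homotopic because [s p] is. *)
have [[sg sgE]|nsp] := classic (split_epi p).
  apply: (homotopic_trans (g := ccomp (ccomp s p) sg)).
    apply: homotopic_sym; apply: (homotopic_trans (g := ccomp s (ccomp p sg))).
      by apply: ceq_homotopic => n x a; rewrite !ccompv.
    apply: homotopic_trans (homotopic_compl s sgE) _.
    by apply: ceq_homotopic => n x a; rewrite ccompv cidv.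
  apply: homotopic_trans (homotopic_compr sg (ext_pr_null pE)) _.
  by apply: ceq_homotopic => n x a; rewrite ccompv !czerov.
have [e0 te0] := ext_factor pE (kills nsp).
have [e' [e'K|e'K]] := local (ccomp e0 h).
  case: nh; exists (ccomp e' e0); apply: ceq_homotopic => n x a.
  by have := e'K n x a; rewrite !ccompv cidv.
(* Here [1 - e0 h] is invertible and [(1 - e0 h) t] is null-homotopic. Hence so is [t], and the
   identity of [Z] lifts to a section of [v]. *)
case: v_nonsplit; apply: lift.
apply: (homotopic_trans (g := ccomp (shift_map e')
   (cadd t (copp (ccomp (shift_map e0) s))))).
  apply: ceq_homotopic => n x a; rewrite !ccompv cidv caddv coppv !ccompv /=.
  by have := e'K (isucc n) x (t n x a); rewrite ccompv => ->.
apply: (homotopic_trans (g := ccomp (shift_map e') (czero _ _))); last first.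
  by apply: ceq_homotopic => n x a; rewrite ccompv !czerov linear0.
apply: homotopic_compl; move/homotopicP: te0 => [q qE]; apply/homotopicP.
by exists q => n x a; rewrite -qE caddv coppv czerov subr0.
Qed.

End AlmostSplit.

(** * The connecting map of a sequence of automorphisms *)

Section Main.
Variables (k : fieldType) (G : gentle) (ST : string_functions G) (m : int).
Variables (w : word G) (hw : homotopy_band ST w) (n : nat).
Variables (mu' : autom k) (mu : 'I_n -> autom k) (mu'' : autom k).
Variables (f : ahom mu' (asum mu)) (g : ahom (asum mu) mu'').
Hypothesis ind' : aindecomposable mu'.
Hypothesis ind'' : aindecomposable mu''.
Hypothesis fg : almost_split_sequence f g.
Notation Y mu := (band_cplx m hw mu).
Notation E := (csum (fun i : 'I_n => band_cplx m hw (mu i))).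
Notation band d mu := (band_obj ST m w mu d).
Notation bco a i p := (bco_at i p a).
Notation Bmap phi d := (@bmap k G ST m w _ _ phi d).

Variables (r : 'Hom(asum mu, mu')) (j : 'Hom(mu'', asum mu)).
Hypothesis gj : (g \o j)%VF = \1%VF.
Hypothesis rf : (r \o f)%VF = \1%VF.
Hypothesis frjg : (f \o r)%VF + (j \o g)%VF = \1%VF.

Variable t : cmap (Y mu'') (shift (Y mu')).
Hypothesis tE : forall d x a, t d x a =
  Bmap r (isucc d) x (band_diff ST m w (asum mu) d x (Bmap j d x a)).

(** Among the edges starting at [esrc l] only [l] can produce the path [epath l], and it does so
    from the trivial path at [etgt l]. *)
Lemma connecting_coef (e : cmap (Y mu') (Y mu'')) l v :
  edge_coef (ccomp t e) l v =
  r (@band_mu k G ST w (asum mu) l (j (mcoef e (etgt l) (etgt l) [::] v))).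
Proof.
rewrite edge_coefE ccompv tE bco_map (bco_diff hw) (bigD1 l) //=.
rewrite epath_gpath // suffix_refl [chop _ _]/chop subnn take0 big1 ?addr0 => [|l' /andP[/eqP e1 n1]].
  by congr (r (band_mu _ _ _)); rewrite bco_map.
case: ifP => // /andP[_ /suffixP[q qE]]; case/eqP: n1; apply: (esrc_inj hw e1).
by rewrite qE oside_cat ?epath_neq0.
Qed.

(** The lift [psi] gives [phi = g psi]; with [j g = 1 - f r] and [r f = 1] the edge coefficient
    becomes [ps bm - bm ps], where [ps = r psi], and cyclicity of the trace applies. *)
Lemma connecting_form (e : cmap (Y mu') (Y mu'')) (phi : ahom mu' mu'') :
  (forall i v, phi v = mcoef e i i [::] v) -> ~ asplit_epi phi ->
  serre_form (ccomp t e) = 0.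
Proof.
move=> phiE nphi; have [_ [_ [_ /(_ _ _ nphi)[psi psiE]]]] := fg.
rewrite /serre_form big1 // => l _.
suff -> : ltrace (band_muV mu' l \o edge_coef (ccomp t e) l)%VF = 0 by rewrite scaler0.
pose ps := (r \o psi)%VF; pose bm := @band_mu k G ST w mu' l.
have -> : edge_coef (ccomp t e) l = (ps \o bm)%VF - (bm \o ps)%VF.
  apply/lfunP=> v; rewrite connecting_coef -phiE add_lfunE opp_lfunE !comp_lfunE.
  have /lfunP/(_ v) := psiE; rewrite comp_lfunE => <-.
  have /lfunP/(_ (psi v)) := frjg; rewrite add_lfunE !comp_lfunE [RHS]lfunE /=.
  move=> H; have E0 : j (g (psi v)) = psi v - f (r (psi v)).
    by apply/eqP; rewrite eq_sym subr_eq addrC H.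
  rewrite E0 !linearB /= (band_mu_nat psi).
  rewrite -(band_mu_nat f); congr (_ - _).
  by have /lfunP/(_ (bm (r (psi v)))) := rf; rewrite comp_lfunE lfunE.
rewrite comp_lfunDr comp_lfunNr linearD linearN /= comp_lfunA ltraceC !comp_lfunA.
have bmV : (bm \o band_muV mu' l)%VF = \1%VF.
  by apply/lfunP=> v; rewrite comp_lfunE band_muVK lfunE.
have bVm : (band_muV mu' l \o bm)%VF = \1%VF.
  by apply/lfunP=> v; rewrite comp_lfunE band_muK lfunE.
by rewrite bmV bVm subrr.
Qed.

(** Were the morphism [phi] of [h e0] a split epimorphism, its section would induce a chain map [s1]
    such that [h e0 s1] has identity diagonal coefficients. This composite would be invertible by
    [eps_iso], and [h] a split epimorphism. *)
Lemma connecting_kills (W : cplx k G) (h : cmap W (Y mu'')) : ~ split_epi h ->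
  homotopic (ccomp t h) (czero _ _).
Proof.
move=> nh; apply: serre_nondegenerate => e0.
have -> : serre_form (ccomp (ccomp t h) e0) = serre_form (ccomp t (ccomp h e0)).
  apply: eq_bigr => l _; congr (_ *: ltrace (_ \o _)%VF); apply/lfunP=> v.
  by rewrite !edge_coefE !ccompv.
have [phi phiE] := eps_ahom (ccomp h e0).
apply: (connecting_form phiE) => -[s sE]; apply: nh.
have [s1 s1E] := band_cmap_exists m hw s.
have [|c [cK _]] := @eps_iso _ _ _ m _ hw mu'' (ccomp (ccomp h e0) s1).
  move=> i a b; rewrite !(@mcoef_map_comp _ _ _ _ _ _ _ _ _ s (ccomp h e0)) -?phiE.
  - by have /lfunP E0 := sE; have := E0 a; have := E0 b; rewrite !comp_lfunE !lfunE /= => -> ->.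
  - by move=> d x c; rewrite [LHS]ccompv s1E.
  by move=> d x c; rewrite [LHS]ccompv s1E.
exists (ccomp e0 (ccomp s1 c)); apply: ceq_homotopic => d x a.
by have := cK d x a; rewrite !ccompv cidv.
Qed.

End Main.

Theorem mainTheorem1 (k : fieldType) (G : gentle) (ST : string_functions G)
  (m : int) (w : word G) (hw : homotopy_band ST w)
  (n : nat) (mu' : autom k) (mu : 'I_n -> autom k) (mu'' : autom k)
  (f : ahom mu' (asum mu)) (g : ahom (asum mu) mu'') :
  aindecomposable mu' ->
  (forall i, aindecomposable (mu i)) ->
  aindecomposable mu'' ->
  almost_split_sequence f g ->
  exists (u : cmap (band_cplx m hw mu') (csum (fun i => band_cplx m hw (mu i))))
         (v : cmap (csum (fun i => band_cplx m hw (mu i))) (band_cplx m hw mu''))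
         (t : cmap (band_cplx m hw mu'') (shift (band_cplx m hw mu'))),
    almost_split_triangle u v t.
Proof.
move=> ind' _ ind'' fg; have [[f0 fgE g1] [[nf _] [ng _]]] := fg.
have [r [j [gj rf frjg]]] := split_linear f0 fgE g1.
have [F FE] := band_cmap_exists m hw f.
have [H HE] := band_cmap_exists m hw g.
have [i1 [i2 [i2K i1K]]] := sum_iso_exists m hw mu.
pose u := ccomp i1 F; pose v := ccomp H i2.
pose J d : rhom (band_cplx m hw mu'' d) (csum (fun i => band_cplx m hw (mu i)) d) :=
  rcomp (i1 d) (@bmap k G ST m w _ _ j d).
pose R d : rhom (csum (fun i => band_cplx m hw (mu i)) d) (band_cplx m hw mu' d) :=
  rcomp (@bmap k G ST m w _ _ r d) (i2 d).
have vJ d x a : v d x (J d x a) = a.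
  by rewrite ccompv rcompv i2K HE bmap_comp gj bmap_id.
have Ru d x a : R d x (u d x a) = a.
  by rewrite ccompv rcompv i2K FE bmap_comp rf bmap_id.
have uRJv d x a : u d x (R d x a) + J d x (v d x a) = a.
  rewrite !ccompv !rcompv FE HE !bmap_comp -[RHS]i1K -{3}[i2 d x a]bmap_id -frjg.
  by rewrite bmap_add GRing.linearD.
have [t tE] := conn_exists vJ Ru uRJv.
have tE' d x a : t d x a = bmap ST m w r (isucc d) x
    (band_diff ST m w (asum mu) d x (bmap ST m w j d x a)).
  rewrite tE conn_compE !rcompv; congr (bmap _ _ _ _ _ _ _).
  by rewrite -(cfunv i1) i2K.
have kills := connecting_kills fg rf frjg tE'.
(* Diagonal coefficients are homotopy invariant; those of [r0 i1] form a morphism of automorphisms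
   that would be a retraction of [f]. *)
have unsplit : ~ split_mono u.
  move=> [r0 /mcoef_homotopic H0]; apply: nf.
  have [psi psiE] := eps_ahom (ccomp r0 i1).
  exists psi; apply/lfunP=> a; rewrite comp_lfunE [RHS]lfunE (psiE (eps0 hw)).
  rewrite -(@mcoef_map_comp _ _ _ _ _ hw _ _ _ f (ccomp r0 i1) (ccomp r0 u)).
    by rewrite H0 mcoef_id // => d x b; apply: cidv.
  by move=> d x b; rewrite !ccompv FE.
have vnsplit : ~ split_epi v.
  move=> [s0 /mcoef_homotopic H0]; apply: ng.
  have [psi psiE] := eps_ahom (ccomp i2 s0).
  exists psi; apply/lfunP=> a; rewrite comp_lfunE [RHS]lfunE (psiE (eps0 hw)).
  rewrite -(@mcoef_comp_map _ _ _ _ _ hw _ _ _ g (ccomp i2 s0) (ccomp v s0)).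
    by rewrite H0 mcoef_id // => d x b; apply: cidv.
  by move=> d x b; rewrite !ccompv HE.
have lift W (h : cmap W (band_cplx m hw mu'')) :
    homotopic (ccomp t h) (czero _ _) -> exists h', homotopic (ccomp v h') h.
  move=> /(split_exact_lift vJ Ru uRJv tE)[h' h'E]; exists h'.
  by apply: ceq_homotopic => d x a; rewrite ccompv h'E.
have ext W (h : cmap (band_cplx m hw mu') W) :
    homotopic (ccomp (shift_map h) t) (czero _ _) -> exists h', homotopic (ccomp h' u) h.
  move=> /(split_exact_extension vJ Ru uRJv tE)[h' h'E]; exists h'.
  by apply: ceq_homotopic => d x a; rewrite ccompv h'E.
exists u, v, (copp t); split.
- exact: split_exact_triangle vJ Ru uRJv _ tE.
- exact: band_indecomposable.
- exact: band_indecomposable.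
- exact: left_almost_split_of_kills lift ext (band_local ind') vnsplit kills unsplit.
exact: right_almost_split_of_kills lift vnsplit kills.
Qed.
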